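(* Let $z \geq 0$ be fixed, and put $\lambda_z := e^{-z}$ and $\gamma_z := \lambda_z(1 - 2z\lambda_z)$. For integers $n \ge 1$ let $p_1(n) < p_2(n) < \dots < p_{\omega(n)}(n)$ be the distinct prime factors of $n$, and define $$G(n; z) := \bigl|\{1 \leq j < \omega(n) : p_{j+1}(n) > p_j(n)^{\exp z}\}\bigr|,$$ and, for $N \ge 1$ and $1 \le n \le N$, $G_N^*(n; z) := G(n; z) - \lambda_z \log_2 (2N)$. Let $\Phi(t) := \frac{1}{\sqrt{2\pi}} \int_{-\infty}^t e^{-y^2/2}\, dy$. Then, uniformly for $t \in \mathbb{R}$ and $N \geq 16$, $$\frac{1}{N} \sum_{\substack{n \leq N \\ G_N^*(n; z) \leq t \sqrt{\gamma_z \log_2 N}}} 1 = \Phi(t) + O\!\left(\frac{\log_3 N}{\sqrt{\log_2 N}}\right).$$ Moreover, for any given non-negative integer $r$, for $N\ge 16$, $$\frac{1}{N} \sum_{n \leq N} G_N^*(n; z)^r = (\gamma_z \log_2 N)^{r/2} \left\{ \mu_r + O\!\left(\frac{(\log_3 N)^{1+r/2}}{\sqrt{\log_2 N}}\right) \right\},$$ where $\mu_r$ is the $r$th moment of the standard normal law. This last formula also holds for every real $r \geq 0$ provided $G_N^*(n; z)^r$ is replaced by $|G_N^*(n; z)|^r$ and $\mu_r$ is replaced by $2^{r/2}\Gamma(\tfrac12 r + \tfrac12)/\sqrt{\pi}$.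
   Context: $\log_k$ denotes the $k$-fold iterated natural logarithm (so $\log_2 x = \log\log x$, $\log_3 x = \log\log\log x$). $\omega(n)$ is the number of distinct prime factors of $n$. The implied constants in the $O$-terms may depend on $z$ (and, for the moment estimates, on $r$), but not on $t$ or $N$. The $r$th moment of the standard normal law is $\mu_r = \frac{1}{\sqrt{2\pi}}\int_{\mathbb{R}} y^r e^{-y^2/2}\,dy$. *)

(* Defs.v *)
From HB Require Import structures.
From mathcomp Require Import all_boot all_order all_algebra.
From mathcomp Require Import all_classical all_reals all_analysis.

Set Implicit Arguments.
Unset Strict Implicit.
Unset Printing Implicit Defensive.

Import Order.TTheory GRing.Theory Num.Theory.
Import numFieldNormedType.Exports.

Local Open Scope classical_set_scope.
Local Open Scope ring_scope.

Definition log_iter {R : realType} (k : nat) (x : R) : R := iter k (@ln R) x.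

Definition omega (n : nat) : nat := size (primes n).

(* The primes are numbered from 1; the value is 0 unless 1 <= j <= omega n
   (except that j = 0 also gives the first prime). *)
Definition prime_nth (n j : nat) : nat := nth 0%N (primes n) j.-1.

(* As [j] ranges over ['I_(omega n)], the bound [0 < j] leaves exactly the
   indices 1 <= j < omega n. *)
Definition gap_count {R : realType} (z : R) (n : nat) : nat :=
  #|[pred j : 'I_(omega n) | (0 < j)%N &&
       ((prime_nth n j)%:R `^ expR z < (prime_nth n j.+1)%:R :> R)]|.

Definition lambda {R : realType} (z : R) : R := expR (- z).

Definition gamma {R : realType} (z : R) : R :=
  lambda z * (1 - 2 * z * lambda z).

Definition gap_dev {R : realType} (z : R) (N n : nat) : R :=
  (gap_count z n)%:R - lambda z * log_iter 2 (2 * N%:R).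

Definition Phi {R : realType} (t : R) : R :=
  (Num.sqrt (2 * pi))^-1 *
  \int[lebesgue_measure]_(y in `]-oo, t]) expR (- (y ^+ 2 / 2)).

Definition normal_moment {R : realType} (r : nat) : R :=
  (Num.sqrt (2 * pi))^-1 *
  \int[lebesgue_measure]_(y in [set: R]) (y ^+ r * expR (- (y ^+ 2 / 2))).

Definition Gamma {R : realType} (s : R) : R :=
  \int[lebesgue_measure]_(x in `]0, +oo[) (x `^ (s - 1) * expR (- x)).

(* Main.v *)
(* Write T = log log N. Up to the correction 1 for n > 1, G(n; z) counts the prime
   factors p of n such that n has no prime factor k with k < p <= k^(exp z). The
   set of prime factors of a random n <= N below m = exp(log N / (100 T)) is
   compared, through its Moebius coefficients and with error O(exp(-T)), to a
   random set of primes containing each p independently with probability 1 / p,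
   and n has O(log T) prime factors beyond m, except for few n. In the
   independent model the count is a sum of indicators attached to windows
   [p^(exp(-z)), p]; indicators with disjoint windows are independent, and at most
   one indicator is nonzero among those whose windows share a point. Stein's
   method for local dependence then gives a Berry-Esseen bound O(1 / sqrt T) and
   a Chernoff bound, and the estimates of Mertens give the mean
   lambda T + O(log T) and the variance gamma T + O(log T). Replacing the exact
   centering by lambda T and the count by that of the model shifts everything by
   O(log T), which costs O(log T / sqrt T) in the distribution function.
   For the moments, the distribution function controls the part below
   K sqrt(log T) standard deviations, and Chernoff's bound with a crude moment
   bound controls the rest. *)
Require Import Defs.
From HB Require Import structures.
From mathcomp Require Import all_boot all_order all_algebra.
From mathcomp Require Import all_classical all_reals all_analysis.
From mathcomp Require Import measurable_realfun zify ring lra.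

Import Order.TTheory GRing.Theory Num.Theory.
Import numFieldNormedType.Exports.

Local Open Scope ring_scope.

(** Two effects compete in the rate. The Stein error is only 1 / sqrt T; the factor log T comes from
    cutting at m, since the primes between m and N have reciprocal sum about log T, and this shift
    of the count is divided by a standard deviation of order sqrt T. The constant 100 leaves room
    for Moebius coefficients of sets of up to 13 T primes: a product of so many primes below m stays
    below N^0.13, while truncating the expansion there gains a factor exp(-6 T) against an
    exponential moment of order exp(4 T). The obstacle for Stein's method is that a window holds an
    unbounded number of primes, so local sums cannot be bounded by counting their terms; they are
    split into a fixed number of families whose indicators exclude each other. The factor 1 - 2 z
    exp(-z) in gamma arises because the indicators with index in one window have total mean about z
    exp(-z), and each exclusion enters the variance twice. For moments, a distance d between
    distribution functions costs b^r d once the variable is capped at b. Taking b of order sqrt(log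
    T) turns d of order log T / sqrt T into (log T)^(1 + r/2) / sqrt T, the stated error. *)

Section CalculusAux.
Local Open Scope classical_set_scope.
Local Open Scope ring_scope.
Context {R : realType}.
Implicit Types f df : R -> R.

Lemma is_derive_continuous {f df} : (forall x, is_derive x (1:R) f (df x)) ->
  continuous f.
Proof.
move=> fd x; apply/differentiable_continuous/derivable1_diffP.
by have [] := fd x.
Qed.

(** The sign of [u] is left free because the shifts it will be applied to are sums of centred
    indicators, of no fixed sign. *)
Lemma mean_value_shift {f df} : (forall x, is_derive x (1:R) f (df x)) ->
  forall x u, exists2 v, `|v| <= `|u| & f x - f (x - u) = u * df (x - v).
Proof.
move=> fd x u; have cf := is_derive_continuous fd.
have [u0|u0] := leP 0 u.
  have xu : x - u <= x by rewrite gerBl.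
  have [c] := MVT_segment xu (fun y _ => fd y) (continuous_subspaceT cf).
  rewrite in_itv/= => /andP[c1 c2] ->; exists (x - c).
    by rewrite !ger0_norm//; lra.
  by rewrite (_ : x - (x - c) = c); ring.
have xu : x <= x - u by rewrite lerDl oppr_ge0 ltW.
have [c] := MVT_segment xu (fun y _ => fd y) (continuous_subspaceT cf).
rewrite in_itv/= => /andP[c1 c2] E; exists (x - c).
  by rewrite !ler0_norm//; lra.
rewrite (_ : x - (x - c) = c); last by ring.
by rewrite -opprB E; ring.
Qed.

Lemma nondecreasing_derive f df : (forall x, is_derive x (1:R) f (df x)) ->
  (forall x, 0 <= df x) -> forall x y, x <= y -> f x <= f y.
Proof.
move=> fd df0 x y xy.
have [c _ E] := MVT_segment xy (fun z _ => fd z)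
  (continuous_subspaceT (is_derive_continuous fd)).
by rewrite -subr_ge0 E mulr_ge0// subr_ge0.
Qed.

Lemma measurable_EFin_continuous (f : R -> R) (A : set R) : measurable A ->
  continuous f -> measurable_fun A (EFin \o f).
Proof.
move=> mA cf; apply/measurable_EFinP.
apply: (measurable_funS measurableT) => //.
exact: continuous_measurable_fun.
Qed.

End CalculusAux.

(** * Standard normal density and distribution function *)

Section Gauss.
Local Open Scope classical_set_scope.
Local Open Scope ring_scope.
Context {R : realType}.
Implicit Types x y t : R.
Local Notation mu := (@lebesgue_measure R).

Definition phi x : R := (Num.sqrt (2 * pi))^-1 * expR (- (x ^+ 2 / 2)).

(** One term of the exponential series; it absorbs powers into exponentials in the normal tail and
    in the crude moment bound. *)
Lemma exprn_le_expR (n : nat) x : 0 <= x -> x ^+ n <= n`!%:R * expR x.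
Proof.
case: n => [|k] x0; first by rewrite expr0 fact0 mul1r; have := expR_ge1Dx x; lra.
have F0 : 0 < (k.+1)`!%:R :> R by rewrite ltr0n fact_gt0.
rewrite -ler_pdivrMl// mulrC.
by have := expR_ge1Dxn k x0; lra.
Qed.

Lemma phi_gt0 x : 0 < phi x.
Proof.
by rewrite mulr_gt0 ?expR_gt0// invr_gt0 sqrtr_gt0 mulr_gt0// pi_gt0.
Qed.

Lemma phiE : phi = normal_pdf 0 1.
Proof.
apply/funext => x; rewrite normal_pdfE ?oner_neq0// /normal_peak /normal_fun /phi.
by rewrite expr1n mul1r subr0 mulr_natl mulNr.
Qed.

Lemma sqrt2pi_ge1 : 1 <= Num.sqrt (2 * pi) :> R.
Proof.
rewrite -[leLHS]sqrtr1 ler_sqrt; have := pi_ge2 R; lra.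
Qed.

Lemma phi_le x : phi x <= expR (- (x ^+ 2 / 2)).
Proof.
rewrite /phi ger_pMl ?expR_gt0// invf_le1; first exact: sqrt2pi_ge1.
exact: lt_le_trans ltr01 sqrt2pi_ge1.
Qed.

Lemma phi_le1 x : phi x <= 1.
Proof.
apply: le_trans (phi_le x) _; rewrite expR_le1 oppr_le0.
by rewrite mulr_ge0// sqr_ge0.
Qed.

Lemma phiN x : phi (- x) = phi x. Proof. by rewrite /phi sqrrN. Qed.

Lemma is_derive_phi x : is_derive x (1:R) phi (- x * phi x).
Proof.
rewrite /phi.
have H : is_derive x 1 (fun y : R => - (y ^+ 2 / 2)) (- x).
  have -> : (fun y : R => - (y ^+ 2 / 2)) = - ((2^-1 : R) *: (id ^+ 2)).
    by apply/funext => y; rewrite !fctE /GRing.scale/= mulrC.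
  by apply: is_derive_eq; rewrite /GRing.scale/=; field.
rewrite (_ : (fun _ => _) =
  (Num.sqrt (2 * pi))^-1 *: (expR \o (fun y : R => - (y ^+ 2 / 2)))) //.
apply: is_derive_eq; rewrite /GRing.scale/=; ring.
Qed.

Lemma continuous_phi : continuous phi.
Proof. exact: is_derive_continuous is_derive_phi. Qed.

Lemma integrable_phi (A : set R) : measurable A -> mu.-integrable A (EFin \o phi).
Proof.
move=> mA; apply: (integrableS measurableT) => //.
by rewrite phiE; exact: integrable_normal_pdf.
Qed.

Lemma integral_phi : \int[mu]_x phi x = 1.
Proof. by rewrite /Rintegral phiE integral_normal_pdf. Qed.

Lemma integrable_expR_sq (A : set R) : measurable A ->
  mu.-integrable A (EFin \o (fun y => expR (- (y ^+ 2 / 2)))).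
Proof.
move=> mA.
have -> : (EFin \o (fun y => expR (- (y ^+ 2 / 2)))) =
   (fun y => (Num.sqrt (2 * pi))%:E * (EFin \o phi) y)%E.
  apply/funext => y /=; rewrite -EFinM /phi mulVKf// gt_eqF//.
  exact: lt_le_trans ltr01 sqrt2pi_ge1.
by apply: integrableZl => //; exact: integrable_phi.
Qed.

Lemma PhiE t : Phi t = \int[mu]_(y in `]-oo, t]) phi y.
Proof. by rewrite /Phi /phi RintegralZl//; exact: integrable_expR_sq. Qed.

Lemma is_derive_Phi t : is_derive t (1:R) Phi (phi t).
Proof.
have -> : Phi = (fun t => \int[mu]_(y in `]-oo, t]) phi y).
  by apply/funext => s; exact: PhiE.
have [] := @continuous_FTC1 R phi -oo%O t (t + 1).
- by rewrite ltrDl.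
- exact: integrable_phi.
- exact: ltNyr.
- exact: continuous_phi.
by move=> d; rewrite derive1E => e; exact: (DeriveDef d e).
Qed.

Lemma Phi_ge0 t : 0 <= Phi t.
Proof. by rewrite PhiE Rintegral_ge0// => x _; rewrite ltW ?phi_gt0. Qed.

Lemma oneBPhi t : 1 - Phi t = \int[mu]_(y in `]t, +oo[) phi y.
Proof.
rewrite PhiE -integral_phi -set_itvNyy Rintegral_itvB//.
exact: integrable_phi.
Qed.

Lemma Phi_le1 t : Phi t <= 1.
Proof.
by rewrite -subr_ge0 oneBPhi Rintegral_ge0// => x _; rewrite ltW ?phi_gt0.
Qed.

Lemma PhiN t : Phi (- t) = 1 - Phi t.
Proof.
rewrite oneBPhi PhiE Rintegral_itv_obnd_cbnd; last exact: integrable_phi.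
rewrite /Rintegral ge0_integration_by_substitutionNy.
- congr fine; apply: eq_integral => x _ /=; by rewrite phiN.
- exact/continuous_subspaceT/continuous_phi.
- by move=> x _; rewrite ltW ?phi_gt0.
Qed.

Lemma le_Phi x y : x <= y -> Phi x <= Phi y.
Proof.
exact: (nondecreasing_derive _ _ is_derive_Phi (fun x => ltW (phi_gt0 x))).
Qed.

Lemma Phi_lip x y : x <= y -> Phi y - Phi x <= y - x.
Proof.
move=> xy; have [v _] := mean_value_shift is_derive_Phi y (y - x).
rewrite (_ : y - (y - x) = x); last by ring.
by move=> ->; rewrite ler_piMr ?phi_le1// subr_ge0.
Qed.

Lemma Phi_lip_norm x y : `|Phi x - Phi y| <= `|x - y|.
Proof.
wlog xy : x y / x <= y.
  by move=> H; have [/H//|/ltW/H] := leP x y; rewrite distrC (distrC x).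
rewrite distrC ger0_norm ?subr_ge0 ?le_Phi// distrC ger0_norm ?subr_ge0//.
exact: Phi_lip.
Qed.

Lemma cvg_phi : phi x @[x --> +oo] --> (0 : R).
Proof.
apply: (@squeeze_cvgr _ _ _ _ (cst 0) (fun x => expR (- x))).
- have : \forall x \near +oo, (2 : R) <= x by exact: nbhs_pinfty_ge.
  apply: filterS => x x2; rewrite ltW ?phi_gt0//=; apply: le_trans (phi_le x) _.
  by rewrite ler_expR lerN2 ler_pdivlMr// expr2 ler_wpM2l// (le_trans _ x2).
- exact: cvg_cst.
- exact: cvgr_expR.
Qed.

Lemma continuous_mul_phi : continuous (fun y : R => y * phi y).
Proof. by move=> x; apply: cvgM; [exact: cvg_id|exact: continuous_phi]. Qed.

(** The antiderivative is [- phi (c * y) / c ^+ 2]. The scale [c] is 1 in Mills' bound and 1/2 in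
    the moment tails, where part of the Gaussian exponent has been spent on absorbing a power of
    [y]. *)
Lemma integral_mul_phi (c x : R) : 0 < c -> 0 <= x ->
  (\int[mu]_(y in `[x, +oo[) (y * phi (c * y))%:E = (phi (c * x) / c ^+ 2)%:E)%E.
Proof.
move=> c0 x0.
have D (y : R) : is_derive y (1:R) (fun y => - (phi (c * y) / c ^+ 2)) (y * phi (c * y)).
  have H : is_derive y (1:R) (phi \o (fun y => c * y)) (- (c * y) * phi (c * y) * c).
    have Hc : is_derive y (1:R) (fun y => c * y) c.
      rewrite (_ : (fun _ => _) = c *: id)//.
      by apply: is_derive_eq; rewrite /GRing.scale/= mulr1.
    by have := is_derive1_comp (is_derive_phi (c * y)) Hc; rewrite /GRing.scale/=.
  rewrite (_ : (fun _ => _) = (- (c ^+ 2)^-1) *: (phi \o (fun y => c * y))); last first.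
    by apply/funext => v; rewrite !fctE/= /GRing.scale/= mulrC mulNr.
  by apply: is_derive_eq; rewrite /GRing.scale/=; field; rewrite gt_eqF.
have cphi : continuous (fun y : R => phi (c * y)).
  by move=> y; apply: (@continuous_comp _ _ _ (fun y => c * y) phi); [exact: mulrl_continuous|exact: continuous_phi].
have cv : (fun y : R => phi (c * y)) y @[y --> +oo] --> (0 : R).
  have cy : c * y @[y --> +oo] --> +oo.
    exact: gt0_cvgMry c0 cvg_id.
  exact: cvg_comp cy cvg_phi.
rewrite (@ge0_continuous_FTC2y _ _ (fun y => - (phi (c * y) / c ^+ 2)) x 0).
- by rewrite sub0e -EFinN opprK.
- by move=> y xy; apply: mulr_ge0; [exact: le_trans x0 xy|exact/ltW/phi_gt0].
- apply: continuous_subspaceT => y.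
  by apply: cvgM; [exact: cvg_id|exact: cphi].
- rewrite -oppr0; apply: cvgN; rewrite -(mul0r (c ^+ 2)^-1).
  by apply: cvgM; [exact: cv|exact: cvg_cst].
- by move=> y _; case: (D y).
- apply: cvg_at_right_filter.
  exact: (is_derive_continuous D).
- by move=> y _; rewrite derive1E; case: (D y).
Qed.

(** On the tail [x * phi y] is at most [y * phi y], whose integral is exactly [phi x]. *)
Lemma mills x : 0 <= x -> x * (1 - Phi x) <= phi x.
Proof.
move=> x0; rewrite oneBPhi -RintegralZl//; last exact: integrable_phi.
have I (A : set R) : measurable A ->
    mu.-integrable A (EFin \o (fun y => x * phi y)).
  move=> mA; rewrite (_ : EFin \o _ = (fun y => x%:E * (EFin \o phi) y)%E)//.
  by apply: integrableZl => //; exact: integrable_phi.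
rewrite Rintegral_itv_obnd_cbnd; last exact: I.
have := integral_mul_phi 1 x ltr01 x0; rewrite mul1r expr1n divr1.
under eq_integral do rewrite mul1r.
move=> E; rewrite -lee_fin -E /Rintegral fineK; last first.
  by apply: integrable_fin_num => //; exact: I.
apply: ge0_le_integral => //=.
- by move=> y _; rewrite lee_fin mulr_ge0// ltW ?phi_gt0.
- apply: (measurable_EFin_continuous (fun y => x * phi y)) => //.
  by move=> y; apply: cvgM; [exact: cvg_cst|exact: continuous_phi].
- apply: (measurable_EFin_continuous (fun y => y * phi y)) => //.
  exact: continuous_mul_phi.
- move=> y; rewrite in_itv/= andbT => xy.
  by rewrite lee_fin ler_wpM2r// ltW ?phi_gt0.
Qed.

End Gauss.

(** * Stein's equation for a smoothed indicator *)

Section SteinSolution.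
Local Open Scope classical_set_scope.
Local Open Scope ring_scope.
Context {R : realType}.
Variables (t eps : R).
Hypothesis eps0 : 0 < eps.
Local Notation mu := (@lebesgue_measure R).

(* [ramp] is 1 on ]-oo, t], 0 on [t + eps, +oo[ and affine in between. *)
Let u (s : R) := (t + eps - s) / eps.
Definition ramp (s : R) : R := (`|u s| - `|u s - 1| + 1) / 2.

Let rampP s : [/\ 0 <= ramp s, ramp s <= 1, s <= t -> ramp s = 1 &
  t + eps <= s -> ramp s = 0].
Proof.
have H2 : (t + eps <= s) -> u s <= 0.
  by move=> ?; rewrite /u pmulr_lle0 ?invr_gt0// subr_le0.
have H1 : (s <= t) -> 1 <= u s.
  by move=> ?; rewrite /u ler_pdivlMr// mul1r; lra.
rewrite /ramp; move: (u s) H1 H2 => v H1 H2.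
by case: (ger0P v) => v0; case: (ger0P (v - 1)) => v1; split; try lra;
  do ?[move/H1; lra|move/H2; lra].
Qed.

Let ramp_lip s s' : `|ramp s - ramp s'| <= `|s - s'| / eps.
Proof.
have -> : `|s - s'| / eps = `|u s - u s'|.
  rewrite /u -mulrBl normrM [`|eps^-1|]gtr0_norm ?invr_gt0//; congr (_ / _).
  by rewrite distrC; congr `|_|; ring.
rewrite /ramp; move: (u s) (u s') => v w.
case: (ger0P v) => ?; case: (ger0P (v - 1)) => ?;
case: (ger0P w) => ?; case: (ger0P (w - 1)) => ?;
case: (ger0P (v - w)) => ?; rewrite ler_norml; apply/andP; split; lra.
Qed.

Let continuous_ramp : continuous ramp.
Proof.
move=> s; rewrite /ramp /u.
apply: cvgM; last exact: cvg_cst.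
apply: cvgD; last exact: cvg_cst.
have Hu : (fun s : R => (t + eps - s) / eps) s @[s --> s] --> (t + eps - s) / eps.
  apply: cvgM; last exact: cvg_cst.
  by apply: cvgB; [exact: cvg_cst|exact: cvg_id].
apply: cvgB; apply: cvg_norm => //.
by apply: cvgB; [exact: Hu|exact: cvg_cst].
Qed.

Let rphi s := ramp s * phi s.

Let continuous_rphi : continuous rphi.
Proof. by move=> s; apply: cvgM; [exact: continuous_ramp|exact: continuous_phi]. Qed.

Let rphi_ge0 s : 0 <= rphi s.
Proof. by have [? _ _ _] := rampP s; rewrite mulr_ge0// ltW ?phi_gt0. Qed.

Let rphi_le s : rphi s <= phi s.
Proof. by have [? ? _ _] := rampP s; rewrite ler_piMl// ltW ?phi_gt0. Qed.

Let integrable_rphi (A : set R) : measurable A -> mu.-integrable A (EFin \o rphi).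
Proof.
move=> mA; apply: le_integrable (integrable_phi A mA) => //.
  exact: measurable_EFin_continuous.
move=> s _ /=; rewrite lee_fin (ger0_norm (rphi_ge0 s)).
by rewrite (ger0_norm (ltW (phi_gt0 s))); exact: rphi_le.
Qed.

Let H (x : R) := \int[mu]_(y in `]-oo, x]) rphi y.
Let c := \int[mu]_y rphi y.

Let is_derive_H x : is_derive x (1 : R) H (rphi x).
Proof.
have [] := @continuous_FTC1 R rphi -oo%O x (x + 1).
- by rewrite ltrDl.
- exact: integrable_rphi.
- exact: ltNyr.
- exact: continuous_rphi.
by move=> d; rewrite derive1E => e; exact: (DeriveDef d e).
Qed.

Let H_ge0 x : 0 <= H x.
Proof. by rewrite /H Rintegral_ge0. Qed.

Let H_le x : H x <= Phi x.
Proof.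
rewrite PhiE /H le_Rintegral//; first exact: integrable_rphi.
exact: integrable_phi.
Qed.

Let cBH x : c - H x = \int[mu]_(y in `]x, +oo[) rphi y.
Proof.
rewrite /c -set_itvNyy /H Rintegral_itvB//.
exact: integrable_rphi.
Qed.

Let cBH_ge0 x : 0 <= c - H x.
Proof. by rewrite cBH Rintegral_ge0. Qed.

Let cBH_le x : c - H x <= 1 - Phi x.
Proof.
rewrite cBH oneBPhi le_Rintegral//; first exact: integrable_rphi.
exact: integrable_phi.
Qed.

Let c_ge : Phi t <= c.
Proof.
suff -> : Phi t = H t by rewrite -subr_ge0.
rewrite PhiE /H; apply: eq_Rintegral => y; rewrite inE/= in_itv/= => yt.
by have [_ _ /(_ yt) E _] := rampP y; rewrite /rphi E mul1r.
Qed.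

Let c_le : c <= Phi (t + eps).
Proof.
suff -> : c = H (t + eps) by exact: H_le.
apply/eqP; rewrite -subr_eq0 cBH; apply/eqP.
rewrite (_ : \int[mu]_(y in _) _ = \int[mu]_(y in `]t + eps, +oo[) 0).
  by rewrite Rintegral_cst// mul0r.
apply: eq_Rintegral => y; rewrite inE/= in_itv/= andbT => /ltW yt.
by have [_ _ _ /(_ yt) E] := rampP y; rewrite /rphi E mul0r.
Qed.

(** The solution of Stein's equation [f' - x f = ramp - c], obtained with the integrating factor
    [phi]. Since [c] is the normal mean of the ramp, the numerator vanishes at both ends of the
    line. *)
Let f (x : R) := (H x - c * Phi x) / phi x.
Let f' (x : R) := x * f x + (ramp x - c).

Let is_derive_f x : is_derive x (1 : R) f (f' x).
Proof.
have p0 : phi x != 0 by rewrite gt_eqF ?phi_gt0.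
have dH := is_derive_H x; have dP := is_derive_Phi x.
have dp := is_derive_phi x.
have dV : is_derive x (1 : R) (fun y => (phi y)^-1)
   (- (phi x) ^- 2 *: (- x * phi x)) by exact: is_deriveV.
rewrite (_ : f = (H - c *: Phi) * (fun y => (phi y)^-1)); last first.
  by apply/funext => y; rewrite /f !fctE.
apply: is_derive_eq; rewrite /f' /f /rphi !fctE /GRing.scale/=.
by field.
Qed.

(** [H] and [c * Phi] both lie between 0 and [Phi]. The next bound is its mirror image for the right
    tail; each is used on the side where Mills' bound controls it. *)
Let numer_le x : `|H x - c * Phi x| <= Phi x.
Proof.
have := H_ge0 x; have := H_le x; have := cBH_ge0 x; have := cBH_le x.
have c1 : c <= 1 by apply: le_trans c_le (Phi_le1 _).
have c0 : 0 <= c by apply: le_trans c_ge; exact: Phi_ge0.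
have P0 := Phi_ge0 x; have P1 := Phi_le1 x.
have : c * Phi x <= Phi x by rewrite ler_piMl.
have : 0 <= c * Phi x by rewrite mulr_ge0.
by rewrite ler_norml => *; apply/andP; split; lra.
Qed.

Let numer_le' x : `|H x - c * Phi x| <= 1 - Phi x.
Proof.
have := H_ge0 x; have := H_le x; have := cBH_ge0 x; have := cBH_le x.
have c1 : c <= 1 by apply: le_trans c_le (Phi_le1 _).
have c0 : 0 <= c by apply: le_trans c_ge; exact: Phi_ge0.
have P0 := Phi_ge0 x; have P1 := Phi_le1 x.
have -> : H x - c * Phi x = c * (1 - Phi x) - (c - H x) by ring.
have : c * (1 - Phi x) <= 1 - Phi x by rewrite ler_piMl// subr_ge0.
have : 0 <= c * (1 - Phi x) by rewrite mulr_ge0// subr_ge0.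
by rewrite ler_norml => *; apply/andP; split; lra.
Qed.

Let xf_le x : `|x * f x| <= 1.
Proof.
have p0 := phi_gt0 x.
rewrite /f mulrA normrM (gtr0_norm (_ : 0 < (phi x)^-1)) ?invr_gt0//.
rewrite ler_pdivrMr// mul1r normrM.
have [x0|x0] := leP 0 x.
  apply: le_trans (mills x x0).
  by rewrite ger0_norm// ler_wpM2l.
rewrite -phiN; apply: le_trans (mills (- x) _); last by rewrite oppr_ge0 ltW.
by rewrite ltr0_norm// PhiN subKr ler_wpM2l// oppr_ge0 ltW.
Qed.

(** For [|x| <= 1] the division by [phi] costs at most [1 / phi 1]; beyond, the bound on [x * f x]
    already gives 1. *)
Let f_le x : `|f x| <= (phi (1 : R))^-1.
Proof.
have p0 := phi_gt0 x; have p1 := phi_gt0 (1 : R).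
have [x1|x1] := leP `|x| 1.
  rewrite /f normrM (gtr0_norm (_ : 0 < (phi x)^-1)) ?invr_gt0//.
  rewrite -[leRHS]mul1r ler_pM//.
  - by rewrite invr_ge0 ltW.
  - by apply: le_trans (numer_le x) (Phi_le1 _).
  rewrite lef_pV2// /phi ler_pM2l ?invr_gt0 ?sqrtr_gt0 ?mulr_gt0 ?pi_gt0//.
  rewrite ler_expR lerN2 ler_pM2r// expr1n -real_normK ?num_real//.
  by rewrite exprn_ile1.
apply: (@le_trans _ _ 1); last first.
  by rewrite invf_ge1// phi_le1.
have := xf_le x; rewrite normrM; apply: le_trans.
by rewrite ler_peMl// ltW.
Qed.

Let f'_le x : `|f' x| <= 2.
Proof.
apply: le_trans (ler_normD _ _) _; have := xf_le x.
have [? ? _ _] := rampP x.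
have c1 : c <= 1 by apply: le_trans c_le (Phi_le1 _).
have c0 : 0 <= c by apply: le_trans c_ge; exact: Phi_ge0.
have : `|ramp x - c| <= 1 by rewrite ler_norml; apply/andP; split; lra.
by lra.
Qed.

(** The increment of [f'] is [v f(x + v) + x (f(x + v) - f(x))] plus an increment of the ramp. The
    latter vanishes unless [x] is within [|v|] of the sloping part, so the large slope [1 / eps] is
    paid only with the probability of lying there. *)
Let f'_lip x v : `|f' (x + v) - f' x| <= `|v| * ((phi (1 : R))^-1 + 2 * `|x|) +
  `|v| / eps * ((t - `|v| <= x) && (x <= t + eps + `|v|))%:R.
Proof.
have -> : f' (x + v) - f' x = v * f (x + v) + x * (f (x + v) - f x) +
   (ramp (x + v) - ramp x) by rewrite /f'; ring.
apply: le_trans (ler_normD _ _) _; apply: lerD.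
  apply: le_trans (ler_normD _ _) _; rewrite [leRHS]mulrDr (normrM v) (normrM x) lerD//.
    by rewrite ler_wpM2l.
  have [w _] := mean_value_shift is_derive_f (x + v) v.
  rewrite (_ : x + v - v = x); last by ring.
  move=> ->; rewrite normrM mulrCA ler_wpM2l// mulrC ler_wpM2r//.
have := ramp_lip (x + v) x; rewrite (_ : x + v - x = v); last by ring.
have [|H12] := boolP (_ && _); first by rewrite mulr1.
move=> _; rewrite mulr0.
have [_ _ A1 A2] := rampP x; have [_ _ B1 B2] := rampP (x + v).
have := ler_norm v; have := ler_norm (- v); rewrite normrN => v1 v2.
move: H12; rewrite negb_and -!ltNge => /orP[H1|H2].
  by rewrite A1 ?B1 ?subrr ?normr0//; lra.
by rewrite A2 ?B2 ?subrr ?normr0//; lra.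
Qed.

Lemma stein_solution : exists (g g' h : R -> R) (k : R),
  [/\ forall x : R, is_derive x (1 : R) g (g' x),
      forall x : R, g' x = x * g x + (h x - k),
      forall x v : R, `|g' (x + v) - g' x| <=
        `|v| * ((phi (1 : R))^-1 + 2 * `|x|) +
        `|v| / eps * ((t - `|v| <= x) && (x <= t + eps + `|v|))%R%:R,
      forall x : R, (x <= t)%R%:R <= h x <= (x <= t + eps)%R%:R &
      Phi t <= k <= Phi (t + eps)].
Proof.
exists f, f', ramp, c; split => //; last by rewrite c_ge c_le.
move=> x; have [r0 r1 A B] := rampP x; apply/andP; split.
  by have [/A ->|] := leP x t.
by have [|/ltW/B ->] := leP x (t + eps).
Qed.

End SteinSolution.

(** * Expectations under finite laws *)

Section Expectation.
Local Open Scope classical_set_scope.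
Local Open Scope ring_scope.
Context {R : realType} {T : finType}.
Implicit Types (w f g : T -> R) (A B : pred T).

Definition is_distr w := (forall x, 0 <= w x) /\ \sum_x w x = 1.

(** All laws involved live on finite types (integers up to N, sets of primes below a bound), so an
    expectation is a finite weighted sum and needs no measurability. *)
Definition Ex w f : R := \sum_x w x * f x.

Definition Pr w A : R := Ex w (fun x => (A x)%:R).

Lemma eq_Ex w f g : f =1 g -> Ex w f = Ex w g.
Proof. by move=> fg; apply: eq_bigr => x _; rewrite fg. Qed.

Lemma ExD w f g : Ex w (fun x => f x + g x) = Ex w f + Ex w g.
Proof. by rewrite -big_split/=; apply: eq_bigr => x _; rewrite mulrDr. Qed.

Lemma ExB w f g : Ex w (fun x => f x - g x) = Ex w f - Ex w g.
Proof. by rewrite -sumrB; apply: eq_bigr => x _; rewrite mulrBr. Qed.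

Lemma ExZ w (k : R) f : Ex w (fun x => k * f x) = k * Ex w f.
Proof. by rewrite mulr_sumr; apply: eq_bigr => x _; rewrite mulrCA. Qed.

Lemma Ex_sum w (J : Type) (r : seq J) (P : pred J) (F : J -> T -> R) :
  Ex w (fun x => \sum_(j <- r | P j) F j x) = \sum_(j <- r | P j) Ex w (F j).
Proof.
by rewrite exchange_big/=; apply: eq_bigr => x _; rewrite mulr_sumr.
Qed.

Lemma Ex_cst w (k : R) : is_distr w -> Ex w (fun=> k) = k.
Proof. by case=> _ w1; rewrite /Ex -mulr_suml w1 mul1r. Qed.

Lemma le_Ex w f g : is_distr w -> (forall x, f x <= g x) -> Ex w f <= Ex w g.
Proof. by case=> w0 _ fg; apply: ler_sum => x _; rewrite ler_wpM2l. Qed.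

Lemma Ex_ge0 w f : is_distr w -> (forall x, 0 <= f x) -> 0 <= Ex w f.
Proof. by case=> w0 _ f0; apply: sumr_ge0 => x _; rewrite mulr_ge0. Qed.

Lemma norm_Ex w f g : is_distr w -> (forall x, `|f x| <= g x) ->
  `|Ex w f| <= Ex w g.
Proof.
case=> w0 _ fg; apply: le_trans (ler_norm_sum _ _ _) _.
by apply: ler_sum => x _; rewrite normrM ger0_norm// ler_wpM2l.
Qed.

Lemma le_Pr w A B : is_distr w -> (forall x, A x -> B x) -> Pr w A <= Pr w B.
Proof.
move=> dw AB; apply: le_Ex => // x; rewrite ler_nat.
by case: (A x) (AB x) => // ->.
Qed.

Lemma Pr_ge0 w A : is_distr w -> 0 <= Pr w A.
Proof. by move=> dw; apply: Ex_ge0 => // x; rewrite ler0n. Qed.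

Lemma Pr_le1 w A : is_distr w -> Pr w A <= 1.
Proof.
move=> dw; rewrite -[leRHS](Ex_cst w)//; apply: le_Ex => // x.
by rewrite lern1 leq_b1.
Qed.

Lemma Pr_union w A B C : is_distr w -> (forall x, A x -> B x || C x) ->
  Pr w A <= Pr w B + Pr w C.
Proof.
move=> dw AB; rewrite -ExD; apply: le_Ex => // x; rewrite -natrD ler_nat.
by case: (A x) (AB x) => // /(_ isT); case: (B x); case: (C x).
Qed.

Lemma PrC w A : is_distr w -> Pr w A = 1 - Pr w (fun x => ~~ A x).
Proof.
move=> dw; rewrite -[in RHS](Ex_cst w 1)// -ExB; apply: eq_Ex => x.
by case: (A x); rewrite /= ?subr0 ?subrr.
Qed.

Lemma markov_Ex w A f : is_distr w -> (forall x, 0 <= f x) ->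
  (forall x, A x -> 1 <= f x) -> Pr w A <= Ex w f.
Proof.
move=> dw f0 Af; apply: le_Ex => // x.
by case: (boolP (A x)) => [/Af|_].
Qed.

End Expectation.

Lemma is_derive_bigsum {R : realType} {J : Type} (r : seq J)
    (F : J -> R -> R) (dF : J -> R) (u : R) :
  (forall j, is_derive u (1 : R) (F j) (dF j)) ->
  is_derive u (1 : R) (fun v => \sum_(j <- r) F j v) (\sum_(j <- r) dF j).
Proof.
move=> HF; elim: r => [|j r IH].
  rewrite big_nil (_ : (fun _ => _) = cst 0); first exact: is_derive_cst.
  by apply/funext => v; rewrite big_nil.
rewrite big_cons (_ : (fun _ => _) = F j + (fun v => \sum_(j <- r) F j v)).
  by have := HF j => ?; exact: is_deriveD.
by apply/funext => v; rewrite big_cons.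
Qed.

(** * Stein's method under local dependence *)

Section LocalDependence.
Local Open Scope classical_set_scope.
Local Open Scope ring_scope.
Context {R : realType} {T I : finType}.
Variables (w : T -> R) (xi eta zeta : I -> T -> R) (D : R).
Hypothesis dw : is_distr w.
Let W x := \sum_i xi i x.
(** Independence enters through three identities: [eta i] collects the terms near [xi i], and
    [zeta i] the terms near any of these, so that [W - zeta i] is independent of [xi i] and [eta i]
    jointly. *)
Hypothesis indep1 : forall i (F : R -> R),
  Ex w (fun x => xi i x * F (W x - eta i x)) = 0.
Hypothesis indep2 : forall i (F : R -> R),
  Ex w (fun x => `|xi i x| * F (W x - zeta i x)) =
  Ex w (fun x => `|xi i x|) * Ex w (fun x => F (W x - zeta i x)).
Hypothesis indep3 : forall i (F : R -> R),
  Ex w (fun x => xi i x * eta i x * F (W x - zeta i x)) =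
  Ex w (fun x => xi i x * eta i x) * Ex w (fun x => F (W x - zeta i x)).
Hypothesis eta_le : forall i x, `|eta i x| <= D.
Hypothesis zeta_le : forall i x, `|zeta i x| <= D.

Let M := \sum_i Ex w (fun x => `|xi i x|).

(** The subtracted terms have mean zero by [indep1]. For differentiable [F] the differences turn
    into [eta i] times a derivative, which brings in the variance. *)
Lemma local_dep_Ex (F : R -> R) : Ex w (fun x => W x * F (W x)) =
  \sum_i Ex w (fun x => xi i x * (F (W x) - F (W x - eta i x))).
Proof.
rewrite (eq_Ex _ _ (fun x => \sum_i xi i x * F (W x))); last first.
  by move=> x; rewrite mulr_suml.
rewrite Ex_sum; apply: eq_bigr => i _.
rewrite (eq_Ex _ (fun x => xi i x * (F (W x) - F (W x - eta i x)))
 (fun x => xi i x * F (W x) - xi i x * F (W x - eta i x))); last first.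
  by move=> x; rewrite mulrBr.
by rewrite ExB indep1 subr0.
Qed.

Section Berry_Esseen.
Hypothesis var1 : \sum_i Ex w (fun x => xi i x * eta i x) = 1.
Hypotheses (D0 : 0 < D) (D1 : D <= 1).

Let EW2 : Ex w (fun x => W x * W x) = 1.
Proof.
rewrite (local_dep_Ex idfun)/= -var1; apply: eq_bigr => i _.
by apply: eq_Ex => x; rewrite subKr.
Qed.

Let EW : Ex w (fun x => `|W x|) <= 1.
Proof.
have -> : 1 = Ex w (fun x => 2^-1 * (1 + W x * W x)).
  by rewrite ExZ ExD Ex_cst// EW2; field.
apply: le_Ex => // x; have := sqr_ge0 (`|W x| - 1).
by rewrite -[W x * W x]expr2 -(@real_normK _ (W x)) ?num_real// !expr2; lra.
Qed.

Let K0 : R := (phi (1 : R))^-1.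

Let K0_ge0 : 0 <= K0. Proof. by rewrite invr_ge0 ltW ?phi_gt0. Qed.

(** Both the mean of [g'] and the remainder of the mean value theorem are compared with [g'] at
    [W - zeta i], which factors out by [indep2] and [indep3]; by [var1] the main terms cancel. The
    displacements from that point are at most [2 * D], hence the majorant [q]. *)
Let stein_err (d t eps k : R) (g g' h : R -> R) :
  (forall s, `|Pr w (fun x => W x <= s) - Phi s| <= d) -> 0 < eps ->
  (forall x : R, is_derive x (1 : R) g (g' x)) ->
  (forall x : R, g' x = x * g x + (h x - k)) ->
  (forall x v : R, `|g' (x + v) - g' x| <= `|v| * (K0 + 2 * `|x|) +
        `|v| / eps * ((t - `|v| <= x) && (x <= t + eps + `|v|))%R%:R) ->
  `|Ex w (fun x => h (W x)) - k| <=
  2 * D * M * (2 * D * (K0 + 4) + 2 * D / eps * (eps + 7 * D + 2 * d)).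
Proof.
move=> Hd e0 dg g'E g'lip.
pose U i x := W x - zeta i x.
pose q (u : R) := 2 * D * (K0 + 2 * `|u|) +
  2 * D / eps * ((t - 2 * D <= u) && (u <= t + eps + 2 * D))%R%:R.
have g'q u v : `|v| <= 2 * D -> `|g' (u + v) - g' u| <= q u.
  move=> vD; apply: le_trans (g'lip u v) _; rewrite lerD//.
    by rewrite ler_wpM2r// addr_ge0// mulr_ge0.
  rewrite ler_pM ?ler0n//; first by rewrite mulr_ge0// invr_ge0 ltW.
    by rewrite ler_wpM2r// invr_ge0 ltW.
  rewrite ler_nat; have [/andP[A B]|//] := boolP (_ && _).
  by rewrite (_ : (_ && _) = true)//; apply/andP; split; lra.
have Eq i : Ex w (fun x => q (U i x)) <=
    2 * D * (K0 + 4) + 2 * D / eps * (eps + 7 * D + 2 * d).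
  rewrite ExD; apply: lerD.
    rewrite ExZ ExD Ex_cst// ExZ ler_wpM2l ?mulr_ge0 ?(ltW D0)//.
    have EU : Ex w (fun x => `|U i x|) <= 1 + D; last first.
      by rewrite lerD2l; have := D1; lra.
    apply: (@le_trans _ _ (Ex w (fun x => `|W x| + D))).
      apply: le_Ex => // x; apply: le_trans (ler_normB _ _) _.
      by rewrite lerD2l.
    by rewrite ExD Ex_cst// lerD2r.
  rewrite ExZ ler_wpM2l ?divr_ge0 ?mulr_ge0 ?(ltW D0) ?(ltW e0)//.
  (* Adding [zeta i] back puts [W] in [[t - 3 * D, t + eps + 3 * D]]. The difference of two
     distribution functions is the mass of a half-open interval, so the left end is moved to
     [t - 4 * D] to keep the endpoint; the length is then [eps + 7 * D]. *)
  apply: (@le_trans _ _ (Pr w (fun x => W x <= t + eps + 3 * D) -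
                         Pr w (fun x => W x <= t - 4 * D))).
    rewrite -ExB; apply: le_Ex => // x.
    have D0' := D0; have := zeta_le i x; rewrite ler_norml => /andP[z1 z2].
    rewrite /U; case: (leP (W x) (t - 4 * D)) => [?|?].
      rewrite (_ : _ && _ = false); last by apply/negP => /andP[]; lra.
      have -> : (W x <= t + eps + 3 * D) = true by lra.
      by rewrite subrr.
    rewrite subr0 ler_nat; have [/andP[? ?]|//] := boolP (_ && _).
    by have -> : (W x <= t + eps + 3 * D) = true by lra.
  have := Hd (t + eps + 3 * D); have := Hd (t - 4 * D).
  have := @Phi_lip R (t - 4 * D) (t + eps + 3 * D).
  rewrite !ler_norml => HP; have {}HP : Phi (t + eps + 3 * D) - Phi (t - 4 * D)
      <= t + eps + 3 * D - (t - 4 * D) by apply: HP; have := D0; lra.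
  by move=> /andP[? ?] /andP[? ?]; lra.
have hE x : h (W x) = g' (W x) - W x * g (W x) + k by rewrite g'E; ring.
rewrite (eq_Ex _ _ _ hE) ExD Ex_cst// addrK ExB local_dep_Ex.
have E1 : Ex w (fun x => g' (W x)) =
    \sum_i Ex w (fun x => xi i x * eta i x) * Ex w (fun x => g' (W x)).
  by rewrite -mulr_suml var1 mul1r.
rewrite [X in `|X - _|]E1 -sumrB.
rewrite /M mulr_sumr mulr_suml.
apply: le_trans (ler_norm_sum _ _ _) _; apply: ler_sum => i _.
set Q := 2 * D * (K0 + 4) + _; set m := Ex w (fun x => `|xi i x|).
have m0 : 0 <= m by apply: Ex_ge0.
have -> : Ex w (fun x => xi i x * eta i x) * Ex w (fun x => g' (W x)) -
    Ex w (fun x => xi i x * (g (W x) - g (W x - eta i x))) =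
  Ex w (fun x => xi i x * eta i x) * Ex w (fun x => g' (W x) - g' (U i x)) +
  Ex w (fun x => xi i x * eta i x * g' (U i x) -
    xi i x * (g (W x) - g (W x - eta i x))).
  by rewrite !ExB indep3; ring.
have -> : 2 * D * m * Q = D * m * Q + D * m * Q by ring.
apply: le_trans (ler_normD _ _) _; apply: lerD.
  rewrite normrM ler_pM//.
    rewrite -ExZ; apply: norm_Ex => // x; rewrite normrM mulrC ler_wpM2r//.
  apply: le_trans (Eq i); apply: norm_Ex => // x.
  rewrite (_ : g' (W x) = g' (U i x + zeta i x)); last by rewrite /U subrK.
  apply: g'q.
  by apply: le_trans (zeta_le i x) _; have := D0; lra.
apply: (@le_trans _ _ (Ex w (fun x => D * (`|xi i x| * q (U i x))))).
  apply: norm_Ex => // x.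
  have [v vle ->] := mean_value_shift dg (W x) (eta i x).
  have -> : xi i x * eta i x * g' (U i x) - xi i x * (eta i x * g' (W x - v)) =
     xi i x * eta i x * - (g' (U i x + (zeta i x - v)) - g' (U i x)).
    by rewrite /U (_ : W x - zeta i x + (zeta i x - v) = W x - v); ring.
  rewrite !normrM normrN mulrA (mulrC D) ler_pM ?mulr_ge0//.
    by rewrite ler_wpM2l.
  apply: g'q; apply: le_trans (ler_normB _ _) _.
  by have := zeta_le i x; have := eta_le i x; lra.
rewrite ExZ (indep2 i q) -mulrA ler_wpM2l ?(ltW D0)//.
by rewrite ler_wpM2l//; exact: Eq.
Qed.

Let kappa := M * D.

Let M_ge0 : 0 <= M.
Proof. by rewrite sumr_ge0// => i _; apply: Ex_ge0. Qed.

Let kappa_ge0 : 0 <= kappa. Proof. by rewrite mulr_ge0// ltW. Qed.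

Let C0 := (kappa + 1) * (4 * K0 + 36) * D.

(* The mass of W near the discontinuity of the test function is controlled by
   the sought distance itself: a bound d improves to C0 + d / 2. *)
Let bootstrap (d : R) :
  (forall s, `|Pr w (fun x => W x <= s) - Phi s| <= d) ->
  forall s, `|Pr w (fun x => W x <= s) - Phi s| <= C0 + d / 2.
Proof.
move=> Hd s.
have d0 : 0 <= d by apply: le_trans (Hd 0).
(* With this width the coefficient of [d] in the error is [kappa / (2 * (kappa + 1))], hence at most
   1/2, while [eps] itself is still of the order of the desired bound. *)
pose eps := 16 * (kappa + 1) * D.
have e0 : 0 < eps by rewrite !mulr_gt0// ltr_wpDl.
have err_le : 2 * D * M * (2 * D * (K0 + 4) +
    2 * D / eps * (eps + 7 * D + 2 * d)) + eps <= C0 + d / 2.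
  have -> : 2 * D * M * (2 * D * (K0 + 4) +
    2 * D / eps * (eps + 7 * D + 2 * d)) + eps =
    kappa * (4 * K0 + 20) * D + 16 * (kappa + 1) * D +
     kappa / (kappa + 1) * (28 / 16 * D + d / 2).
    have kn : M * D + 1 != 0 by rewrite gt_eqF// ltr_wpDl.
    have Dn : D != 0 by rewrite gt_eqF.
    by rewrite /eps /kappa; field; rewrite Dn kn.
  have k1 : kappa / (kappa + 1) <= 1.
    by rewrite ler_pdivrMr ?ltr_wpDl// mul1r lerDl.
  have : kappa / (kappa + 1) * (28 / 16 * D + d / 2) <= 28 / 16 * D + d / 2.
    by rewrite ler_piMl//; have := D0; have := d0; lra.
  have := mulr_ge0 kappa_ge0 (ltW D0); have := mulr_ge0 K0_ge0 (ltW D0).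
  by rewrite /C0; have := D0; have := d0; lra.
apply: le_trans err_le.
have up : Pr w (fun x => W x <= s) - Phi s <=
   2 * D * M * (2 * D * (K0 + 4) +
    2 * D / eps * (eps + 7 * D + 2 * d)) + eps.
  have [g [g' [h [k [dg g'E g'lip hb /andP[k1 k2]]]]]] := stein_solution s eps e0.
  have := stein_err d s eps k g g' h Hd e0 dg g'E g'lip.
  have hP : Pr w (fun x => W x <= s) <= Ex w (fun x => h (W x)).
    by apply: le_Ex => // x; have /andP[] := hb (W x).
  have := @Phi_lip R s (s + eps); rewrite lerDl (ltW e0) => /(_ isT).
  by rewrite ler_norml => ? /andP[? ?]; lra.
(* Here the ramp ends at [s] instead of starting there, so that it lies below the indicator. *)
have dn : Phi s - Pr w (fun x => W x <= s) <=
   2 * D * M * (2 * D * (K0 + 4) +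
    2 * D / eps * (eps + 7 * D + 2 * d)) + eps.
  have [g [g' [h [k [dg g'E g'lip hb /andP[k1 k2]]]]]] :=
    stein_solution (s - eps) eps e0.
  have := stein_err d (s - eps) eps k g g' h Hd e0 dg g'E g'lip.
  have hP : Ex w (fun x => h (W x)) <= Pr w (fun x => W x <= s).
    by apply: le_Ex => // x; have := hb (W x); rewrite subrK => /andP[].
  have := @Phi_lip R (s - eps) s; rewrite gerBl (ltW e0) => /(_ isT).
  by rewrite ler_norml => ? /andP[? ?]; lra.
by rewrite ler_norml; apply/andP; split; lra.
Qed.

(** The map [d -> C0 + d / 2] has fixed point [2 * C0]. Iterating it from the trivial bound leaves
    an excess of at most [2 ^- n] after [n] steps. *)
Lemma local_dep_berry_esseen (s : R) :
  `|Pr w (fun x => W x <= s) - Phi s| <=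
  (M * D + 1) * (8 * (phi (1 : R))^-1 + 72) * D.
Proof.
have -> : (M * D + 1) * (8 * (phi (1 : R))^-1 + 72) * D = 2 * C0.
  by rewrite /C0 /K0 /kappa; ring.
have H n : forall s, `|Pr w (fun x => W x <= s) - Phi s| <= 2 * C0 + 2^-1 ^+ n.
  elim: n => [|n IH] u.
    have := Pr_ge0 w (fun x => W x <= u) dw.
    have := Pr_le1 w (fun x => W x <= u) dw.
    have := @Phi_ge0 R u; have := @Phi_le1 R u.
    have : 0 <= C0 by rewrite !mulr_ge0// ?addr_ge0 ?mulr_ge0// ltW.
    by rewrite ler_norml expr0 => *; apply/andP; split; lra.
  by apply: le_trans (bootstrap _ IH u) _; rewrite exprS; lra.
apply/ler_addgt0Pr => e e0.
have : (fun n => 2^-1 ^+ n) @ \oo --> (0 : R).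
  by apply: cvg_expr; rewrite gtr0_norm//; lra.
move/cvgrPdist_lt => /(_ e e0) [n _ /(_ n (leqnn n))].
rewrite /= sub0r normrN ger0_norm ?exprn_ge0// => ne.
by apply: le_trans (H n s) _; rewrite lerD2l ltW.
Qed.

End Berry_Esseen.

(** The moment generating function [m] of [W] satisfies [m' <= c u m] with [c = expR 3 * (M * D)] as
    long as [u * D <= 1]. Hence [m(u) exp(- c u^2 / 2)] does not increase, and Markov's inequality
    concludes. *)
Lemma local_dep_chernoff (s x : R) : 0 <= s -> s * D <= 1 ->
  Pr w (fun y => x <= W y) <= expR (- (s * x) + expR 3 * (M * D) * s ^+ 2 / 2).
Proof.
move=> s0 sD.
(* An empty sample space or an empty index set is treated apart, because [0 <= D] is read off from
   an instance of [eta_le]. *)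
have [y0 _|ny] := pickP (fun y : T => true); last first.
  by rewrite /Pr /Ex big_pred0 ?expR_ge0.
have [i0 _|ni] := pickP (fun i : I => true); last first.
  have W0 y : W y = 0 by rewrite /W big_pred0.
  have -> : M = 0 by rewrite /M big_pred0.
  rewrite mul0r mulr0 mul0r mul0r addr0.
  apply: (@le_trans _ _ (Ex w (fun=> expR (- (s * x))))); last by rewrite Ex_cst.
  apply: le_Ex => // y; rewrite W0; have [x0|_] := leP x 0; rewrite ?expR_ge0//.
  by rewrite -[leLHS]expR0 ler_expR oppr_ge0 mulr_ge0_le0.
have D0 : 0 <= D by apply: le_trans (eta_le i0 y0).
pose m (u : R) := Ex w (fun y => expR (u * W y)).
pose dm (u : R) := Ex w (fun y => W y * expR (u * W y)).
pose c := expR 3 * (M * D).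
have dmE u : is_derive u (1 : R) m (dm u).
  rewrite /m /dm /Ex.
  apply: is_derive_bigsum => y.
  have H1 : is_derive u (1 : R) (fun v : R => v * W y) (W y).
    rewrite (_ : (fun _ => _) = W y *: id); last first.
      by apply/funext => v; rewrite !fctE /GRing.scale/= mulrC.
    by apply: is_derive_eq; rewrite /GRing.scale/= mulr1.
  rewrite (_ : (fun _ => _) = w y *: (expR \o (fun v : R => v * W y))) //.
  by apply: is_derive_eq; rewrite /GRing.scale/=; ring.
have m0 u : 0 <= m u by apply: Ex_ge0 => // y; rewrite expR_ge0.
have dm_le u : 0 <= u -> u * D <= 1 -> dm u <= c * u * m u.
  move=> u0 uD; rewrite /dm (local_dep_Ex (fun v => expR (u * v))).
  have -> : c * u * m u = \sum_i Ex w (fun y => `|xi i y|) * (expR 3 * D * u * m u).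
    by rewrite -mulr_suml /c -/M; ring.
  apply: ler_sum => i _.
  (* The factor [expR 2] pays for moving from the intermediate point to [W] and from [W] to
     [W - zeta i], each at most 1 after scaling by [u]. After factoring, one more [expR 1] pays for
     the way back to [W]. *)
  apply: (@le_trans _ _ (Ex w (fun y => expR 2 * D * u * (`|xi i y| *
     expR (u * (W y - zeta i y)))))).
    apply: le_Ex => // y; apply: le_trans (ler_norm _) _; rewrite normrM.
    rewrite mulrCA ler_wpM2l//.
    have [v vle] := mean_value_shift (fun x => is_derive_expR x) (u * W y)
      (u * eta i y).
    rewrite mulrBr => ->.
    have ue : `|u * eta i y| <= u * D by rewrite normrM ger0_norm// ler_wpM2l.
    have uz : `|u * zeta i y| <= u * D by rewrite normrM ger0_norm// ler_wpM2l.
    rewrite normrM (ger0_norm (expR_ge0 _)).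
    rewrite [leRHS](_ : _ = u * D * (expR 2 * expR (u * (W y - zeta i y))));
      last by ring.
    rewrite ler_pM ?expR_ge0// -expRD ler_expR mulrBr.
    by move: vle uz; rewrite !ler_norml => /andP[? ?] /andP[? ?]; lra.
  rewrite ExZ (indep2 i (fun v => expR (u * v))).
  rewrite mulrCA ler_wpM2l//; first by apply: Ex_ge0.
  have -> : expR 3 * D * u * m u = expR 2 * D * u * (expR 1 * m u).
    have -> : expR 3 = expR 2 * expR 1 :> R by rewrite -expRD; congr expR; ring.
    by ring.
  rewrite ler_wpM2l//.
    by rewrite !mulr_ge0 ?expR_ge0.
  rewrite -ExZ; apply: le_Ex => // y; rewrite -expRD ler_expR mulrBr.
  have uz : `|u * zeta i y| <= u * D by rewrite normrM ger0_norm// ler_wpM2l.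
  by move: uz; rewrite ler_norml => /andP[? ?]; lra.
pose G (u : R) := m u * expR (- (c * u ^+ 2 / 2)).
have GE (u : R) : is_derive u (1 : R) G
    ((dm u - c * u * m u) * expR (- (c * u ^+ 2 / 2))).
  have dmu := dmE u.
  have H1 : is_derive u (1 : R) (fun v : R => - (c * v ^+ 2 / 2)) (- (c * u)).
    rewrite (_ : (fun _ => _) = - ((c / 2) *: (id ^+ 2))); last first.
      by apply/funext => v; rewrite !fctE /GRing.scale/=; ring.
    by apply: is_derive_eq; rewrite /GRing.scale/=; field.
  rewrite (_ : G = m * (expR \o (fun v : R => - (c * v ^+ 2 / 2)))) //.
  by apply: is_derive_eq; rewrite /GRing.scale/=; ring.
have Gs : G s <= 1.
  have [v] := MVT_segment s0 (fun z _ => GE z)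
    (continuous_subspaceT (is_derive_continuous GE)).
  rewrite in_itv/= => /andP[v0 vs] E.
  have G0 : G 0 = 1.
    rewrite /G expr0n/= mulr0 mul0r oppr0 expR0 mulr1 /m.
    rewrite (eq_Ex _ _ (fun=> 1)) ?Ex_cst// => y; by rewrite mul0r expR0.
  rewrite -G0 -subr_le0 E mulr_le0_ge0 ?subr_ge0//.
  rewrite mulr_le0_ge0 ?expR_ge0// subr_le0 dm_le//.
  by apply: le_trans sD; rewrite ler_wpM2r.
have -> : expR (- (s * x) + expR 3 * (M * D) * s ^+ 2 / 2) =
   expR (- (s * x)) * expR (c * s ^+ 2 / 2) by rewrite -expRD.
apply: (@le_trans _ _ (expR (- (s * x)) * m s)).
  rewrite /m -ExZ; apply: markov_Ex => // y; rewrite -expRD ?expR_ge0//.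
  move=> xW; rewrite -expR0 ler_expR addrC subr_ge0 ler_wpM2l//.
rewrite ler_wpM2l ?expR_ge0//.
by move: Gs; rewrite /G expRN ler_pdivrMr ?expR_gt0// mul1r.
Qed.

End LocalDependence.

(** * Moebius inversion on subsets *)

Section Moebius.
Import mathcomp.boot.fintype mathcomp.boot.finset.
Context {R : realType} {I : finType}.
Implicit Types (f : {set I} -> R) (A B E : {set I}).

(** The coefficient of [f] on the function [A -> (E \subset A)]. In the arithmetic application these
    basis functions are divisibility conditions, whose densities are known. *)
Definition moebius f E : R := \sum_(B : {set I} | B \subset E) (-1) ^+ #|E :\: B| * f B.

Lemma prod_subset_sum (F G : I -> R) :
  \prod_i (F i + G i) = \sum_(J : {set I}) \prod_i (if i \in J then F i else G i).
Proof. exact: bigA_distr. Qed.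

(** Turning inclusions into products of indicators lets sums over all subsets be evaluated one
    coordinate at a time. *)
Lemma prodr_indic (P : pred I) : \prod_i ((P i)%:R : R) = [forall i, P i]%:R.
Proof.
have [/forallP H|] := boolP [forall i, P i]; first by rewrite big1// => i _; rewrite H.
rewrite negb_forall => /existsP[i /negbTE Hi].
by rewrite (bigD1 i)//= Hi mul0r.
Qed.

Lemma prodr_sub (F : I -> R) A E : \prod_i (if i \in E then (i \in A)%:R * F i else 1) =
  (E \subset A)%:R * \prod_(i in E) F i.
Proof.
rewrite -big_mkcond/= big_split/=; congr (_ * _).
rewrite big_mkcond/= (eq_bigr (fun i => ((i \in E) ==> (i \in A))%:R)).
  by rewrite prodr_indic; congr (nat_of_bool _)%:R; apply/forall_inP/subsetP.
by move=> i _; case: (i \in E).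
Qed.

(** After exchanging the sums, the total weight of [f B] factors over the coordinates; each factor
    is 1 or 0 according to whether [A] and [B] agree there. *)
Lemma moebius_inv f A : \sum_(E : {set I} | E \subset A) moebius f E = f A.
Proof.
have sum_indic (P : pred {set I}) (F : {set I} -> R) :
    \sum_(B | P B) F B = \sum_B (P B)%:R * F B.
  by rewrite big_mkcond; apply: eq_bigr => B _; case: (P B); rewrite ?mul1r ?mul0r.
have coeff (B : {set I}) : \sum_(E : {set I}) (B \subset E)%:R *
    (E \subset A)%:R * (-1) ^+ #|E :\: B| = (A == B)%:R :> R.
  have -> : (A == B) = [forall i, (i \in A) == (i \in B)].
    apply/eqP/forallP => [-> i //|AB]; apply/setP => i; exact/eqP.
  rewrite -prodr_indic.
  transitivity (\prod_i ((i \in A)%:R * (-1) ^+ (i \notin B) + (i \notin B)%:R : R)).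
    rewrite prod_subset_sum; apply: eq_bigr => E _.
    have -> : (B \subset E) = [forall i, (i \in B) ==> (i \in E)].
      by apply/subsetP/forall_inP.
    have -> : (E \subset A) = [forall i, (i \in E) ==> (i \in A)].
      by apply/subsetP/forall_inP.
    rewrite -prodr_const [X in _ * X]big_mkcond/= -!prodr_indic -!big_split/=.
    apply: eq_bigr => i _; rewrite !inE.
    by case: (i \in A); case: (i \in B); case: (i \in E); rewrite /=; ring.
  by apply: eq_bigr => i _; case: (i \in A); case: (i \in B); rewrite /=; ring.
rewrite sum_indic.
transitivity (\sum_(B : {set I}) \sum_(E : {set I}) ((B \subset E)%:R *
    (E \subset A)%:R * (-1) ^+ #|E :\: B|) * f B).
  rewrite exchange_big/=; apply: eq_bigr => E _.
  rewrite /moebius sum_indic mulr_sumr; apply: eq_bigr => B _; ring.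
transitivity (\sum_(B : {set I}) (A == B)%:R * f B).
  by apply: eq_bigr => B _; rewrite -mulr_suml coeff.
rewrite (bigD1 A)//= eqxx mul1r big1 ?addr0// => B BA.
by rewrite eq_sym (negbTE BA) mul0r.
Qed.

Lemma moebius_norm f E : (forall B, `|f B| <= 1) -> `|moebius f E| <= 2 ^+ #|E|.
Proof.
move=> f1; rewrite /moebius.
apply: le_trans (ler_norm_sum _ _ _) _.
apply: (@le_trans _ _ (\sum_(B : {set I} | B \subset E) 1)).
  by apply: ler_sum => B _; rewrite normrM normrX normrN1 expr1n mul1r.
rewrite sumr_const -natrX ler_nat -card_powerset.
by apply: subset_leq_card; apply/subsetP => B; rewrite powersetE.
Qed.

End Moebius.

(** * Independent random subsets *)

Section Bernoulli.
Import mathcomp.boot.fintype mathcomp.boot.finset.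
Context {R : realType} {I : finType}.
Variable a : I -> R.
Hypothesis a01 : forall i, 0 <= a i <= 1.
Implicit Types (f h : {set I} -> R) (A E J : {set I}).

Definition bern (A : {set I}) : R := \prod_i (if i \in A then a i else 1 - a i).

Lemma Ex_bern_prod (u v : I -> R) :
  Ex bern (fun A => \prod_i (if i \in A then u i else v i)) =
  \prod_i (a i * u i + (1 - a i) * v i).
Proof.
rewrite prod_subset_sum; apply: eq_bigr => A _; rewrite -big_split/=.
by apply: eq_bigr => i _; case: ifP.
Qed.

Lemma bern_distr : is_distr bern.
Proof.
split; first by move=> A; apply: prodr_ge0 => i _; have /andP[? ?] := a01 i;
  case: ifP => _ //; rewrite subr_ge0.
transitivity (Ex bern (fun A => \prod_i (if i \in A then 1 else 1 : R))).
  by apply: eq_bigr => A _; rewrite big1 ?mulr1// => i _; rewrite if_same.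
by rewrite Ex_bern_prod big1// => i _; ring.
Qed.

Lemma Ex_bern_sub E : Ex bern (fun A => (E \subset A)%:R) = \prod_(i in E) a i.
Proof.
transitivity (Ex bern (fun A => \prod_i (if i \in A then 1 else (i \notin E)%:R : R))).
  apply: eq_Ex => A; rewrite (_ : (E \subset A) = [forall i, (i \in E) ==> (i \in A)]).
    rewrite -prodr_indic; apply: eq_bigr => i _.
    by case: (i \in A); case: (i \in E).
  by apply/subsetP/forall_inP.
rewrite Ex_bern_prod [RHS]big_mkcond/=; apply: eq_bigr => i _.
by case: (i \in E); rewrite /=; ring.
Qed.

Lemma Ex_bern_exp (c : R) :
  Ex bern (fun A => c ^+ #|A|) = \prod_i (1 + (c - 1) * a i).
Proof.
transitivity (Ex bern (fun A => \prod_i (if i \in A then c else 1))).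
  by apply: eq_Ex => A; rewrite -big_mkcond/= prodr_const.
by rewrite Ex_bern_prod; apply: eq_bigr => i _; ring.
Qed.

Definition depends_on f J := forall A, f A = f (A :&: J).

Lemma depends_onS f J J' : J \subset J' -> depends_on f J -> depends_on f J'.
Proof.
move=> JJ' fJ A; rewrite fJ [RHS]fJ -setIA; congr (f (_ :&: _)).
by apply/esym/setIidPr.
Qed.

Lemma depends_on_expand f J : depends_on f J ->
  forall A, f A = \sum_(E : {set I} | E \subset J) (E \subset A)%:R * moebius f E.
Proof.
move=> fJ A; rewrite fJ -moebius_inv (eq_bigl (fun E => (E \subset J) && (E \subset A))).
  by rewrite big_mkcondr/=; apply: eq_bigr => E _; case: ifP => _; rewrite ?mul1r ?mul0r.
by move=> E; rewrite subsetI andbC.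
Qed.

(** By bilinearity it suffices to treat indicators of [E \subset A] and [E' \subset A] with [E],
    [E'] disjoint, where the probability of the union is a product. *)
Lemma bern_indep f h J J' : [disjoint J & J'] -> depends_on f J ->
  depends_on h J' -> Ex bern (fun A => f A * h A) = Ex bern f * Ex bern h.
Proof.
move=> dJ fJ hJ.
rewrite (eq_Ex _ _ _ (depends_on_expand f J fJ)) [Ex _ h](eq_Ex _ _ _ (depends_on_expand h J' hJ)).
rewrite !Ex_sum mulr_suml.
under eq_Ex => A do rewrite (depends_on_expand f J fJ A)
  (depends_on_expand h J' hJ A) mulr_suml.
rewrite Ex_sum; apply: eq_bigr => E EJ.
rewrite mulr_sumr.
under eq_Ex => A do rewrite mulr_sumr.
rewrite Ex_sum; apply: eq_bigr => E' EJ'.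
have dE : [disjoint E & E'] by apply: disjointWl EJ _; apply: disjointWr EJ' _.
transitivity (Ex bern (fun A => (moebius f E * moebius h E') * (E :|: E' \subset A)%:R)).
  apply: eq_Ex => A; rewrite subUset; case: (E \subset A); case: (E' \subset A);
  by rewrite /=; ring.
rewrite ExZ Ex_bern_sub.
under [Ex _ (fun A => (E \subset A)%:R * _)]eq_Ex => A do rewrite mulrC.
under [Ex _ (fun A => (E' \subset A)%:R * _)]eq_Ex => A do rewrite mulrC.
rewrite !ExZ !Ex_bern_sub (big_setID E)/= setUK.
rewrite (_ : (E :|: E') :\: E = E'); last first.
  rewrite setDUl setDv set0U; apply/setDidPl; by rewrite disjoint_sym.
by ring.
Qed.

End Bernoulli.

(** * The gap count of a random set: dependence structure *)

Section GapProcess.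
Import mathcomp.boot.fintype mathcomp.boot.finset.
Context {R : realType} {m : nat}.
Variables (a : 'I_m -> R) (g : rel nat).
Hypothesis a01 : forall i, 0 <= a i <= 1.
Hypothesis g_lower : forall j' j i, (j' <= j)%N -> g j i -> g j' i.
Hypothesis g_upper : forall j i i', (i <= i')%N -> g j i -> g j i'.
Implicit Types (i j k : 'I_m) (A J S : {set 'I_m}).

Local Notation E := (Ex (bern a)).

(** By the monotonicity of [g] this is an interval of indices whose last element is [i]. *)
Definition window i : {set 'I_m} := [set k | (k == i) || ((k < i)%N && ~~ g k i)].

Definition after_gap i A : bool := A :&: window i == [set i].

Definition gap_mean i : R := E (fun A => (after_gap i A)%:R).

Definition gap_total A : R := \sum_i (after_gap i A)%:R.

Definition gap_total_mean : R := \sum_i gap_mean i.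

(* The indicators at i and j exclude each other when j is in the window of i,
   and are independent when the two windows are disjoint. *)
Definition gap_total_var : R := gap_total_mean
  - 2 * (\sum_i gap_mean i * \sum_(j in window i) gap_mean j)
  + \sum_i gap_mean i ^+ 2.

Let db := bern_distr a a01.

Lemma gap_mean_ge0 i : 0 <= gap_mean i.
Proof. by apply: Ex_ge0. Qed.

Lemma in_window_self i : i \in window i. Proof. by rewrite inE eqxx. Qed.

Lemma after_gap_in i A : after_gap i A -> i \in A.
Proof.
move=> /eqP Y; suff : i \in A :&: window i by rewrite inE => /andP[].
by rewrite Y inE.
Qed.

Lemma gap_meanE i : gap_mean i = a i * \prod_(k in window i | k != i) (1 - a k).
Proof.
rewrite /gap_mean.
transitivity (E (fun A => \prod_k (if k \in A then
   ((k == i) || (k \notin window i))%:R else (k != i)%:R : R))).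
  apply: eq_Ex => A; rewrite /after_gap.
  have -> : (A :&: window i == [set i]) = [forall k, if k \in A then
   ((k == i) || (k \notin window i)) else (k != i)].
    apply/eqP/forallP => [H k|H].
      move/setP/(_ k) : H; rewrite !inE.
      by case: (k \in A); case: (k == i); case: ((k < i)%N && ~~ g k i).
    apply/setP => k; have := H k; rewrite !inE; case: (eqVneq k i) => [->|_].
      by case: (i \in A).
    by case: (k \in A) => //= /negbTE.
  by rewrite -prodr_indic; apply: eq_bigr => k _; case: (k \in A).
rewrite Ex_bern_prod (bigD1 i)//= eqxx; congr (_ * _).
  by rewrite in_window_self/=; ring.
rewrite [in RHS](eq_bigl (fun k => (k != i) && (k \in window i))); last first.
  by move=> k; rewrite andbC.
rewrite [RHS]big_mkcondr/=; apply: eq_bigr => k ki; rewrite (negbTE ki)/=.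
by case: (k \in window i); rewrite /=; ring.
Qed.

(** The indices whose indicators exclude each other pairwise: an element of [A] in the window of
    [j'] other than [j'] prevents [after_gap j' A]. *)
Definition clique J :=
  forall j j', j \in J -> j' \in J -> (j < j')%N -> j \in window j'.

Let ys S A : R := \sum_(j in S) (after_gap j A)%:R.

Let ys_ge0 S A : 0 <= ys S A. Proof. by apply: sumr_ge0. Qed.

Lemma clique_after_gap J A : clique J -> ys J A <= 1.
Proof.
move=> cJ; rewrite /ys -natr_sum lern1.
rewrite (eq_bigr (fun j => if after_gap j A then 1%N else 0%N)); last first.
  by move=> j _; case: ifP.
rewrite -big_mkcondr/= sum1dep_card; apply/card_le1_eqP => j j'.
wlog jj' : j j' / (j < j')%N.
  move=> H jP j'P; case: (ltngtP j j') => [lt|gt|/val_inj//]; first exact: H.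
  by apply/esym; exact: H.
rewrite !inE => /andP[jJ Yj] /andP[j'J /eqP Yj'].
have : j \in A :&: window j' by rewrite inE (after_gap_in _ _ Yj) cJ.
by rewrite Yj' inE => /eqP.
Qed.

Let ysU J1 J2 A : ys (J1 :|: J2) A <= ys J1 A + ys J2 A.
Proof.
rewrite /ys big_mkcond [X in _ <= X + _]big_mkcond [X in _ <= _ + X]big_mkcond.
rewrite -big_split/=; apply: ler_sum => j _; rewrite inE.
by case: (j \in J1); case: (j \in J2); rewrite /= ?addr0 ?add0r ?lerDl ?ler0n.
Qed.

Let ysS J1 J2 A : J1 \subset J2 -> ys J1 A <= ys J2 A.
Proof.
move=> /subsetP J12; rewrite /ys big_mkcond [leRHS]big_mkcond.
apply: ler_sum => j _; case: (boolP (j \in J1)) => [/J12 ->//|_].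
by case: ifP; rewrite ?ler0n.
Qed.

(** For intervals ending at their index, two windows meet exactly when one contains the end of the
    other; [nbhd2] collects the neighbours of neighbours. Both can be arbitrarily large, so only
    exclusion bounds the sums over them. *)
Definition nbhd i : {set 'I_m} := [set j | (j \in window i) || (i \in window j)].
Definition nbhd2 i : {set 'I_m} :=
  [set k : 'I_m | [exists j : 'I_m, (j \in nbhd i) && (k \in nbhd j)]].

Let win_lt i j : (j < i)%N -> (j \in window i) = ~~ g j i.
Proof.
by move=> ji; rewrite inE ji/=; case: eqP => // E; move: ji; rewrite E ltnn.
Qed.

Let win_gt i j : (i < j)%N -> (j \in window i) = false.
Proof.
move=> ij; rewrite inE ltnNge (ltnW ij)/= orbF; apply/eqP => E.
by move: ij; rewrite E ltnn.
Qed.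

Let clique_window i : clique (window i).
Proof.
move=> j j' ji j'i jj'; rewrite win_lt//.
have j'le : (j' <= i)%N.
  by rewrite leqNgt; apply/negP => /win_gt; rewrite j'i.
have jlt : (j < i)%N by exact: leq_trans j'le.
move: ji; rewrite win_lt//; apply: contra; exact: g_upper.
Qed.

Let dwindow i : {set 'I_m} := [set j | i \in window j].

Let clique_dwindow i : clique (dwindow i).
Proof.
move=> j j'; rewrite [j \in _]inE [j' \in _]inE => ij ij' jj'; rewrite win_lt//.
have jle : (i <= j)%N.
  by rewrite leqNgt; apply/negP => /win_gt; rewrite ij.
have ilt : (i < j')%N by exact: leq_ltn_trans jj'.
move: ij'; rewrite win_lt//; apply: contra; exact: g_lower.
Qed.

Let ys_nbhd i A : ys (nbhd i) A <= 2.
Proof.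
have -> : nbhd i = window i :|: dwindow i by apply/setP => j; rewrite !inE.
apply: le_trans (ysU _ _ _) _.
by apply: lerD; apply: clique_after_gap.
Qed.

(** [lo] and [hi] are the second-order neighbours below and above that are not direct ones. Any two
    of them on one side are separated from [i] by an intermediate [j], which forces the lower into
    the window of the upper. *)
Let lo i : {set 'I_m} := [set k : 'I_m | [&& (k < i)%N, k \notin window i &
  [exists j : 'I_m, (j \in window i) && (k \in window j)]]].

Let hi i : {set 'I_m} := [set k : 'I_m | [&& (i < k)%N, i \notin window k &
  [exists j : 'I_m, (i \in window j) && (j \in window k)]]].

Let window_le i j : (j \in window i) -> (j <= i)%N.
Proof. by move=> H; rewrite leqNgt; apply/negP => /win_gt; rewrite H. Qed.

Let window_up i j k : (j \in window i) -> (j <= k)%N -> (k <= i)%N -> k \in window i.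
Proof.
move=> ji jk; rewrite leq_eqVlt => /predU1P[/val_inj ->|ki].
  exact: in_window_self.
rewrite win_lt//; move: ji; rewrite win_lt ?(leq_ltn_trans jk)//.
by apply: contra; exact: g_lower.
Qed.

Let window_dn i j k : (j \in window i) -> (j <= k)%N -> (k <= i)%N -> j \in window k.
Proof.
move=> ji; rewrite leq_eqVlt => /predU1P[/val_inj <-|jk] ki.
  by rewrite in_window_self.
rewrite win_lt//; move: ji; rewrite win_lt ?(leq_trans jk)//.
by apply: contra; exact: g_upper.
Qed.

Let clique_lo i : clique (lo i).
Proof.
move=> k k'; rewrite [k \in _]inE [k' \in _]inE.
move=> /and3P[ki kVi /existsP[j /andP[ji kj]]] /and3P[k'i k'Vi _] kk'.
apply: (window_dn j); [by []|exact: ltnW|].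
rewrite leqNgt; apply/negP => jk'; move: k'Vi; rewrite (window_up i j)//.
  exact: ltnW.
exact: ltnW.
Qed.

Let clique_hi i : clique (hi i).
Proof.
move=> k k'; rewrite [k \in _]inE [k' \in _]inE.
move=> /and3P[ik iVk _] /and3P[ik' iVk' /existsP[j /andP[ij jk']]] kk'.
apply: (window_up k' j); [by []| |exact: ltnW].
rewrite leqNgt; apply/negP => kj; move: iVk; rewrite (window_dn j i)//.
  exact: ltnW.
exact: ltnW.
Qed.

Let ys_nbhd2 i A : ys (nbhd2 i) A <= 4.
Proof.
(* Four cliques cover [nbhd2 i]. On a path from [i] through [j] to [k], two steps in the same
   direction lead to [lo] or [hi]; a step back leaves [k] a direct neighbour because windows are
   intervals. *)
have sub : nbhd2 i \subset (window i :|: dwindow i) :|: (lo i :|: hi i).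
  apply/subsetP => k; rewrite [k \in nbhd2 i]inE => /existsP[j /andP[]].
  rewrite [_ \in nbhd _]inE [_ \in nbhd _]inE => ij jk.
  have [//|] := boolP (k \in _ :|: _).
  rewrite in_setU negb_or => /andP[]; rewrite in_setU negb_or => /andP[kVi].
  rewrite [k \in dwindow _]inE => iVk; rewrite in_setU negb_or => /andP[].
  rewrite [k \in lo _]inE [k \in hi _]inE kVi iVk/=.
  case: (ltngtP k i) => [ki|ik|/val_inj ki].
  - move=> /existsPn/(_ j) + _; case/orP: ij => [ji|ij].
      case/orP: jk => [kj|jk]; first by rewrite ji kj.
      by move: kVi; rewrite (window_up i j k ji (window_le _ _ jk) (ltnW ki)).
    case/orP: jk => [kj|jk].
      by move: kVi; rewrite (window_dn j k i kj (ltnW ki) (window_le _ _ ij)).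
    by have := window_le _ _ jk; have := window_le _ _ ij; lia.
  - move=> _ /existsPn/(_ j); case/orP: ij => [ji|ij].
      case/orP: jk => [kj|jk].
        by have := window_le _ _ kj; have := window_le _ _ ji; lia.
      by move: iVk; rewrite (window_up k j i jk (window_le _ _ ji) (ltnW ik)).
    case/orP: jk => [kj|jk]; last by rewrite ij jk.
    by move: iVk; rewrite (window_dn j i k ij (ltnW ik) (window_le _ _ kj)).
  - by move: kVi; rewrite ki in_window_self.
apply: le_trans (ysS _ _ A sub) _; apply: le_trans (ysU _ _ _) _.
have := ysU (window i) (dwindow i) A; have := ysU (lo i) (hi i) A.
have := clique_after_gap _ A (clique_window i).
have := clique_after_gap _ A (clique_dwindow i).
have := clique_after_gap _ A (clique_lo i).
have := clique_after_gap _ A (clique_hi i).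
by move: (ys _ A) (ys _ A) (ys _ A) (ys _ A) (ys _ A) (ys _ A) => *; lra.
Qed.

Definition gap_dev_at i A : R := (after_gap i A)%:R - gap_mean i.
Local Notation xi := gap_dev_at.

Let eta i A := \sum_(j in nbhd i) xi j A.
Let zeta i A := \sum_(j in nbhd2 i) xi j A.

(** The sum of indicators and its mean lie in the same interval [[0, c]], so centring does not
    double the bound. *)
Let sum_xi_le S (c : R) : (forall A, ys S A <= c) ->
  forall A, `|\sum_(j in S) xi j A| <= c.
Proof.
move=> yc A; rewrite /xi sumrB -/(ys S A).
have -> : \sum_(j in S) gap_mean j = E (ys S) by rewrite /gap_mean -Ex_sum.
have : E (ys S) <= c by rewrite -[leRHS](Ex_cst _ c db); apply: le_Ex.
have : 0 <= E (ys S) by apply: Ex_ge0.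
have := yc A; have := ys_ge0 S A.
by move=> *; rewrite ler_norml; apply/andP; split; lra.
Qed.

Let nbhdC i j : (i \in nbhd j) = (j \in nbhd i). Proof. by rewrite !inE orbC. Qed.

(** If [j < i] and [g j i], then [g k i] for all [k <= j], so no point of the window of [j] belongs
    to that of [i]. *)
Lemma disjoint_window i j : j \notin nbhd i -> [disjoint window j & window i].
Proof.
wlog ji : i j / (j < i)%N.
  move=> H; case: (ltngtP j i) => [ji|ij|/val_inj ->]; first exact: H.
    by rewrite nbhdC disjoint_sym; exact: H.
  by rewrite inE in_window_self.
rewrite [_ \in nbhd _]inE negb_or (win_lt _ _ ji) negbK => /andP[gji _].
rewrite -setI_eq0; apply/eqP/setP => k; rewrite [LHS]inE [RHS]inE.
apply/negP => /andP[/window_le kj]; rewrite win_lt ?(leq_ltn_trans kj)//.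
by rewrite (g_lower _ _ _ kj gji).
Qed.

Let xi_dep i : depends_on (xi i) (window i).
Proof. by move=> A; rewrite /xi /after_gap -setIA setIid. Qed.

Let sum_dep S J : (forall j, j \in S -> window j \subset J) ->
  depends_on (fun A => \sum_(j in S) xi j A) J.
Proof.
move=> SJ A; apply: eq_bigr => j jS.
exact: (depends_onS _ _ _ (SJ j jS) (xi_dep j)).
Qed.

Let U i := \bigcup_(j in nbhd i) window j.

Let W A := \sum_i xi i A.

Let WB (P : pred 'I_m) A : W A - \sum_(j | P j) xi j A = \sum_(j | ~~ P j) xi j A.
Proof. by rewrite /W (bigID P)/= [X in X - _]addrC addrK. Qed.

Let Weta_dep i : depends_on (fun A => W A - eta i A) (~: window i).
Proof.
have H := sum_dep (~: nbhd i) (~: window i).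
move=> A; rewrite !WB; have := H _ A.
under eq_bigl do rewrite inE; move=> -> => [|j].
  by apply: eq_bigl => j; rewrite inE.
by rewrite inE => /disjoint_window; rewrite disjoints_subset.
Qed.

(** An index outside [nbhd2 i] is no neighbour of any neighbour of [i], so its window misses all
    windows that determine [eta i]. *)
Let Wzeta_dep i : depends_on (fun A => W A - zeta i A) (~: U i).
Proof.
have H := sum_dep (~: nbhd2 i) (~: U i).
move=> A; rewrite !WB; have := H _ A.
under eq_bigl do rewrite inE; move=> -> => [|k].
  by apply: eq_bigl => j; rewrite inE.
rewrite inE => kn; rewrite subsetC; apply/bigcupsP => j ji.
rewrite -disjoints_subset; apply: disjoint_window.
by apply: contra kn => kj; rewrite inE; apply/existsP; exists j; rewrite ji nbhdC.
Qed.

Let window_U i : window i \subset U i.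
Proof. by apply: bigcup_sup; rewrite inE in_window_self. Qed.

Let eta_dep i : depends_on (eta i) (U i).
Proof. by apply: sum_dep => j ji; exact: bigcup_sup. Qed.

Let disjC J : [disjoint J & ~: J].
Proof. by rewrite -setI_eq0 setICr. Qed.

Let E_xi i : E (xi i) = 0.
Proof. by rewrite ExB (Ex_cst _ _ db) subrr. Qed.

Section Scaled.
Variable c : R.
Let sxi i A := c * xi i A.
Let seta i A := c * eta i A.
Let szeta i A := c * zeta i A.
Let sW A := \sum_i sxi i A.

Let sWE A : sW A = c * W A. Proof. by rewrite /sW -mulr_sumr. Qed.

Let indep1 i (F : R -> R) : E (fun A => sxi i A * F (sW A - seta i A)) = 0.
Proof.
rewrite (bern_indep a (sxi i) _ (window i) (~: window i))//.
- by rewrite ExZ E_xi mulr0 mul0r.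
- by move=> A; rewrite /sxi (xi_dep i A).
- by move=> A; rewrite !sWE /seta -!mulrBr (Weta_dep i A).
Qed.

Let F_dep i (F : R -> R) : depends_on (fun A => F (sW A - szeta i A)) (~: U i).
Proof. by move=> A; rewrite !sWE /szeta -!mulrBr (Wzeta_dep i A). Qed.

Let sxi_dep i : depends_on (sxi i) (U i).
Proof.
by move=> A; rewrite /sxi (depends_onS _ _ _ (window_U i) (xi_dep i) A).
Qed.

Let indep2 i (F : R -> R) : E (fun A => `|sxi i A| * F (sW A - szeta i A)) =
  E (fun A => `|sxi i A|) * E (fun A => F (sW A - szeta i A)).
Proof.
apply: (bern_indep a _ _ (U i) (~: U i)) => //.
by move=> A; rewrite (sxi_dep i A).
Qed.

Let indep3 i (F : R -> R) :
  E (fun A => sxi i A * seta i A * F (sW A - szeta i A)) =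
  E (fun A => sxi i A * seta i A) * E (fun A => F (sW A - szeta i A)).
Proof.
apply: (bern_indep a _ _ (U i) (~: U i)) => //.
by move=> A; rewrite (sxi_dep i A) /seta (eta_dep i A).
Qed.

Let seta_le i A : `|seta i A| <= `|c| * 4.
Proof.
rewrite normrM ler_wpM2l//; apply: (@le_trans _ _ 2); last by lra.
by apply: sum_xi_le => B; exact: ys_nbhd.
Qed.

Let szeta_le i A : `|szeta i A| <= `|c| * 4.
Proof.
by rewrite normrM ler_wpM2l//; apply: sum_xi_le => B; exact: ys_nbhd2.
Qed.

(** A centred indicator has absolute mean at most twice its probability. With [D = |c| * 4] this
    makes [M * D] at most [8 * c ^+ 2 * gap_total_mean]. *)
Let M_le : \sum_i E (fun A => `|sxi i A|) <= `|c| * (2 * gap_total_mean).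
Proof.
rewrite /gap_total_mean !mulr_sumr; apply: ler_sum => i _.
rewrite (eq_Ex _ _ (fun A => `|c| * `|xi i A|)); last first.
  by move=> A; rewrite normrM.
rewrite ExZ ler_wpM2l//.
apply: (@le_trans _ _ (E (fun A => (after_gap i A)%:R + gap_mean i))).
  apply: le_Ex => // A; apply: le_trans (ler_normB _ _) _.
  by rewrite normr_nat ger0_norm// gap_mean_ge0.
by rewrite ExD (Ex_cst _ _ db) -/(gap_mean i); lra.
Qed.

Lemma gap_scaled_chernoff (s x : R) : 0 <= s -> s * (`|c| * 4) <= 1 ->
  Pr (bern a) (fun A => x <= c * W A) <=
  expR (- (s * x) + expR 3 * (8 * c ^+ 2 * gap_total_mean) * s ^+ 2 / 2).
Proof.
move=> s0 sc.
have := local_dep_chernoff (bern a) sxi seta szeta (`|c| * 4) db indep1 indep2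
  seta_le szeta_le s x s0 sc.
rewrite (_ : Pr _ _ = Pr (bern a) (fun A => x <= c * W A)); last first.
  by apply: eq_Ex => A; rewrite -/(sW A) sWE.
move/le_trans; apply; rewrite ler_expR lerD2l ler_pM2r ?invr_gt0//.
rewrite ler_wpM2r ?sqr_ge0// ler_wpM2l ?expR_ge0//.
have := ler_wpM2r (_ : 0 <= `|c| * 4) M_le; rewrite mulr_ge0// => /(_ isT).
move/le_trans; apply; rewrite -(@real_normK _ c) ?num_real//; lra.
Qed.

Hypothesis var1 : \sum_i E (fun A => sxi i A * seta i A) = 1.

Lemma gap_scaled_berry_esseen (s : R) : 0 < `|c| -> `|c| * 4 <= 1 ->
  `|Pr (bern a) (fun A => c * W A <= s) - Phi s| <=
  (8 * c ^+ 2 * gap_total_mean + 1) * (8 * (phi (1 : R))^-1 + 72) * (`|c| * 4).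
Proof.
move=> c0 c1.
have := local_dep_berry_esseen (bern a) sxi seta szeta (`|c| * 4) db indep1 indep2
  indep3 seta_le szeta_le var1 _ c1 s.
rewrite (_ : Pr _ _ = Pr (bern a) (fun A => c * W A <= s)); last first.
  by apply: eq_Ex => A; rewrite -/(sW A) sWE.
rewrite mulr_gt0// => /(_ isT)/le_trans; apply.
rewrite ler_wpM2r ?mulr_ge0// ler_wpM2r//.
  by rewrite addr_ge0// mulr_ge0// invr_ge0 ltW// phi_gt0.
rewrite lerD2r.
have := ler_wpM2r (_ : 0 <= `|c| * 4) M_le; rewrite mulr_ge0// => /(_ isT).
move/le_trans; apply; rewrite -(@real_normK _ c) ?num_real//; lra.
Qed.

End Scaled.

(** For distinct neighbours the product of the two indicators vanishes, so their covariance is minus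
    the product of the means; the diagonal term contributes the mean minus its square. *)
Let E_xi_eta i : E (fun A => xi i A * eta i A) =
  gap_mean i - \sum_(j in nbhd i) gap_mean i * gap_mean j.
Proof.
transitivity (\sum_(j in nbhd i) E (fun A => xi i A * xi j A)).
  rewrite -Ex_sum; apply: eq_Ex => A; by rewrite mulr_sumr.
have Exx j : E (fun A => xi i A * xi j A) =
    E (fun A => (after_gap i A)%:R * (after_gap j A)%:R) - gap_mean i * gap_mean j.
  transitivity (E (fun A => (after_gap i A)%:R * (after_gap j A)%:R -
    (gap_mean j * (after_gap i A)%:R + gap_mean i * (xi j A)))).
    by apply: eq_Ex => A; rewrite /xi; ring.
  by rewrite ExB ExD !ExZ E_xi mulr0 addr0 -/(gap_mean i) mulrC.
under eq_bigr do rewrite Exx; rewrite sumrB; congr (_ - _).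
rewrite (bigD1 i)/=; last by rewrite [_ \in nbhd _]inE in_window_self.
rewrite big1 ?addr0 => [|j /andP[ji jni]].
  by apply: eq_Ex => A; case: (after_gap i A); rewrite ?mulr1 ?mulr0.
rewrite -[RHS](Ex_cst _ 0 db); apply: eq_Ex => A.
have : clique [set i; j].
  move=> k k'; rewrite !in_set2 => /predU1P[->|/eqP ->] /predU1P[->|/eqP ->];
    rewrite ?ltnn//.
    by move=> ij; move: ji; rewrite [_ \in nbhd _]inE => /orP[/window_le|//]; lia.
  by move=> ij; move: ji; rewrite [_ \in nbhd _]inE => /orP[//|/window_le]; lia.
move/(clique_after_gap _ A); rewrite /ys big_setU1 ?inE 1?eq_sym// big_set1.
rewrite /= -natrD lern1.
by case: (after_gap i A); case: (after_gap j A); rewrite ?mulr0 ?mul0r.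
Qed.

(** Summed over [i], pairs with [j] in the window of [i] and pairs with [i] in the window of [j]
    give the same total. The diagonal would be counted twice, whence the added squares. *)
Lemma gap_total_varE : \sum_i E (fun A => xi i A * eta i A) = gap_total_var.
Proof.
under eq_bigr do rewrite E_xi_eta; rewrite sumrB /gap_total_var -addrA.
congr (_ + _).
have -> : \sum_i \sum_(j in nbhd i) gap_mean i * gap_mean j =
   \sum_i \sum_(j in window i) gap_mean i * gap_mean j +
   \sum_i \sum_(j | (i \in window j) && (j != i)) gap_mean i * gap_mean j.
  rewrite -big_split/=; apply: eq_bigr => i _.
  rewrite (bigID (fun j => j \in window i))/=; congr (_ + _).
    apply: eq_bigl => j; rewrite [_ \in nbhd _]inE.
    by case: (j \in window i); rewrite ?andbF.
  apply: eq_bigl => j; rewrite [_ \in nbhd _]inE; case: (eqVneq j i) => [->|ji].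
    by rewrite in_window_self andbF.
  case: (boolP (j \in window i)) => [/window_le jw|]; rewrite ?andbF ?andbT//=.
  apply/esym/negP => /window_le wj.
  by move: ji; rewrite -val_eqE/= eqn_leq jw wj.
have -> : \sum_i \sum_(j | (i \in window j) && (j != i)) gap_mean i * gap_mean j =
  \sum_i \sum_(j in window i) gap_mean i * gap_mean j - \sum_i gap_mean i ^+ 2.
  rewrite (exchange_big_dep predT)//= -sumrB; apply: eq_bigr => j _.
  rewrite [in RHS](bigD1 j) ?in_window_self//= expr2 [X in _ = X - _]addrC addrK.
  by apply: eq_big => [i|i _]; [rewrite eq_sym|rewrite mulrC].
under eq_bigr do rewrite -mulr_sumr.
by ring.
Qed.

Let W_total A : W A = gap_total A - gap_total_mean.
Proof. by rewrite /W /xi sumrB. Qed.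

(** The scales 1 and -1 give the two one-sided tails. *)
Lemma gap_chernoff (s x : R) : 0 <= s -> s * 4 <= 1 ->
  Pr (bern a) (fun A => x <= `|gap_total A - gap_total_mean|) <=
  2 * expR (- (s * x) + expR 3 * (8 * gap_total_mean) * s ^+ 2 / 2).
Proof.
move=> s0 s4.
have H1 := gap_scaled_chernoff 1 s x s0; have H2 := gap_scaled_chernoff (-1) s x s0.
move: H1 H2; rewrite normrN normr1 sqrrN expr1n mulr1 mul1r => /(_ s4) H1 /(_ s4) H2.
apply: le_trans (Pr_union _ _ (fun A => x <= 1 * W A) (fun A => x <= -1 * W A) db _) _.
  move=> A; rewrite mul1r mulN1r -W_total.
  by have [_ ->|_ ->] := ger0P (W A); rewrite ?orbT.
lra.
Qed.

(** Scale [sigma^-1] normalizes the variance; [4 <= sigma] is the requirement that the local sums,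
    of size [4 / sigma], stay below 1. *)
Lemma gap_berry_esseen (s sigma : R) : 4 <= sigma -> sigma ^+ 2 = gap_total_var ->
  `|Pr (bern a) (fun A => gap_total A - gap_total_mean <= s * sigma) - Phi s| <=
  (8 * gap_total_mean / sigma ^+ 2 + 1) * (8 * (phi (1 : R))^-1 + 72) * (4 / sigma).
Proof.
move=> s4 sv.
have s0 : 0 < sigma by lra.
have := gap_scaled_berry_esseen sigma^-1 _ s.
rewrite gtr0_norm ?invr_gt0// s0.
rewrite (_ : Pr _ _ = Pr (bern a) (fun A => gap_total A - gap_total_mean <= s * sigma)).
  move=> /(_ _ isT) H; rewrite (_ : 8 * _ / _ = 8 * sigma^-1 ^+ 2 * gap_total_mean).
    rewrite (mulrC 4); apply: H; last by rewrite mulrC ler_pdivrMr// mul1r.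
    under eq_bigr => i _.
      under eq_Ex => A do rewrite mulrACA.
      rewrite ExZ; over.
    rewrite -mulr_sumr gap_total_varE -sv; field.
    by rewrite gt_eqF.
  by rewrite exprVn; ring.
by apply: eq_Ex => A; rewrite -W_total mulrC ler_pdivrMr.
Qed.

End GapProcess.

(** * Chebyshev's bound for the primorial *)

Section NatPrimes.
Local Open Scope nat_scope.

Lemma prod_primes_dvd (r : seq nat) (n : nat) : uniq r -> all prime r ->
  (\prod_(p <- r) p %| n) = all (fun p => p %| n) r.
Proof.
elim: r n => [|p r IH] n; first by rewrite big_nil dvd1n.
rewrite big_cons => /= /andP[pr ur] /andP[pp pR].
rewrite Gauss_dvd ?IH//.
elim: r pr pR {ur IH} => [|q r IH]; first by rewrite big_nil coprimen1.
rewrite inE negb_or => /andP[pq pr] /= /andP[qq rR].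
rewrite big_cons coprimeMr IH// andbT prime_coprime// dvdn_prime2//.
Qed.

(** This coefficient occurs twice in a row of sum [2 * 4 ^ m]. *)
Lemma binomial_half (m : nat) : 'C(m.*2.+1, m) <= 4 ^ m.
Proof.
have : \sum_(i < m.*2.+2) 'C(m.*2.+1, i) = 2 ^ m.*2.+1.
  rewrite -[2]/(1 + 1) expnDn; apply: eq_bigr => i _.
  by rewrite !exp1n !muln1.
have m1 : m < m.*2.+2 by lia.
have m2 : m.+1 < m.*2.+2 by lia.
rewrite (bigD1 (Ordinal m1))//= (bigD1 (Ordinal m2))/=; last first.
  by rewrite -val_eqE/=; lia.
have -> : 'C(m.*2.+1, m.+1) = 'C(m.*2.+1, m).
  by rewrite -bin_sub; [congr ('C(_, _)); lia|lia].
have -> : 2 ^ m.*2.+1 = 4 ^ m * 2.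
  by rewrite -[4]/(2 ^ 2) -expnM -expnSr mul2n.
lia.
Qed.

Lemma prod_primes_binomial (m : nat) :
  \prod_(m.+2 <= p < m.*2.+2 | prime p) p %| 'C(m.*2.+1, m).
Proof.
rewrite -big_filter prod_primes_dvd; last 2 first.
- by rewrite filter_uniq// iota_uniq.
- exact: filter_all.
apply/allP => p; rewrite mem_filter mem_index_iota => /and3P[pp mp pm].
have : p %| 'C(m.*2.+1, m) * (m`! * (m.*2.+1 - m)`!).
  by rewrite bin_fact ?dvdn_fact//; lia.
rewrite Euclid_dvdM// => /orP[//|]; rewrite Euclid_dvdM//.
have fac k : k < p -> ~~ (p %| k`!).
  elim: k => [|k IHk] kp; first by rewrite dvdn1 neq_ltn prime_gt1// orbT.
  rewrite factS Euclid_dvdM// negb_or IHk ?andbT; last exact: ltnW.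
  by apply/negP => /dvdn_leq; lia.
by move=> /orP[]; apply: contraTT => _; apply: fac; lia.
Qed.

(** Erdos's induction: an even [n] above 2 adds no prime, and for [n = 2 m + 1] the primes above
    [m + 1] divide the middle binomial coefficient. *)
Lemma primorial_le (n : nat) : \prod_(0 <= p < n.+1 | prime p) p <= 4 ^ n.
Proof.
elim/ltn_ind: n => n IH.
have [n2|n2] := leqP n 2.
  case: n n2 {IH} => [|[|[|//]]] _.
  - by rewrite big_mkcond big_nat1.
  - by rewrite big_mkcond/= !big_nat_recr//= big_geq.
  - by rewrite big_mkcond/= !big_nat_recr//= big_geq.
have [no|ne] := boolP (odd n); last first.
  case: n IH n2 ne => // n IH n2 ne.
  rewrite big_mkcond big_nat_recr//= -big_mkcond/=.
  have -> : prime n.+1 = false.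
    apply/negP => /primeP[_ /(_ 2)]; rewrite dvdn2 ne => /(_ isT).
    by move=> /orP[]; lia.
  rewrite muln1; apply: leq_trans (IH n _) _ => //.
  by rewrite leq_exp2l.
have [m nE] : exists m, n = m.*2.+1.
  by exists n./2; rewrite -[LHS](odd_double_half n) no.
rewrite nE (@big_cat_nat _ _ _ m.+2)//=; last by lia.
have -> : 4 ^ m.*2.+1 = 4 ^ m.+1 * 4 ^ m by rewrite -expnD; congr (_ ^ _); lia.
apply: leq_mul; first by apply: IH; lia.
apply: leq_trans (binomial_half m).
by apply: dvdn_leq (prod_primes_binomial m); rewrite bin_gt0; lia.
Qed.

End NatPrimes.

(** * Mertens' estimates with explicit errors *)

Section Mertens.
Context {R : realType}.
Local Notation ln := (@ln R).
Implicit Types (m n k p : nat).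

Lemma ln_nat_ge0 n : 0 <= ln n%:R.
Proof.
case: n => [|n]; first by rewrite ln0.
by apply: ln_ge0; rewrite ler1n.
Qed.

Lemma le_ln_nat m n : (0 < m)%N -> (m <= n)%N -> ln m%:R <= ln n%:R.
Proof.
by move=> m0 mn; rewrite ler_ln ?posrE ?ltr0n ?ler_nat// (leq_trans m0).
Qed.

Lemma ln_nat_gt0 n : (1 < n)%N -> 0 < ln n%:R.
Proof. by move=> n1; apply: ln_gt0; rewrite ltr1n. Qed.

Lemma ln_diff_le (x y : R) : 0 < x -> 0 < y -> ln y - ln x <= (y - x) / x.
Proof.
move=> x0 y0; rewrite -ln_div ?posrE//.
have -> : y / x = 1 + (y - x) / x by field; rewrite gt_eqF.
apply: le_ln1Dx; rewrite ltr_pdivlMr//; lra.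
Qed.

Lemma ln_prod_nat (r : seq nat) (P : pred nat) (F : nat -> nat) :
  (forall k, P k -> 0 < F k)%N ->
  ln (\prod_(k <- r | P k) F k)%:R = \sum_(k <- r | P k) ln (F k)%:R.
Proof.
move=> F0.
suff [] : (0 < \prod_(k <- r | P k) F k)%N /\
  ln (\prod_(k <- r | P k) F k)%:R = \sum_(k <- r | P k) ln (F k)%:R by [].
apply: (big_rec2 (fun x y => (0 < x)%N /\ ln x%:R = y)); first by rewrite ln1.
move=> k x y Pk [x0 xy]; rewrite muln_gt0 F0// x0; split => //.
by rewrite natrM lnM ?posrE ?ltr0n ?F0// xy.
Qed.

Lemma theta_le n : \sum_(0 <= p < n.+1 | prime p) ln p%:R <= n%:R * ln 4.
Proof.
have -> : n%:R * ln 4 = ln (4 ^ n)%:R.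
  by rewrite natrX lnXn// mulr_natl.
have -> : \sum_(0 <= p < n.+1 | prime p) ln p%:R =
    ln (\prod_(0 <= p < n.+1 | prime p) p)%:R.
  by rewrite ln_prod_nat//; exact: prime_gt0.
by rewrite le_ln_nat ?primorial_le// prodn_cond_gt0// => p; exact: prime_gt0.
Qed.

Lemma ln_fact_le n : ln n`!%:R <= n%:R * ln n%:R.
Proof.
elim: n => [|n IH]; first by rewrite fact0 ln1 mul0r.
rewrite factS natrM lnM ?posrE ?ltr0n ?fact_gt0//.
rewrite -[X in _ <= X%:R * _]add1n natrD mulrDl mul1r lerD2l.
apply: le_trans IH _; rewrite ler_wpM2l//.
case: n => [|n]; first by rewrite addr0 ln0// ln1.
by rewrite [1 + _]addrC natr1 le_ln_nat.
Qed.

Lemma ln_fact_ge n : n%:R * ln n%:R - n%:R <= ln n`!%:R.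
Proof.
elim: n => [|n IH]; first by rewrite fact0 ln1 mul0r subr0.
case: n IH => [_|n IH]; first by rewrite ln1 mulr0 sub0r lerN10.
rewrite factS natrM lnM ?posrE ?ltr0n ?fact_gt0//.
have H := @ln_diff_le n.+1%:R n.+2%:R; rewrite !ltr0n in H.
have {}H : n.+1%:R * (ln n.+2%:R - ln n.+1%:R) <= 1.
  have := H isT isT; rewrite (_ : (n.+2%:R - n.+1%:R) = 1).
    by rewrite ler_pdivlMr ?ltr0n// mulrC.
  by rewrite -natrB// subSnn.
have -> : n.+2%:R = n.+1%:R + 1 :> R by rewrite -natr1.
move: H IH; rewrite -[n.+2%:R]natr1; lra.
Qed.

Definition prime_wt p : R := (prime p)%:R * (ln p%:R / p%:R).

Lemma prime_wt_ge0 p : 0 <= prime_wt p.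
Proof. by rewrite mulr_ge0// divr_ge0// ln_nat_ge0. Qed.

(** This sum majorizes the contribution of higher prime powers to log n!. The induction carries a
    negative term modelled on the tail of the integral of [ln x / x^2]. *)
Lemma ln_over_sq_sum n : \sum_(2 <= k < n.+1) ln k%:R / (k%:R * k.-1%:R) <= 2.
Proof.
suff H : (0 < n)%N -> \sum_(2 <= k < n.+1) ln k%:R / (k%:R * k.-1%:R) <=
   2 - (ln n%:R + 2) / n%:R.
  case: n H => [_|n H]; first by rewrite big_geq.
  apply: le_trans (H isT) _; rewrite gerBl divr_ge0// addr_ge0//.
  exact: ln_nat_ge0.
elim: n => // -[_ _|n IH _].
  by rewrite big_geq// ln1 add0r divr1 subrr.
rewrite big_nat_recr//=; apply: le_trans (lerD (IH isT) (lexx _)) _.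
have H : ln n.+2%:R - ln n.+1%:R <= n.+1%:R^-1.
  apply: le_trans (ln_diff_le _ _ _ _) _; rewrite ?ltr0n//.
  by rewrite -natrB// subSnn mul1r.
have n1 : 1 <= n.+1%:R :> R by rewrite ler1n.
have -> : n.+2%:R = n.+1%:R + 1 :> R by rewrite natr1.
rewrite -[n.+2%:R]natr1 in H.
move: (n.+1%:R : R) n1 H => x x1 H.
rewrite -subr_ge0.
have -> : 2 - (ln (x + 1) + 2) / (x + 1) - (2 - (ln x + 2) / x + ln (x + 1) / ((x + 1) * x))
  = (2 - (x + 1) * (ln (x + 1) - ln x)) / (x * (x + 1)).
  field; rewrite gt_eqF//=; [|lra]; by rewrite gt_eqF//; lra.
rewrite divr_ge0//; last by rewrite mulr_ge0//; lra.
have : (x + 1) * (ln (x + 1) - ln x) <= (x + 1) * x^-1 by rewrite ler_wpM2l//; lra.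
have : (x + 1) * x^-1 <= 2 by rewrite ler_pdivrMr//; lra.
lra.
Qed.

Lemma logn_fact_ge p n : prime p -> n%:R / p%:R - 1 <= (logn p n`!)%:R :> R.
Proof.
move=> pp; rewrite logn_fact//.
case: n => [|n]; first by rewrite big_geq// mul0r sub0r lerN10.
rewrite big_ltn// expn1 natrD.
have : n.+1%:R / p%:R - 1 <= (n.+1 %/ p)%:R :> R.
  have p0 : 0 < p%:R :> R by rewrite ltr0n prime_gt0.
  rewrite lerBlDr ler_pdivrMr// natr1 -natrM ler_nat ltnW//.
  by rewrite ltn_ceil// prime_gt0.
move=> H; apply: le_trans H _; by rewrite lerDl.
Qed.

Lemma logn_fact_le p n : prime p ->
  (logn p n`!)%:R <= n%:R / p%:R + n%:R / (p%:R * p.-1%:R) :> R.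
Proof.
move=> pp; rewrite logn_fact//.
have p2 : 2 <= p%:R :> R by rewrite ler_nat prime_gt1.
have -> : p.-1%:R = p%:R - 1 :> R by rewrite -subn1 natrB// prime_gt0.
have p1 : (p%:R - 1 : R) != 0 by rewrite gt_eqF//; lra.
have p0 : (p%:R : R) != 0 by rewrite gt_eqF//; lra.
apply: (@le_trans _ _ (\sum_(1 <= k < n.+1) n%:R * (p%:R^-1) ^+ k)).
  rewrite natr_sum; apply: ler_sum_nat => k _.
  rewrite exprVn ler_pdivlMr ?exprn_gt0; [|lra|lra].
  by rewrite -natrX -natrM ler_nat leq_trunc_div.
have -> : n%:R / p%:R + n%:R / (p%:R * (p%:R - 1)) = n%:R * (p%:R - 1)^-1 :> R.
  by field; rewrite ?p0 ?p1.
rewrite -mulr_sumr ler_wpM2l//.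
have -> : \sum_(1 <= k < n.+1) p%:R^-1 ^+ k = (1 - p%:R^-1 ^+ n) / (p%:R - 1) :> R.
  elim: n => [|n IH]; first by rewrite big_geq// subrr mul0r.
  rewrite big_nat_recr//= IH exprSr; move: (p%:R^-1 ^+ n) => x.
  by field; rewrite ?p0 ?p1.
by rewrite ler_piMl ?invr_ge0 ?gerBl ?exprn_ge0 ?invr_ge0//; lra.
Qed.

Lemma ln_logn n B : (0 < n)%N -> (n <= B)%N ->
  ln n%:R = \sum_(0 <= p < B.+1 | prime p) (logn p n)%:R * ln p%:R.
Proof.
move=> n0 nB; have := widen_partn predT nB; rewrite partnT// => E.
rewrite {1}E ln_prod_nat => [|k _]; last first.
  by case: k => [|k]; [rewrite lognE/=|rewrite expn_gt0].
rewrite [RHS]big_mkcond [LHS]big_mkcond/=; apply: eq_bigr => p _.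
case: (boolP (prime p)) => pp; last by rewrite lognE (negbTE pp) ln1.
by rewrite natrX lnXn ?ltr0n ?prime_gt0// mulr_natl.
Qed.

Lemma ln_fact_logn n B : (n <= B)%N ->
  ln n`!%:R = \sum_(0 <= p < B.+1 | prime p) (logn p n`!)%:R * ln p%:R.
Proof.
elim: n => [_|n IH nB].
  by rewrite fact0 ln1 big1// => p _; rewrite logn1 mul0r.
rewrite factS natrM lnM ?posrE ?ltr0n ?fact_gt0// (IH (ltnW nB)).
rewrite (ln_logn n.+1 B)// -big_split/=; apply: eq_bigr => p _.
by rewrite lognM ?fact_gt0// natrD mulrDl.
Qed.

(** Legendre's formula for log n! is compared with Stirling. Upwards, the floors lose at most
    Chebyshev's sum, [ln 4 <= 3] after division by [n]; downwards, 1 comes from Stirling and 2 from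
    the higher powers. *)
Lemma mertens1 n : (0 < n)%N ->
  `|\sum_(0 <= p < n.+1) prime_wt p - ln n%:R| <= 3.
Proof.
move=> n0.
have np : 0 < n%:R :> R by rewrite ltr0n.
have lnF := ln_fact_logn n n (leqnn n).
have up : n%:R * \sum_(0 <= p < n.+1) prime_wt p <= n%:R * ln n%:R + n%:R * ln 4.
  apply: le_trans _ (lerD (ln_fact_le n) (theta_le n)).
  rewrite lnF -big_split/= mulr_sumr [leRHS]big_mkcond/=; apply: ler_sum_nat => p _.
  rewrite /prime_wt; case: (boolP (prime p)) => [pp|_]; last by rewrite mul0r mulr0.
  rewrite mul1r; have := logn_fact_ge p n pp; have := ln_nat_ge0 p.
  move=> l0 /(ler_wpM2r l0); rewrite mulrBl mul1r; lra.
have dn : n%:R * ln n%:R - n%:R <= n%:R * \sum_(0 <= p < n.+1) prime_wt p + n%:R * 2.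
  apply: le_trans (ln_fact_ge n) _.
  apply: le_trans _ (lerD (lexx _) (ler_wpM2l (ltW np) (ln_over_sq_sum n))).
  rewrite lnF !mulr_sumr [leLHS]big_mkcond/=.
  rewrite (@big_cat_nat _ _ _ 2)//= [X in _ <= X + _](@big_cat_nat _ _ _ 2)//=.
  rewrite -addrA -big_split/=; apply: lerD.
    apply: ler_sum_nat => -[|[|//]] _ /=;
    by rewrite mulr_ge0 ?prime_wt_ge0// ltW.
  apply: ler_sum_nat => p /andP[p2 _]; have l0 := ln_nat_ge0 p.
  have dl : 0 <= n%:R * (ln p%:R / (p%:R * p.-1%:R)) by rewrite mulr_ge0// divr_ge0// mulr_ge0.
  rewrite /prime_wt; case: (boolP (prime p)) => [pp|_]; last first.
    by rewrite mul0r mulr0 add0r.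
  rewrite mul1r; apply: le_trans (ler_wpM2r l0 (logn_fact_le p n pp)) _.
  by rewrite mulrDl !mulrA [_ / _ * _]mulrAC [n%:R / (_) * _]mulrAC.
have ln4 : ln 4 <= 3.
  by rewrite (_ : 4 = 1 + 3 :> R); [apply: le_ln1Dx; lra|ring].
have up' : \sum_(0 <= p < n.+1) prime_wt p <= ln n%:R + ln 4.
  by rewrite -(ler_pM2l np) mulrDr.
have dn' : ln n%:R - 1 <= \sum_(0 <= p < n.+1) prime_wt p + 2.
  by rewrite -(ler_pM2l np); move: dn; lra.
by rewrite ler_norml; apply/andP; split; lra.
Qed.

(** Summation by parts against the bounded remainder [r]. Isolating the boundary term [r n * g n]
    leaves an estimate that telescopes for nonincreasing [g]. *)
Lemma abel_sum_bound (a L g : nat -> R) (C : R) m n : (m < n)%N ->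
  (forall k, (m <= k)%N -> `|\sum_(0 <= i < k.+1) a i - L k| <= C) ->
  (forall k, (m < k)%N -> 0 <= g k) ->
  (forall k, (m < k)%N -> g k.+1 <= g k) ->
  `|\sum_(m.+1 <= k < n.+1) (a k - (L k - L k.-1)) * g k| <= 2 * C * g m.+1.
Proof.
move=> mn HC g0 gd.
pose r k := \sum_(0 <= i < k.+1) a i - L k.
have rE k : a k.+1 - (L k.+1 - L k) = r k.+1 - r k.
  by rewrite /r (big_nat_recr k.+1)//=; ring.
suff H : `|\sum_(m.+1 <= k < n.+1) (a k - (L k - L k.-1)) * g k - r n * g n| <=
    C * (2 * g m.+1 - g n).
  have : `|r n * g n| <= C * g n.
    by rewrite normrM (ger0_norm (g0 _ mn)) ler_wpM2r ?g0//; exact/HC/ltnW.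
  move: H; set S := \sum_(_ <= _ < _) _ => H1 H2.
  rewrite -[S](subrK (r n * g n)); apply: le_trans (ler_normD _ _) _; lra.
elim: n mn => // n IH; rewrite ltnS leq_eqVlt => /predU1P[<-|mn].
  rewrite big_nat1 rE -mulrBl addrC addKr normrM normrN (ger0_norm (g0 _ (leqnn _))).
  have -> : C * (2 * g m.+1 - g m.+1) = C * g m.+1 by ring.
  by rewrite ler_wpM2r ?g0//; exact: HC.
rewrite big_nat_recr//=; last exact: ltnW.
rewrite rE; move: (IH mn); set S := \sum_(_ <= _ < _) _ => {}IH.
have -> : S + (r n.+1 - r n) * g n.+1 - r n.+1 * g n.+1 =
  (S - r n * g n) + r n * (g n - g n.+1) by ring.
apply: le_trans (ler_normD _ _) _.
have : `|r n * (g n - g n.+1)| <= C * (g n - g n.+1).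
  rewrite normrM [`|g n - _|]ger0_norm ?subr_ge0 ?gd// ler_wpM2r ?subr_ge0 ?gd//.
  exact/HC/ltnW.
lra.
Qed.

Lemma ln_ratio_bounds (x y : R) : 0 < x -> x <= y ->
  (y - x) / y <= ln y - ln x <= (y - x) / x.
Proof.
move=> x0 xy; have y0 : 0 < y by exact: lt_le_trans xy.
rewrite ln_diff_le// andbT.
have := ln_diff_le _ _ y0 x0; rewrite -(opprB y x) mulNr; lra.
Qed.

Lemma ln_succ_diff_le k : (2 <= k)%N -> ln k%:R - ln k.-1%:R <= 1.
Proof.
case: k => [|[|k]]// _; apply: le_trans (ln_diff_le _ _ _ _) _; rewrite ?ltr0n//.
by rewrite -natrB// subSnn mul1r invf_le1 ?ltr0n// ler1n.
Qed.

Lemma prime_recip_wt p : (2 <= p)%N ->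
  (prime p)%:R / p%:R = prime_wt p * (ln p%:R)^-1.
Proof.
move=> p2; rewrite /prime_wt; have l0 := ln_nat_gt0 p p2.
by field; rewrite !gt_eqF// ltr0n ltnW.
Qed.

Lemma mertens_abel (g : nat -> R) m n : (1 < m)%N -> (m < n)%N ->
  (forall k, (m < k)%N -> 0 <= g k) ->
  (forall k, (m < k)%N -> g k.+1 <= g k) ->
  `|\sum_(m.+1 <= k < n.+1) prime_wt k * g k -
    \sum_(m.+1 <= k < n.+1) (ln k%:R - ln k.-1%:R) * g k| <= 6 * g m.+1.
Proof.
move=> m1 mn g0 gd; rewrite -sumrB.
under eq_bigr do rewrite -mulrBl.
have -> : 6 = 2 * 3 :> R by ring.
apply: (abel_sum_bound prime_wt (fun k => ln k%:R)) => // k mk.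
by apply: mertens1; lia.
Qed.

Lemma ln_telescope m n (F : nat -> R) : (m <= n)%N ->
  \sum_(m.+1 <= k < n.+1) (F k - F k.-1) = F n - F m.
Proof.
move=> mn; rewrite -(telescope_sumr _ mn).
by rewrite big_add1.
Qed.

(** Abel summation with [g = 1 / ln] costs 6. Replacing the weighted increments of [ln] by those of
    [ln ln] costs one more, since the errors are dominated by a telescoping sum of increments of
    [1 / ln]. *)
Lemma mertens2_nat m n : (1 < m)%N -> (m <= n)%N ->
  `|\sum_(m.+1 <= p < n.+1) (prime p)%:R / p%:R - (ln (ln n%:R) - ln (ln m%:R))| <=
  7 / ln m%:R.
Proof.
move=> m1; have lm := ln_nat_gt0 m m1.
rewrite leq_eqVlt => /predU1P[<-|mn].
  by rewrite big_geq// !subrr normr0 divr_ge0// ltW.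
have pos k : (m <= k)%N -> 0 < ln k%:R by move=> mk; apply: ln_nat_gt0; lia.
pose g k := (ln k%:R)^-1.
have g0 k : (m < k)%N -> 0 <= g k by move=> mk; rewrite invr_ge0 ltW// pos// ltnW.
have gd k : (m <= k)%N -> g k.+1 <= g k.
  move=> mk; rewrite lef_pV2 ?posrE ?pos// ?le_ln_nat//; lia.
have H1 := mertens_abel g m n m1 mn g0 (fun k mk => gd k (ltnW mk)).
rewrite (eq_big_nat _ _ (F2 := fun k => prime_wt k * g k)); last first.
  by move=> k /andP[mk _]; rewrite prime_recip_wt//; lia.
have H2 : `|\sum_(m.+1 <= k < n.+1) (ln k%:R - ln k.-1%:R) * g k -
   (ln (ln n%:R) - ln (ln m%:R))| <= g m.
  have mn' := ltnW mn.
  rewrite -(ln_telescope m n (fun k => ln (ln k%:R)) mn') -sumrB.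
  apply: le_trans (ler_norm_sum _ _ _) _.
  apply: (@le_trans _ _ (\sum_(m.+1 <= k < n.+1) - (g k - g k.-1))); last first.
    rewrite sumrN ln_telescope// opprB gerBl; exact: g0.
  apply: ler_sum_nat => -[//|k]; rewrite ltnS => /andP[mk _] /=.
  have lk := pos k mk; have lk1 := pos k.+1 (leqW mk).
  have lkk : ln k%:R <= ln k.+1%:R by rewrite le_ln_nat//; lia.
  have d1 := ln_succ_diff_le k.+1 (leq_trans m1 (leqW mk)).
  rewrite /= in d1.
  have /andP[A B] := ln_ratio_bounds _ _ lk lkk.
  rewrite /g distrC ger0_norm ?subr_ge0//.
  apply: (@le_trans _ _ ((ln k.+1%:R - ln k%:R) * ((ln k%:R)^-1 - (ln k.+1%:R)^-1))).
    by rewrite mulrBr lerD2r.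
  rewrite opprB ler_piMl// subr_ge0; exact: gd.
have -> : 7 / ln m%:R = 6 * g m + g m by rewrite /g; ring.
set S := \sum_(_ <= _ < _) prime_wt _ * _.
rewrite -[S](subrK (\sum_(m.+1 <= k < n.+1) (ln k%:R - ln k.-1%:R) * g k)) -addrA.
apply: le_trans (ler_normD _ _) _; apply: lerD H2.
by apply: le_trans H1 _; rewrite ler_pM2l// gd.
Qed.

(** Serves to sum the relative errors of order [1 / ln p] in the means. Here [g = 1 / ln^2], and the
    resulting sum is again dominated by increments of [1 / ln]. *)
Lemma sum_prime_recip_ln : exists C : R, forall n,
  \sum_(0 <= p < n) (prime p)%:R / (p%:R * ln p%:R) <= C.
Proof.
pose g k := (ln k%:R ^+ 2)^-1 : R.
pose F k := (prime k)%:R / (k%:R * ln k%:R) : R.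
have F0 k : 0 <= F k by rewrite divr_ge0// mulr_ge0// ln_nat_ge0.
exists (\sum_(0 <= p < 3) F p + (6 * g 3 + (ln 2%:R)^-1)) => n.
have [n3|n3] := leqP n 3.
  rewrite [X in _ <= X + _](@big_cat_nat _ _ _ n)//= -addrA lerDl.
  by rewrite addr_ge0 ?sumr_ge0// addr_ge0 ?mulr_ge0 ?invr_ge0 ?sqr_ge0// ln_nat_ge0.
case: n n3 => // n; rewrite ltnS => n2.
rewrite (@big_cat_nat _ _ _ 3)//=; last by lia.
rewrite lerD2l.
have pos k : (2 <= k)%N -> 0 < ln k%:R by exact: ln_nat_gt0.
have gd k : (2 < k)%N -> g k.+1 <= g k.
  move=> k2; rewrite lef_pV2 ?posrE ?exprn_gt0 ?pos//; try lia.
  by rewrite lerXn2r ?nnegrE ?ln_nat_ge0// le_ln_nat//; lia.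
have H1 := mertens_abel g 2 n isT n2 (fun k _ => _) gd.
have {}H1 := H1 ltac:(by move=> k; rewrite invr_ge0 sqr_ge0).
rewrite (eq_big_nat _ _ (F2 := fun k => prime_wt k * g k)); last first.
  move=> k /andP[k2 _]; rewrite /F /prime_wt /g; have := pos k (ltnW k2) => lk.
  by field; rewrite !gt_eqF// ltr0n; lia.
have H2 : \sum_(3 <= k < n.+1) (ln k%:R - ln k.-1%:R) * g k <= (ln 2%:R)^-1.
  apply: (@le_trans _ _ (\sum_(3 <= k < n.+1) - ((ln k%:R)^-1 - (ln k.-1%:R)^-1))); last first.
    rewrite sumrN (ln_telescope 2 n (fun k => (ln k%:R)^-1)) ?opprB ?gerBl ?invr_ge0 ?ln_nat_ge0//.
    exact: ltnW.
  apply: ler_sum_nat => -[//|k]; rewrite ltnS => /andP[k2 _] /=.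
  have lk := pos k k2; have lk1 := pos k.+1 (leqW k2).
  have lkk : ln k%:R <= ln k.+1%:R by rewrite le_ln_nat//; lia.
  rewrite /g opprB.
  have -> : (ln k%:R)^-1 - (ln k.+1%:R)^-1 =
    (ln k.+1%:R - ln k%:R) / (ln k%:R * ln k.+1%:R).
    by field; rewrite !gt_eqF.
  rewrite ler_wpM2l ?subr_ge0// lef_pV2 ?posrE ?mulr_gt0//.
  by rewrite expr2 ler_pM2r.
by move: H1; rewrite ler_norml => /andP[_ H1]; lra.
Qed.

Lemma mertens2_real : exists2 C : R, 0 <= C & forall (x : R) n, 3 <= x -> x <= n%:R ->
  `|\sum_(0 <= p < n | prime p && (x <= p%:R)) p%:R^-1 -
    (ln (ln n%:R) - ln (ln x))| <= C / ln x.
Proof.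
(* The integer version costs [7 / ln m] and the roundings at the two ends [1 / ln m] each; then
   [ln x <= 2 * ln m] doubles 9. *)
exists 18 => // x n x3 xn.
have [m [mx xm]] : exists m : nat, m%:R < x /\ x <= m.+1%:R.
  have ex : exists k : nat, x <= k%:R by exists n.
  case: (ex_minnP ex) => -[|m] xm min; first by move: xm; lra.
  exists m; split => //; rewrite ltNge; apply/negP => /min; rewrite ltnn//.
have m2 : (1 < m)%N.
  by rewrite -ltnS -(ltr_nat R); apply: lt_le_trans xm; lra.
have mn : (m < n)%N by rewrite -(ltr_nat R); exact: lt_le_trans xn.
case: n mn xn => // n; rewrite ltnS => mn xn.
have m0 : (0 < m)%N := ltnW m2; have n0 : (0 < n)%N := leq_trans m0 mn.
have m1m2 : (m.+1 <= m ^ 2)%N by rewrite -mulnn; clear -m2; nia.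
have lm := ln_nat_gt0 m m2.
have ln_n : ln n.+1%:R - ln n%:R <= 1 := ln_succ_diff_le n.+1 n0.
have lnm : ln m.+1%:R - ln m%:R <= 1 := ln_succ_diff_le m.+1 m0.
have x0 : 0 < x by lra.
have lxm : ln m%:R <= ln x by rewrite ler_ln ?posrE ?ltr0n ?ltW.
have lxm1 : ln x <= ln m.+1%:R by rewrite ler_ln ?posrE ?ltr0n.
have lmm : ln m.+1%:R <= 2 * ln m%:R.
  have -> : 2 * ln m%:R = ln (m ^ 2)%:R.
    by rewrite natrX lnXn ?ltr0n ?mulr_natl.
  by rewrite le_ln_nat.
have lmn : ln m%:R <= ln n%:R := le_ln_nat m n m0 mn.
have lnn : ln n%:R <= ln n.+1%:R := le_ln_nat n n.+1 n0 (leqnSn n).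
have lx : 0 < ln x by lra.
have H := mertens2_nat m n m2 mn.
have -> : \sum_(0 <= p < n.+1 | prime p && (x <= p%:R)) p%:R^-1 =
    \sum_(m.+1 <= p < n.+1) (prime p)%:R / p%:R :> R.
  rewrite big_mkcond (@big_cat_nat _ _ _ m.+1); [|by []|by []].
  rewrite /= big_nat big1 ?add0r => [|p /andP[_ pm]].
    apply: eq_big_nat => p /andP[mp _]; rewrite (le_trans xm) ?ler_nat// andbT.
    by case: (prime p); rewrite ?mul1r ?mul0r.
  by rewrite [x <= _]leNgt (le_lt_trans _ mx) ?andbF// ler_nat -ltnS.
have /andP[A1 A2] := ln_ratio_bounds _ _ (lt_le_trans lm lmn) lnn.
have /andP[B1 B2] := ln_ratio_bounds _ _ lm lxm.
have C1 : ln (ln n.+1%:R) - ln (ln n%:R) <= 1 / ln m%:R.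
  apply: le_trans A2 _; rewrite ler_pM ?subr_ge0 ?invr_ge0//; last first.
    by rewrite lef_pV2 ?posrE//; lra.
  lra.
have C2 : ln (ln x) - ln (ln m%:R) <= 1 / ln m%:R.
  by apply: le_trans B2 _; rewrite ler_pM ?subr_ge0 ?invr_ge0 ?(ltW lm)//; lra.
have C3 : 0 <= ln (ln n.+1%:R) - ln (ln n%:R).
  by apply: le_trans A1; rewrite divr_ge0//; lra.
have C4 : 0 <= ln (ln x) - ln (ln m%:R).
  by apply: le_trans B1; rewrite divr_ge0//; lra.
have C5 : (ln m%:R)^-1 <= 2 / ln x.
  by rewrite ler_pdivlMr// mulrC ler_pdivrMr//; lra.
move: H; rewrite !ler_norml => /andP[? ?]; apply/andP; split; lra.
Qed.

End Mertens.

(** * Asymptotics of the mean and variance of the model *)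

Section GapAsymptotics.
Context {R : realType}.
Variable z : R.
Hypothesis z0 : 0 <= z.
Local Notation ln := (@ln R).
Local Notation lam := (expR (- z)).
Implicit Types (i k n : nat).

Definition gap_start i : R := i%:R `^ lam.

Definition prime_gap_mean i : R := (prime i)%:R / i%:R *
  \prod_(0 <= k < i | prime k && (gap_start i <= k%:R)) (1 - k%:R^-1).

Let lam0 : 0 < lam. Proof. exact: expR_gt0. Qed.
Let lam1 : lam <= 1. Proof. by rewrite expR_le1 oppr_le0. Qed.

(** Raising to the powers [expR z] and [lam] are inverse operations, so the gap condition becomes a
    lower bound on [k] and Mertens applies. *)
Lemma gap_startP k i : (0 < i)%N ->
  (k%:R `^ expR z < i%:R :> R) = ~~ (gap_start i <= k%:R).
Proof.
move=> i0; rewrite -ltNge /gap_start.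
have E (x : R) : 0 <= x -> (x `^ expR z) `^ lam = x.
  by move=> x0; rewrite -powRrM -expRD subrr expR0 powRr1.
have E' (x : R) : 0 <= x -> (x `^ lam) `^ expR z = x.
  by move=> x0; rewrite -powRrM -expRD addNr expR0 powRr1.
apply/idP/idP => H.
  rewrite -[ltLHS]E// gt0_ltr_powR ?nnegrE ?powR_ge0//.
by rewrite -[ltRHS]E'// gt0_ltr_powR ?nnegrE ?powR_ge0 ?expR_gt0.
Qed.

Lemma ln_gap_start i : ln (gap_start i) = lam * ln i%:R.
Proof. by rewrite ln_powR. Qed.

Lemma gap_start_le i : (0 < i)%N -> gap_start i <= i%:R.
Proof. by move=> i0; apply: ler1_powR; rewrite ?ler1n. Qed.

Let prime_inv p : prime p -> 0 < (p%:R^-1 : R) /\ (p%:R^-1 : R) <= 2^-1.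
Proof.
move=> pp; have p1 := prime_gt1 pp; rewrite invr_gt0 ltr0n ltnW//; split => //.
by rewrite lef_pV2 ?posrE ?ltr0n ?ler_nat//; exact: ltnW.
Qed.

Let one_sub_ge (x : R) : 0 <= x -> x <= 2^-1 -> expR (- (x + 2 * x ^+ 2)) <= 1 - x.
Proof.
move=> x0 x1; have x2 : 0 < 1 - x by lra.
rewrite expRN -[leRHS]invrK lef_pV2 ?posrE ?invr_gt0 ?expR_gt0//.
apply: (@le_trans _ _ (expR (x / (1 - x)))).
  apply: le_trans (expR_ge1Dx _); rewrite le_eqVlt; apply/orP; left; apply/eqP.
  by field; rewrite gt_eqF.
rewrite ler_expR ler_pdivrMr//; nra.
Qed.

Let expRN_lip (a b : R) : 0 <= a -> 0 <= b ->
  `|expR (- a) - expR (- b)| <= `|a - b|.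
Proof.
wlog ab : a b / a <= b.
  move=> H a0 b0; have [ab|/ltW ba] := leP a b; first exact: H.
  by rewrite distrC (distrC a); exact: H.
move=> a0 b0; rewrite ger0_norm ?subr_ge0 ?ler_expR ?lerN2//.
rewrite distrC ger0_norm ?subr_ge0//.
have -> : expR (- b) = expR (- a) * expR (- (b - a)) by rewrite -expRD; congr expR; ring.
rewrite -{1}[expR (- a)]mulr1 -mulrBr.
apply: (@le_trans _ _ (1 * (b - a))); last by rewrite mul1r.
have := expR_ge1Dx (- (b - a)) => H.
rewrite ler_pM ?expR_ge0//; last lra.
  by rewrite subr_ge0 expR_le1; lra.
by rewrite expR_le1; lra.
Qed.

Let S i : R := \sum_(0 <= k < i | prime k && (gap_start i <= k%:R)) k%:R^-1.
Let Pr i : R := \prod_(0 <= k < i | prime k && (gap_start i <= k%:R)) (1 - k%:R^-1).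

Let S_ge0 i : 0 <= S i. Proof. by apply: sumr_ge0 => k _; rewrite invr_ge0. Qed.

Let Pr_bounds i : 0 <= Pr i <= 1.
Proof.
apply/andP; split; last apply: prodr_ile1.
  by apply: prodr_ge0 => k /andP[/prime_inv[]]; lra.
by move=> k /andP[/prime_inv[]]; lra.
Qed.

(** In Mertens' theorem the main term [ln (ln i) - ln (lam * ln i)] is exactly [z]. *)
Let S_asym : exists2 C : R, 0 <= C & forall i, 3 <= gap_start i ->
  `|S i - z| <= C / ln i%:R.
Proof.
have [C C0 H] := @mertens2_real R.
exists (C / lam); first by rewrite divr_ge0// ltW.
move=> i si.
have i0 : (0 < i)%N.
  by case: i si => // si; move: si; rewrite /gap_start powR0 ?gt_eqF//; lra.
have := H _ _ si (gap_start_le i i0).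
have si3 : 0 < ln (gap_start i) by apply: ln_gt0; lra.
move: si3; rewrite ln_gap_start => l0.
have li : 0 < ln i%:R by move: l0; rewrite pmulr_rgt0.
have -> : ln (ln i%:R) - ln (lam * ln i%:R) = z.
  by rewrite lnM ?posrE// expRK; ring.
by rewrite invfM mulrA.
Qed.

(** Windows starting below 3, outside the range of Mertens' estimate, occur only for bounded [i];
    there [1 / ln i] is bounded below and trivial bounds suffice. *)
Let small_start i : (1 < i)%N -> gap_start i < 3 ->
  1 <= (ln 3 / lam) / ln i%:R /\ i%:R <= expR (ln 3 / lam).
Proof.
move=> i1 si; have li : 0 < ln i%:R := ln_nat_gt0 i i1.
have s0 : 0 < gap_start i by rewrite powR_gt0// ltr0n ltnW.
have H : lam * ln i%:R <= ln 3 by rewrite -ln_gap_start ler_ln ?posrE// ltW.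
split; first by rewrite ler_pdivlMr// mul1r ler_pdivlMr// mulrC.
rewrite -[leLHS]lnK ?posrE ?ltr0n ?ler_expR; last by rewrite ltnW.
by rewrite ler_pdivlMr// mulrC.
Qed.

(** The product lies between [exp(- S - 2 Q)] and [exp(- S)]. The sum of squares [Q] is at most [S]
    divided by the start of the window, which exceeds [lam * ln i]; and [S] is close to [z]. *)
Let Pr_asym : exists2 C : R, 0 <= C & forall i, (1 < i)%N ->
  `|Pr i - lam| <= C / ln i%:R.
Proof.
have [C C0 H] := S_asym.
have ln3 : 0 < ln 3 by apply: ln_gt0; lra.
pose C' := C + 2 * ((z + C * lam / ln 3) / lam).
have K0 : 0 <= z + C * lam / ln 3.
  by rewrite addr_ge0 ?divr_ge0 ?mulr_ge0 ?(ltW lam0) ?(ltW ln3).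
have C'0 : 0 <= C' by rewrite addr_ge0// mulr_ge0// divr_ge0// ltW.
exists (C' + ln 3 / lam); first by rewrite addr_ge0// divr_ge0// ltW.
move=> i i1; have li : 0 < ln i%:R := ln_nat_gt0 i i1.
have [si|si] := leP 3 (gap_start i); last first.
  have [A _] := small_start i i1 si.
  apply: (@le_trans _ _ 1).
    have := lam0; have := lam1; have /andP[? ?] := Pr_bounds i.
    by rewrite ler_norml => ? ?; apply/andP; split; lra.
  apply: le_trans A _; rewrite ler_pM2r ?invr_gt0// lerDr//.
apply: (@le_trans _ _ (C' / ln i%:R)); last first.
  by rewrite ler_pM2r ?invr_gt0// lerDl divr_ge0// ltW.
have HS := H i si.
pose Q : R := \sum_(0 <= k < i | prime k && (gap_start i <= k%:R)) (k%:R^-1) ^+ 2.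
have Q0 : 0 <= Q by apply: sumr_ge0 => k _; rewrite sqr_ge0.
have gs0 : 0 < gap_start i by lra.
have l1 : ln 3 <= lam * ln i%:R by rewrite -ln_gap_start ler_ln ?posrE.
have Cl : C / ln i%:R <= C * lam / ln 3.
  by rewrite -mulrA ler_wpM2l// ler_pdivlMr// mulrC ler_pdivrMr.
have QS : Q <= (z + C * lam / ln 3) / (lam * ln i%:R).
  apply: (@le_trans _ _ (S i / gap_start i)).
    rewrite /S mulr_suml; apply: ler_sum => k /andP[pk sk].
    have [? _] := prime_inv k pk.
    by rewrite expr2 ler_pM2l// lef_pV2 ?posrE// -invr_gt0.
  rewrite ler_pM ?invr_ge0//; first by rewrite ltW.
    by move: HS; rewrite ler_norml => /andP[? ?]; lra.
  rewrite lef_pV2 ?posrE//; last by lra.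
  by rewrite -ln_gap_start ltW// ln_sublinear.
have up : Pr i <= expR (- S i).
  rewrite /Pr /S -sumrN expR_sum; apply: ler_prod => k /andP[pk _].
  have [? ?] := prime_inv k pk; apply/andP; split; first lra.
  exact: expR_ge1Dx.
have dn : expR (- (S i + 2 * Q)) <= Pr i.
  rewrite /Pr /S /Q mulr_sumr -big_split/= -sumrN expR_sum.
  apply: ler_prod => k /andP[pk _]; have [? ?] := prime_inv k pk.
  by rewrite expR_ge0/= one_sub_ge// ltW.
have A := expRN_lip (S i) z (S_ge0 i) z0.
have B := expRN_lip (S i + 2 * Q) z (addr_ge0 (S_ge0 i) (mulr_ge0 (ler0n _ 2) Q0)) z0.
have D : `|S i + 2 * Q - z| <= C / ln i%:R + 2 * Q.
  rewrite addrAC; apply: le_trans (ler_normD _ _) _.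
  by rewrite (ger0_norm (mulr_ge0 (ler0n _ 2) Q0)) lerD2r.
have -> : C' / ln i%:R = C / ln i%:R + 2 * ((z + C * lam / ln 3) / (lam * ln i%:R)).
  by rewrite /C'; field; rewrite !gt_eqF.
move: (le_trans A HS) (le_trans B D).
by rewrite !ler_norml => /andP[? ?] /andP[? ?]; apply/andP; split; lra.
Qed.

Let rec i : R := (prime i)%:R / i%:R.
Let recln i : R := (prime i)%:R / (i%:R * ln i%:R).

Let rec_ge0 i : 0 <= rec i. Proof. by rewrite divr_ge0. Qed.

Let recE i (x : R) : rec i * (x / ln i%:R) = x * recln i.
Proof. by rewrite /rec /recln invfM; ring. Qed.

Lemma prime_gap_mean_bounds i : 0 <= prime_gap_mean i <= (prime i)%:R / i%:R.
Proof.
rewrite /prime_gap_mean -/(rec i) -/(Pr i); have /andP[? ?] := Pr_bounds i.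
by rewrite mulr_ge0//= ler_piMr.
Qed.

Let mean_asym : exists2 C : R, 0 <= C & forall i,
  `|prime_gap_mean i - lam * rec i| <= C * recln i.
Proof.
have [C C0 H] := Pr_asym; exists C => // i.
have [pi|pi] := boolP (prime i); last first.
  by rewrite /prime_gap_mean /rec /recln (negbTE pi) !mul0r !mulr0 subrr normr0.
rewrite -recE /prime_gap_mean -/(rec i) -/(Pr i) mulrC -mulrBl normrM.
by rewrite (ger0_norm (rec_ge0 i)) mulrC ler_wpM2l// H// prime_gt1.
Qed.

Definition window_mean i : R := \sum_(0 <= k < i | gap_start i <= k%:R) prime_gap_mean k.

Local Notation W := window_mean.

Let recS i : \sum_(0 <= k < i | gap_start i <= k%:R) rec k = S i.
Proof.
rewrite /S big_mkcondl/=; apply: eq_bigr => k _; rewrite /rec.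
by case: (prime k); rewrite ?mul1r ?mul0r.
Qed.

(** Throughout the window [ln k] is at least [lam * ln i], so every mean is [lam / k] up to the same
    relative error, and the reciprocals sum to about [z]. *)
Let W_asym : exists2 C : R, 0 <= C & forall i, (1 < i)%N ->
  `|W i - lam * z| <= C / ln i%:R.
Proof.
have [C C0 H] := S_asym; have [C1 C10 H1] := mean_asym.
have ln3 : 0 < ln 3 by apply: ln_gt0; lra.
pose C' := C1 / lam * (z + C * lam / ln 3) + C.
have K0 : 0 <= z + C * lam / ln 3.
  by rewrite addr_ge0 ?divr_ge0 ?mulr_ge0 ?(ltW lam0) ?(ltW ln3).
have C'0 : 0 <= C' by rewrite addr_ge0// mulr_ge0// divr_ge0// ltW.
pose B := expR (ln 3 / lam) + z.
have B0 : 0 <= B by rewrite addr_ge0// expR_ge0.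
exists (C' + B * (ln 3 / lam)); first by rewrite addr_ge0// mulr_ge0// divr_ge0// ltW.
move=> i i1; have li : 0 < ln i%:R := ln_nat_gt0 i i1.
have W0 : 0 <= W i by apply: sumr_ge0 => k _; case/andP: (prime_gap_mean_bounds k).
have [si|si] := leP 3 (gap_start i); last first.
  have [A A'] := small_start i i1 si.
  apply: (@le_trans _ _ (B * 1)).
    rewrite mulr1; have W1 : W i <= i%:R.
      apply: (@le_trans _ _ (\sum_(0 <= k < i) 1)).
        rewrite /window_mean big_mkcond/=; apply: ler_sum => k _.
        case: ifP => _ //; have /andP[_] := prime_gap_mean_bounds k.
        move/le_trans; apply; case: (boolP (prime k)) => [/prime_inv|_].
          by rewrite mul1r; lra.
        by rewrite mul0r.
      by rewrite big_const_nat subn0 iter_addr_0.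
    have : lam * z <= z by rewrite ler_piMl.
    have : 0 <= lam * z by rewrite mulr_ge0// ltW.
    by rewrite ler_norml /B => *; apply/andP; split; lra.
  rewrite [leRHS]mulrDl -(mulrA B); apply: le_trans (ler_wpM2l B0 A) _.
  by rewrite lerDr divr_ge0// ltW.
apply: (@le_trans _ _ (C' / ln i%:R)); last first.
  by rewrite ler_pM2r ?invr_gt0// lerDl mulr_ge0// divr_ge0// ltW.
have HS := H i si.
have gs0 : 0 < gap_start i by lra.
have l1 : ln 3 <= lam * ln i%:R by rewrite -ln_gap_start ler_ln ?posrE.
have Cl : C / ln i%:R <= C * lam / ln 3.
  by rewrite -mulrA ler_wpM2l// ler_pdivlMr// mulrC ler_pdivrMr.
have E1 : `|W i - lam * S i| <= C1 / (lam * ln i%:R) * S i.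
  rewrite /window_mean -recS mulr_sumr -sumrB mulr_sumr.
  apply: le_trans (ler_norm_sum _ _ _) _; apply: ler_sum => k sk.
  apply: le_trans (H1 k) _.
  have [pk|pk] := boolP (prime k); last first.
    by rewrite /recln /rec (negbTE pk) !mul0r !mulr0.
  rewrite -recE mulrC ler_wpM2r// ler_wpM2l// -ln_gap_start lef_pV2 ?posrE.
  - by rewrite ler_ln ?posrE// ltr0n prime_gt0.
  - by apply: ln_nat_gt0; rewrite prime_gt1.
  - by rewrite ln_gap_start; lra.
have S1 : S i <= z + C * lam / ln 3 by move: HS; rewrite ler_norml => /andP[? ?]; lra.
have -> : W i - lam * z = (W i - lam * S i) + lam * (S i - z) by ring.
apply: le_trans (ler_normD _ _) _; rewrite /C' mulrDl; apply: lerD.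
  apply: le_trans E1 _; rewrite invfM.
  have -> : C1 / lam * (z + C * lam / ln 3) / ln i%:R =
     C1 * (lam^-1 / ln i%:R) * (z + C * lam / ln 3) by ring.
  by rewrite ler_wpM2l// mulr_ge0// mulr_ge0 ?invr_ge0 ?ltW.
rewrite normrM (ger0_norm (ltW lam0)).
by apply: le_trans HS; rewrite ler_piMl.
Qed.

Lemma sum_prime_recip : exists2 C : R, 0 <= C & forall n, (3 <= n)%N ->
  `|\sum_(0 <= k < n) (prime k)%:R / k%:R - ln (ln n%:R)| <= C.
Proof.
have [C C0 H] := @mertens2_real R.
have ln3 : 0 < ln 3 by apply: ln_gt0; lra.
exists (\sum_(0 <= k < 3) rec k + (C / ln 3 + `|ln (ln 3)|)).
  by rewrite addr_ge0 ?sumr_ge0// addr_ge0// divr_ge0// ltW.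
move=> n n3; rewrite (@big_cat_nat _ _ _ 3)//= -addrA.
apply: le_trans (ler_normD _ _) _; apply: lerD.
  by rewrite ger0_norm// sumr_ge0.
have := H 3 n (lexx _); rewrite ler_nat => /(_ n3).
have -> : \sum_(0 <= p < n | prime p && (3 <= p%:R :> R)) p%:R^-1 =
   \sum_(3 <= k < n) rec k.
  rewrite big_mkcond (@big_cat_nat _ _ _ 3)//= big_nat big1 ?add0r.
    apply: eq_big_nat => k /andP[k3 _]; rewrite ler_nat k3 andbT /rec.
    by case: (prime k); rewrite ?mul1r ?mul0r.
  by move=> k /andP[_ k3]; rewrite ler_nat leqNgt k3 andbF.
set s := \sum_(_ <= _ < _) _ => HH.
have -> : s - ln (ln n%:R) = (s - (ln (ln n%:R) - ln (ln 3))) - ln (ln 3) by ring.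
by apply: le_trans (ler_normB _ _) _; rewrite lerD2r.
Qed.

Lemma gap_mean_total_asym : exists2 C : R, 0 <= C & forall n, (3 <= n)%N ->
  `|\sum_(0 <= k < n) prime_gap_mean k - lam * ln (ln n%:R)| <= C.
Proof.
have [C C0 H] := sum_prime_recip; have [C1 C10 H1] := mean_asym.
have [C2 H2] := @sum_prime_recip_ln R.
exists (C1 * `|C2| + C); first by rewrite addr_ge0// mulr_ge0.
move=> n n3; have -> : \sum_(0 <= k < n) prime_gap_mean k - lam * ln (ln n%:R) =
  (\sum_(0 <= k < n) (prime_gap_mean k - lam * rec k)) +
  lam * (\sum_(0 <= k < n) rec k - ln (ln n%:R)).
  by rewrite sumrB -mulr_sumr; ring.
apply: le_trans (ler_normD _ _) _; apply: lerD.
  apply: le_trans (ler_norm_sum _ _ _) _.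
  apply: (@le_trans _ _ (\sum_(0 <= k < n) C1 * recln k)).
    by apply: ler_sum => k _.
  by rewrite -mulr_sumr ler_wpM2l// (le_trans (H2 n))// ler_norm.
rewrite normrM (ger0_norm (ltW lam0)).
by apply: le_trans (H n n3); rewrite ler_piMl.
Qed.

(** Replacing [window_mean] by [lam * z] leaves the factor [1 - 2 * z * lam] on the total mean. The
    errors are [1 / (p ln p)] and the squared means at most [1 / p^2], both summable. *)
Lemma gap_var_total_asym : exists2 C : R, 0 <= C & forall n, (3 <= n)%N ->
  `|\sum_(0 <= i < n) prime_gap_mean i
    - 2 * (\sum_(0 <= i < n) prime_gap_mean i * (W i + prime_gap_mean i))
    + \sum_(0 <= i < n) prime_gap_mean i ^+ 2
    - gamma z * ln (ln n%:R)| <= C.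
Proof.
have [C C0 H] := gap_mean_total_asym; have [C1 C10 H1] := W_asym.
have [C2 H2] := @sum_prime_recip_ln R.
pose g := 1 - 2 * z * lam.
exists (2 * (C1 * `|C2|) + `|C2| + `|g| * C).
  by rewrite !addr_ge0 ?mulr_ge0.
move=> n n3.
have -> : \sum_(0 <= i < n) prime_gap_mean i
    - 2 * (\sum_(0 <= i < n) prime_gap_mean i * (W i + prime_gap_mean i))
    + \sum_(0 <= i < n) prime_gap_mean i ^+ 2
    - gamma z * ln (ln n%:R) =
  - 2 * (\sum_(0 <= i < n) prime_gap_mean i * (W i - lam * z))
   - \sum_(0 <= i < n) prime_gap_mean i ^+ 2
   + g * (\sum_(0 <= k < n) prime_gap_mean k - lam * ln (ln n%:R)).
  rewrite /gamma /lambda -/lam -/g.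
  under [\sum_(0 <= i < n) prime_gap_mean i * (W i + _)]eq_bigr do
    rewrite mulrDr -expr2.
  under [\sum_(0 <= i < n) prime_gap_mean i * (W i - _)]eq_bigr do rewrite mulrBr.
  rewrite sumrB big_split/= -mulr_suml /g; ring.
apply: le_trans (ler_normD _ _) _; apply: lerD; last first.
  by rewrite normrM ler_wpM2l// H.
apply: le_trans (ler_normB _ _) _; apply: lerD.
  rewrite normrM normrN normr_nat ler_wpM2l//.
  apply: le_trans (ler_norm_sum _ _ _) _.
  apply: (@le_trans _ _ (\sum_(0 <= k < n) C1 * recln k)).
    apply: ler_sum => k _; have /andP[m0 m1] := prime_gap_mean_bounds k.
    rewrite normrM (ger0_norm m0).
    have [pk|pk] := boolP (prime k); last first.
      by rewrite /prime_gap_mean /recln (negbTE pk) !mul0r mulr0.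
    by rewrite -recE ler_pM// H1// prime_gt1.
  by rewrite -mulr_sumr ler_wpM2l// (le_trans (H2 n))// ler_norm.
rewrite ger0_norm; last by apply: sumr_ge0 => k _; rewrite sqr_ge0.
apply: le_trans (ler_norm _); apply: le_trans (H2 n); apply: ler_sum => k _.
have /andP[m0 m1] := prime_gap_mean_bounds k.
have [pk|pk] := boolP (prime k); last first.
  by rewrite /prime_gap_mean (negbTE pk) !mul0r expr0n/=.
rewrite pk in m1.
have k1 := prime_gt1 pk; have lk : 0 < ln k%:R := ln_nat_gt0 k k1.
have k0 : 0 < k%:R :> R by rewrite ltr0n ltnW.
apply: (@le_trans _ _ (1 / k%:R * (1 / k%:R))); first by rewrite expr2 ler_pM.
rewrite !mul1r -invfM lef_pV2 ?posrE ?mulr_gt0// ler_pM2l//.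
by rewrite ltW// ln_sublinear.
Qed.

End GapAsymptotics.

(** * Kubilius' comparison with independent divisibility *)

Section Kubilius.
Import mathcomp.boot.fintype mathcomp.boot.finset.
Context {R : realType}.
Variables (N m : nat) (Q : pred nat).
Hypothesis N0 : (0 < N)%N.
Hypothesis Qprime : forall p, Q p -> prime p.
Implicit Types (A B S : {set 'I_m}).

(* The uniform law on {1, ..., N}; the index i stands for the integer i + 1. *)
Definition unif (i : 'I_N) : R := N%:R^-1.

Lemma unif_distr : is_distr unif.
Proof.
split => [i|]; first by rewrite invr_ge0.
by rewrite /unif sumr_const card_ord -[_^-1 *+ N]mulr_natl mulfV// pnatr_eq0 -lt0n.
Qed.

Lemma Ex_unif (F : nat -> R) :
  Ex unif (fun i => F i.+1) = N%:R^-1 * \sum_(1 <= n < N.+1) F n.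
Proof. by rewrite big_add1 big_mkord mulr_sumr. Qed.

(** The predicate [Q] allows both all primes below [m] and only the large primes up to [N]. *)
Definition divset (n : nat) : {set 'I_m} := [set p : 'I_m | Q p && (p %| n)%N].

Definition recip (p : 'I_m) : R := (Q p)%:R / p%:R.

Lemma recip01 p : 0 <= recip p <= 1.
Proof.
rewrite /recip; case: (boolP (Q p)) => [/Qprime/prime_gt0 p0|_]; last first.
  by rewrite mul0r lexx ler01.
by rewrite mul1r invr_ge0 ler0n invf_le1 ?ltr0n// ler1n.
Qed.

Let recip_ge0 p : 0 <= recip p. Proof. by have /andP[] := recip01 p. Qed.

(** For a set of primes with product [e] the left side is [floor(N / e) / N]; if an element of [S]
    fails [Q], both expressions vanish. *)
Lemma Ex_divset_sub S :
  Ex unif (fun i => (S \subset divset i.+1)%:R) <= \prod_(p in S) recip p <=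
  Ex unif (fun i => (S \subset divset i.+1)%:R) + N%:R^-1.
Proof.
have NR : 0 < N%:R :> R by rewrite ltr0n.
have [/forall_inP QS|] := boolP [forall p in S, Q p]; last first.
  rewrite negb_forall_in => /exists_inP[p pS Qp].
  have -> : \prod_(p in S) recip p = 0.
    by rewrite (bigD1 p)//= /recip (negbTE Qp) !mul0r.
  rewrite (_ : Ex _ _ = 0); first by rewrite lexx add0r invr_ge0 ltW.
  rewrite /Ex big1// => i _; case: (boolP (S \subset _)) => [/subsetP/(_ p pS)|_].
    by rewrite inE (negbTE Qp).
  by rewrite mulr0.
pose e := \prod_(p in S) (p : nat).
have e0 : (0 < e)%N by apply: prodn_cond_gt0 => p pS; exact/prime_gt0/Qprime/QS.
have SE n : (S \subset divset n) = (e %| n)%N.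
  rewrite /e -big_enum/= -(big_map val predT id) prod_primes_dvd.
  - rewrite all_map; apply/subsetP/allP => H p.
      by rewrite mem_enum => /H; rewrite inE => /andP[].
    by move=> pS; rewrite inE QS//; apply: H; rewrite mem_enum.
  - by rewrite map_inj_uniq ?enum_uniq//; exact: val_inj.
  - by rewrite all_map; apply/allP => p; rewrite mem_enum => /QS/Qprime.
have -> : \prod_(p in S) recip p = e%:R^-1.
  rewrite /e natr_prod -prodfV; apply: eq_bigr => p pS.
  by rewrite /recip QS// mul1r.
rewrite (Ex_unif (fun n => (S \subset divset n)%:R)).
have -> : \sum_(1 <= n < N.+1) ((S \subset divset n)%:R : R) = (N %/ e)%:R.
  by rewrite divn_count_dvd natr_sum; apply: eq_bigr => n _; rewrite SE.
have eR : 0 < e%:R :> R by rewrite ltr0n.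
apply/andP; split.
  by rewrite ler_pdivrMl// ler_pdivlMr// -natrM ler_nat leq_trunc_div.
rewrite -[X in _ + X]mulr1 -mulrDr ler_pdivlMl// ler_pdivrMr//.
by rewrite natr1 -natrM ler_nat ltnW// ltn_ceil.
Qed.

Lemma expr_card_sum (c : R) A : c ^+ #|A| = \sum_(S : {set 'I_m}) (S \subset A)%:R * (c - 1) ^+ #|S|.
Proof.
rewrite -prodr_const big_mkcond/=.
transitivity (\prod_(i : 'I_m) ((i \in A)%:R * (c - 1) + 1)).
  by apply: eq_bigr => i _; case: ifP => _; rewrite /=; ring.
rewrite prod_subset_sum; apply: eq_bigr => S _.
by rewrite -prodr_const -prodr_sub.
Qed.

Lemma sum_expr_card (c : R) : \sum_(S : {set 'I_m}) c ^+ #|S| = (1 + c) ^+ m.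
Proof.
transitivity (\sum_(S : {set 'I_m}) \prod_i (if i \in S then c else 1)).
  by apply: eq_bigr => S _; rewrite -big_mkcond prodr_const.
by rewrite -prod_subset_sum prodr_const card_ord addrC.
Qed.

Lemma prod_le_expR (F : 'I_m -> R) : (forall i, 0 <= F i) ->
  \prod_i (1 + F i) <= expR (\sum_i F i).
Proof.
move=> F0; rewrite expR_sum; apply: ler_prod => i _.
by rewrite addr_ge0//= expR_ge1Dx.
Qed.

Lemma Ex_bern_recip_exp (c : R) : 1 <= c ->
  Ex (bern recip) (fun A => c ^+ #|A|) <= expR ((c - 1) * \sum_p recip p).
Proof.
move=> c1; rewrite Ex_bern_exp mulr_sumr; apply: prod_le_expR => i.
by rewrite mulr_ge0// subr_ge0.
Qed.

(** [c ^+ #|A|] expands in inclusion indicators with coefficients [(c - 1) ^+ #|S|], nonnegative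
    here, so the one-sided comparison of densities holds term by term, without any error and for
    every [m]. *)
Lemma Ex_divset_exp (c : R) : 1 <= c ->
  Ex unif (fun i => c ^+ #|divset i.+1|) <= expR ((c - 1) * \sum_p recip p).
Proof.
move=> c1; apply: le_trans (Ex_bern_recip_exp c c1).
under eq_Ex do rewrite expr_card_sum.
under [X in _ <= X]eq_Ex do rewrite expr_card_sum.
rewrite !Ex_sum; apply: ler_sum => S _.
under eq_Ex do rewrite mulrC.
under [X in _ <= X]eq_Ex do rewrite mulrC.
rewrite !ExZ ler_wpM2l ?exprn_ge0 ?subr_ge0//.
by rewrite Ex_bern_sub; have /andP[] := Ex_divset_sub S.
Qed.

(** The Moebius expansion is truncated at sets of size [k]. Each retained coefficient is compared
    with error [1 / N]; the discarded part is controlled under both laws by an exponential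
    moment. *)
Lemma kubilius (f : {set 'I_m} -> R) k : (0 < m)%N -> (forall A, `|f A| <= 1) ->
  `|Ex unif (fun i => f (divset i.+1)) - Ex (bern recip) f| <=
  expR 1 * (2 * m%:R) ^+ k / N%:R + 2 * expR (4 * \sum_p recip p) / 2 ^+ k.
Proof.
move=> m0 f1.
pose fk A := \sum_(S : {set 'I_m}) (S \subset A)%:R * ((#|S| <= k)%:R * moebius f S).
(* For [k < #|S|] the coefficient is at most [2 ^ #|S| <= 4 ^ #|S| / 2 ^ k], and [4 ^ #|S|] summed
   over the subsets of [A] gives [5 ^ #|A|]. *)
have ffk A : `|f A - fk A| <= 5 ^+ #|A| / 2 ^+ k.
  rewrite -moebius_inv big_mkcond/= /fk -sumrB expr_card_sum mulr_suml.
  apply: le_trans (ler_norm_sum _ _ _) _; apply: ler_sum => S _.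
  case: (S \subset A); rewrite ?mul0r ?subrr ?normr0// mul1r.
  have [Sk|Sk] := leqP #|S| k.
    by rewrite mul1r subrr normr0 mul1r divr_ge0 ?exprn_ge0//; lra.
  rewrite mul0r subr0 mul1r; apply: le_trans (moebius_norm f S f1) _.
  rewrite ler_pdivlMr ?exprn_gt0// (_ : 5 - 1 = 2 * 2 :> R); last by ring.
  by rewrite exprMn ler_wpM2l ?exprn_ge0// ler_weXn2l ?ler1n// ltnW.
have tailN : `|Ex unif (fun i => f (divset i.+1)) - Ex unif (fun i => fk (divset i.+1))|
   <= expR (4 * \sum_p recip p) / 2 ^+ k.
  rewrite -ExB; apply: le_trans (norm_Ex _ _ _ unif_distr (fun i => ffk (divset i.+1))) _.
  under eq_Ex do rewrite mulrC.
  rewrite ExZ mulrC ler_wpM2r ?invr_ge0 ?exprn_ge0//.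
  apply: le_trans (Ex_divset_exp 5 _) _; first by lra.
  by rewrite ler_expR; lra.
have tailB : `|Ex (bern recip) fk - Ex (bern recip) f|
   <= expR (4 * \sum_p recip p) / 2 ^+ k.
  rewrite distrC -ExB; apply: le_trans (norm_Ex _ _ _ (bern_distr _ recip01) ffk) _.
  under eq_Ex do rewrite mulrC.
  rewrite ExZ mulrC ler_wpM2r ?invr_ge0 ?exprn_ge0//.
  apply: le_trans (Ex_bern_recip_exp 5 _) _; first by lra.
  by rewrite ler_expR; lra.
have mid : `|Ex unif (fun i => fk (divset i.+1)) - Ex (bern recip) fk| <=
   expR 1 * (2 * m%:R) ^+ k / N%:R.
  rewrite /fk !Ex_sum -sumrB; apply: le_trans (ler_norm_sum _ _ _) _.
  (* The weights [m ^- #|S|] replace a count of small sets: over all subsets they sum to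
     [(1 + 1 / m) ^ m <= e]. *)
  apply: (@le_trans _ _ (\sum_(S : {set 'I_m}) (2 * m%:R) ^+ k * (m%:R^-1 ^+ #|S|) / N%:R)).
    apply: ler_sum => S _.
    under eq_Ex do rewrite mulrC.
    under [Ex (bern _) _]eq_Ex do rewrite mulrC.
    rewrite !ExZ -mulrBr normrM ler_pM//.
      rewrite normrM normr_nat; have [Sk|_] := leqP #|S| k; last first.
        by rewrite mul0r mulr_ge0 ?exprn_ge0 ?mulr_ge0 ?invr_ge0.
      rewrite mul1r exprVn ler_pdivlMr ?exprn_gt0 ?ltr0n//.
      apply: (@le_trans _ _ (2 ^+ #|S| * m%:R ^+ #|S|)).
        by rewrite ler_wpM2r ?exprn_ge0//; exact: moebius_norm.
      rewrite -exprMn; apply: ler_weXn2l => //.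
      by have : 1 <= m%:R :> R; [rewrite ler1n|lra].
    rewrite distrC Ex_bern_sub; have /andP[A B] := Ex_divset_sub S.
    have : 0 <= N%:R^-1 :> R by rewrite invr_ge0.
    by rewrite ler_norml => ?; apply/andP; split; lra.
  rewrite -mulr_suml ler_wpM2r ?invr_ge0// -mulr_sumr mulrC ler_wpM2r//.
  rewrite sum_expr_card.
  have -> : expR 1 = expR (m%:R * m%:R^-1) :> R by rewrite divff// pnatr_eq0; lia.
  rewrite expRM_natl; apply: lerXn2r; rewrite ?nnegrE ?expR_ge0 ?addr_ge0 ?invr_ge0//.
  exact: expR_ge1Dx.
move: tailN mid tailB.
set X := Ex unif _; set Y := Ex unif _; set Z := Ex (bern _) _; set V := Ex _ _.
have -> : X - V = (X - Y) + (Y - Z) + (Z - V) by ring.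
move=> H1 H2 H3; apply: le_trans (ler_normD _ _) _.
apply: le_trans (lerD (ler_normD _ _) (lexx _)) _; lra.
Qed.

End Kubilius.

(** * From the gap count of an integer to the random-set model *)

Section GapCount.
Import mathcomp.boot.fintype mathcomp.boot.finset.
Context {R : realType}.
Variable z : R.
Hypothesis z0 : 0 <= z.
Implicit Types (i k n m : nat).

Definition gap_rel k i : bool := k%:R `^ expR z < i%:R.

Lemma gap_rel_lower k' k i : (k' <= k)%N -> gap_rel k i -> gap_rel k' i.
Proof.
move=> kk; apply: le_lt_trans; rewrite ge0_ler_powR ?nnegrE ?expR_ge0//.
by rewrite ler_nat.
Qed.

Lemma gap_rel_upper k i i' : (i <= i')%N -> gap_rel k i -> gap_rel k i'.
Proof. by move=> ii /lt_le_trans; apply; rewrite ler_nat. Qed.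

Let fresh n i : bool := all (fun k => (k < i)%N ==> gap_rel k i) (primes n).

Let count_nth (s : seq nat) (P : pred nat) :
  count P s = (\sum_(j < size s) P (nth 0%N s j))%N.
Proof.
rewrite -sum1_count (big_nth 0%N) big_mkord big_mkcond/=.
by apply: eq_bigr => j _; case: (P _).
Qed.

(** By monotonicity only the preceding prime factor matters for freshness. The smallest prime factor
    is vacuously fresh but follows no gap, whence the extra 1 for [n > 1]. *)
Lemma gap_count_fresh n : (gap_count z n + (1 < n))%N = count (fresh n) (primes n).
Proof.
rewrite count_nth /gap_count -sum1_card big_mkcond/= /omega.
have -> : (1 < n)%N = (\sum_(j < size (primes n)) (val j == 0%N))%N :> nat.
  have : ((1 < n) = (0 < size (primes n)))%N.
    by rewrite lt0n size_eq0 primes_eq0 -leqNgt.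
  move=> ->; case: (size _) => [|k]; first by rewrite big_ord0.
  by rewrite big_ord_recl/= big1.
rewrite -big_split/=; apply: eq_bigr => j _; rewrite inE.
have srt := sorted_primes n.
have lt_nth l l' : (l < l')%N -> (l' < size (primes n))%N ->
    (nth 0 (primes n) l < nth 0 (primes n) l')%N.
  by move=> ll ls; apply: (sorted_ltn_nth ltn_trans) => //; exact: ltn_trans ls.
have nth_lt l l' : (l < size (primes n))%N ->
    (nth 0 (primes n) l < nth 0 (primes n) l')%N -> (l < l')%N.
  move=> ls H; rewrite ltnNge leq_eqVlt; apply/negP => /predU1P[E|/lt_nth].
    by move: H; rewrite E ltnn.
  by move=> /(_ ls); rewrite ltnNge ltnW.
case: j => -[|j] jlt /=.
  rewrite add0n; suff -> : fresh n (nth 0%N (primes n) 0) by [].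
  apply/allP => k /(nthP 0%N) [l ls <-]; apply/implyP.
  by move=> /(nth_lt _ _ ls).
rewrite addn0 /prime_nth /= -/(gap_rel _ _).
suff -> : fresh n (nth 0%N (primes n) j.+1) =
   gap_rel (nth 0%N (primes n) j) (nth 0%N (primes n) j.+1) by case: (gap_rel _ _).
apply/allP/idP => [H|H k /(nthP 0%N) [l ls <-]].
  have := H _ (mem_nth 0%N (ltnW jlt)); by rewrite lt_nth.
apply/implyP => /(nth_lt _ _ ls); rewrite ltnS leq_eqVlt => /predU1P[->//|lj].
by apply: gap_rel_lower H; rewrite ltnW// lt_nth// ltnW.
Qed.

Lemma gap_total_fresh m n : (0 < n)%N ->
  gap_total (R := R) gap_rel (divset m prime n) =
  (count (fun i => (i < m)%N && fresh n i) (primes n))%:R.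
Proof.
move=> n0; rewrite /gap_total -natr_sum; congr _%:R.
transitivity #|[set i : 'I_m | after_gap gap_rel i (divset m prime n)]|.
  rewrite -sum1dep_card [RHS]big_mkcond/=; apply: eq_bigr => i _.
  by case: (after_gap _ _ _).
rewrite cardE -(size_map val) -size_filter; apply/perm_size/uniq_perm.
- by rewrite map_inj_uniq ?enum_uniq//; exact: val_inj.
- by rewrite filter_uniq ?primes_uniq.
move=> i; rewrite mem_filter mem_primes n0 /=.
apply/mapP/idP => [[j]|/andP[/andP[im fi] /andP[pi ni]]].
  rewrite mem_enum inE => aj ->; rewrite ltn_ord/=.
  have := after_gap_in _ _ _ aj; rewrite inE => /andP[-> ->]; rewrite /= andbT.
  apply/allP => k; rewrite mem_primes n0/= => /andP[pk kn]; apply/implyP => kj.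
  have km : (k < m)%N := ltn_trans kj (ltn_ord j).
  move/eqP/setP/(_ (Ordinal km)) : aj; rewrite !inE/= pk kn/= kj/= -val_eqE/=.
  by rewrite ltn_eqF//= => /negbT; rewrite negbK.
exists (Ordinal im) => //; rewrite mem_enum inE /after_gap; apply/eqP/setP => k.
rewrite !inE -val_eqE/=; case: (eqVneq (val k) i) => [->|ki]; first by rewrite pi ni.
case: (boolP (prime k)) => //= pk; case: (boolP (k %| n)%N) => //= kn.
case: (boolP (k < i)%N) => //= ki'; move/allP/(_ (val k)) : fi.
by rewrite mem_primes pk n0 kn ki' => /(_ isT)/= ->.
Qed.

Lemma card_divset m N n : (0 < n)%N -> (n <= N)%N ->
  #|divset N.+1 (fun p => prime p && (m <= p)%N) n| =
  count (fun p => (m <= p)%N) (primes n).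
Proof.
move=> n0 nN; rewrite cardE -(size_map val) -size_filter; apply/perm_size/uniq_perm.
- by rewrite map_inj_uniq ?enum_uniq//; exact: val_inj.
- by rewrite filter_uniq ?primes_uniq.
move=> i; rewrite mem_filter mem_primes n0 /=.
apply/mapP/idP => [[j]|/and3P[mi pi ni]].
  by rewrite mem_enum inE => /andP[/andP[pj mj] jn] ->; rewrite mj pj jn.
have iN : (i < N.+1)%N by rewrite ltnS (leq_trans _ nN)// dvdn_leq.
by exists (Ordinal iN) => //; rewrite mem_enum inE/= pi mi ni.
Qed.

Lemma gap_count_le N n : (0 < n)%N -> (n <= N)%N ->
  (gap_count z n <= #|divset N.+1 (fun p => prime p && (0 <= p)%N) n|)%N.
Proof.
move=> n0 nN; rewrite card_divset// count_predT /gap_count.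
by apply: leq_trans (max_card _) _; rewrite card_ord.
Qed.

(** Freshness of a prime depends only on smaller prime factors, so restricting to primes below [m]
    changes no indicator and merely drops those at or beyond [m]. *)
Lemma gap_count_total m N n : (0 < n)%N -> (n <= N)%N ->
  `|(gap_count z n)%:R - gap_total (R := R) gap_rel (divset m prime n)| <=
  1 + #|divset N.+1 (fun p => prime p && (m <= p)%N) n|%:R :> R.
Proof.
move=> n0 nN; rewrite gap_total_fresh//.
set A := divset _ _ _.
have A1 : #|A| = count (fun p => (m <= p)%N) (primes n) by exact: card_divset.
have E := gap_count_fresh n.
have c1 : (count (fun i => (i < m) && fresh n i) (primes n) <= count (fresh n) (primes n))%N.
  by apply: sub_count => i /andP[].
have c2 : (count (fresh n) (primes n) <=
   count (fun i => (i < m) && fresh n i) (primes n) + #|A|)%N.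
  rewrite A1 -count_predUI; apply: leq_trans _ (leq_addr _ _).
  by apply: sub_count => i fi /=; rewrite fi andbT ltnNge orNb.
have c3 : ((1 < n) <= 1)%N by case: (1 < n)%N.
move: c1 c2 E; set u := count _ _; set v := count _ _; set g := gap_count z n.
set B := #|A|; clearbody u v g B; clear A A1 => c1 c2 E.
have E1 : (g <= u + B)%N by clear -E c2; lia.
have E2 : (u <= g + 1)%N by clear -E c1 c3; lia.
move: E1 E2; rewrite -(ler_nat R) -[(u <= _)%N](ler_nat R) !natrD => E1 E2.
have : 0 <= B%:R :> R by [].
by rewrite ler_norml => *; apply/andP; split; lra.
Qed.

Lemma gap_mean_prime m (i : 'I_m) :
  gap_mean (recip m prime) gap_rel i = prime_gap_mean z i :> R.
Proof.
rewrite gap_meanE /prime_gap_mean /recip.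
have [pi|pi] := boolP (prime i); last by rewrite !mul0r.
have i0 := prime_gt0 pi.
congr (_ * _); rewrite [RHS]big_mkord.
rewrite (big_ord_widen_cond m (fun k => prime k && (gap_start z i <= k%:R))
   (fun k => 1 - k%:R^-1 : R) (ltnW (ltn_ord i))).
rewrite big_mkcond [RHS]big_mkcond/=; apply: eq_bigr => k _.
rewrite inE /gap_rel gap_startP// negbK -val_eqE/=.
case: (eqVneq (val k) (val i)) => [->|_]; first by rewrite ltnn andbF.
rewrite /= andbT; case: (k < i)%N; rewrite ?andbF//=.
by case: (prime k); case: (_ <= _); rewrite /= ?mul0r ?mul1r ?subr0.
Qed.

Lemma gap_total_mean_prime m :
  gap_total_mean (recip m prime) gap_rel = \sum_(0 <= k < m) prime_gap_mean z k :> R.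
Proof. by rewrite big_mkord; apply: eq_bigr => i _; exact: gap_mean_prime. Qed.

(** [window_mean] excludes its own index, whereas [window] contains it; hence the added
    [prime_gap_mean z i]. *)
Lemma gap_total_var_prime m : gap_total_var (recip m prime) gap_rel =
    \sum_(0 <= i < m) prime_gap_mean z i
    - 2 * (\sum_(0 <= i < m) prime_gap_mean z i * (window_mean z i + prime_gap_mean z i))
    + \sum_(0 <= i < m) prime_gap_mean z i ^+ 2 :> R.
Proof.
rewrite /gap_total_var gap_total_mean_prime !big_mkord; congr (_ - 2 * _ + _).
  apply: eq_bigr => i _; rewrite gap_mean_prime.
  have [pi|pi] := boolP (prime i); last by rewrite /prime_gap_mean (negbTE pi) !mul0r.
  have i0 := prime_gt0 pi; congr (_ * _).
  rewrite (bigD1 i) ?in_window_self//= gap_mean_prime addrC; congr (_ + _).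
  rewrite /window_mean big_mkord.
  rewrite (big_ord_widen_cond m (fun k => gap_start z i <= k%:R)
   (fun k => prime_gap_mean z k) (ltnW (ltn_ord i))).
  apply: eq_big => [k|k _]; last exact: gap_mean_prime.
  rewrite inE /gap_rel gap_startP// negbK -val_eqE/=.
  case: (eqVneq (val k) (val i)) => [->|_]; first by rewrite ltnn andbF.
  by rewrite /= andbT andbC.
by apply: eq_bigr => i _; rewrite gap_mean_prime.
Qed.

End GapCount.

(** * Estimates for large arguments *)

Section Eventually.
Context {R : realType}.
Local Notation ln := (@ln R).

Lemma near_ge (C : R) : \forall T \near +oo, C <= T.
Proof. by apply: nbhs_pinfty_ge; exact: num_real. Qed.

Lemma near_ln_ge (C : R) : \forall T \near +oo, C <= ln T.
Proof.
apply: filterS (near_ge (expR C)) => T CT.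
by rewrite -[leLHS]expRK ler_ln ?posrE ?expR_gt0// (lt_le_trans (expR_gt0 C)).
Qed.

Lemma ge1_of_ln (T : R) : 1 <= ln T -> 1 <= T.
Proof.
move=> lT1; have T0 : 0 < T by rewrite ltNge; apply/negP => /ln0 E; move: lT1; rewrite E; lra.
by apply: le_trans lT1 _; have := ln_sublinear T0; lra.
Qed.

Lemma ln_le_sqrt (T : R) : 0 < T -> ln T <= 2 * Num.sqrt T.
Proof.
move=> T0; have s0 : 0 < Num.sqrt T by rewrite sqrtr_gt0.
rewrite -{1}(sqr_sqrtr (ltW T0)) lnXn// mulr2n.
by have := ln_sublinear s0; lra.
Qed.

Lemma near_ln_le (e : R) : 0 < e -> \forall T \near +oo, ln T <= e * T.
Proof.
move=> e0; apply: filterS2 (near_ge 1) (near_ge ((2 / e) ^+ 2)) => T T1 Te.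
have T0 : 0 < T by lra.
apply: le_trans (ln_le_sqrt T T0) _.
rewrite -{2}(sqr_sqrtr (ltW T0)) expr2 mulrA ler_wpM2r ?sqrtr_ge0//.
rewrite -ler_pdivrMl// mulrC -(@ger0_norm _ (2 / e)) ?divr_ge0 ?(ltW e0)//.
by rewrite -sqrtr_sqr ler_sqrt// ltW.
Qed.

Lemma near_pow_le_expR (n : nat) : \forall T \near +oo, T ^+ n <= expR T :> R.
Proof.
apply: filterS2 (near_ge 0) (near_ge (n.+1)`!%:R) => T T0 Tn.
apply: le_trans (expR_ge1Dxn n T0); rewrite ler_wpDl//.
by rewrite ler_pdivlMr ?ltr0n ?fact_gt0// exprS mulrC ler_wpM2r// exprn_ge0.
Qed.

Lemma expR_half_le2 : expR 2^-1 <= 2 :> R.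
Proof.
rewrite -[leLHS]invrK -expRN -[leRHS]invrK lef_pV2 ?posrE ?invr_gt0 ?expR_gt0//.
by apply: le_trans (expR_ge1Dx _); lra.
Qed.

(** Positivity of [T] excludes the cases where a logarithm takes its default value 0. *)
Lemma ln_ln_natE (N : nat) (T : R) : 0 < T -> T = ln (ln N%:R) ->
  [/\ (0 < N)%N, ln N%:R = expR T & N%:R = expR (expR T)].
Proof.
move=> T0 TE.
have l0 : 0 < ln N%:R.
  by rewrite ltNge; apply/negP => /ln0 E; move: T0; rewrite TE E ltxx.
have N0 : (0 < N)%N by case: (N) l0 => //; rewrite ln0// ltxx.
have E : ln N%:R = expR T by rewrite TE lnK.
by rewrite -E lnK ?posrE ?ltr0n.
Qed.

(** Covers both the 2N in the centring and the bound N + 1 on the primes. *)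
Lemma ln_ln_near (N : nat) (T x : R) : 1 <= T -> T = ln (ln N%:R) ->
  N%:R <= x -> x <= 2 * N%:R -> 0 <= ln (ln x) - T <= 1.
Proof.
move=> T1 TE Nx xN; have T0 : 0 < T by lra.
have [N0 lNT _] := ln_ln_natE N T T0 TE.
have lN0 : 0 < ln N%:R by rewrite lNT expR_gt0.
have NR : 0 < N%:R :> R by rewrite ltr0n.
have x0 : 0 < x := lt_le_trans NR Nx.
have lNx : ln N%:R <= ln x by rewrite ler_ln ?posrE.
have lx : ln x <= ln 2 + ln N%:R by rewrite -lnM ?posrE// ler_ln ?posrE// mulr_gt0.
have /andP[A B] := ln_ratio_bounds _ _ lN0 lNx.
rewrite TE; apply/andP; split; first by apply: le_trans A; rewrite divr_ge0//; lra.
apply: le_trans B _; rewrite ler_pdivrMr// mul1r lNT.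
by have := expR_ge1Dx T; have := @ln_sublinear R 2; lra.
Qed.

End Eventually.

(** * Choice of the cutoff *)

Section Cutoff.
Context {R : realType}.
Variable z : R.
Hypothesis z0 : 0 <= z.
Local Notation ln := (@ln R).

(* Primes below m = exp (log N / (100 log log N)) behave like independent
   events, and an integer up to N has few prime factors beyond m. *)
Definition is_cutoff (C T : R) (N m : nat) : Prop := [/\ (3 <= m)%N,
   `|ln (ln m%:R) - T| <= 2 * ln T,
   (forall f : {set 'I_m} -> R, (forall A, `|f A| <= 1) ->
      `|Ex (unif N) (fun i => f (divset m prime i.+1)) - Ex (bern (recip m prime)) f|
      <= C * expR (- T)) &
   \sum_p recip N.+1 (fun p => prime p && (m <= p)%N) p <= 4 * ln T].

Lemma cutoff_exists : exists2 C : R, 0 <= C & \forall T \near +oo, forall N : nat,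
  T = ln (ln N%:R) -> exists m, is_cutoff C T N m.
Proof.
have [C0 C00 H0] := @sum_prime_recip R; have [C1 C10 H1] := @mertens2_real R.
exists (1 + 2 * expR (4 * C0)); first by rewrite addr_ge0// mulr_ge0// expR_ge0.
near=> T => N TE.
have T40 : 400 <= T by near: T; exact: near_ge.
have T0 : 0 < T by lra.
have [N0 lN NE] := ln_ln_natE N T T0 TE.
have T3 : T ^+ 3 <= expR T by near: T; exact: near_pow_le_expR.
have lT200 : ln 200 <= ln T by near: T; exact: near_ln_ge.
have lTC : 1 + C1 <= ln T by near: T; exact: near_ln_ge.
have lT0 : 0 <= ln T by apply: ln_ge0; lra.
pose u := expR T / (100 * T).
have u20 : 20 <= u.
  rewrite /u ler_pdivlMr; last lra.
  by apply: le_trans T3; rewrite !exprS expr0; nra.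
have uT : u * (100 * T) = expR T by rewrite /u divfK// gt_eqF//; lra.
pose m := Num.truncn (expR u).
have /andP[mu um] : m%:R <= expR u < m.+1%:R.
  by apply: truncn_itv; exact: expR_ge0.
have eu := expR_ge1Dx u.
have m3 : (3 <= m)%N by rewrite -ltnS -(ltr_nat R); lra.
have m0 : 0 < m%:R :> R by rewrite ltr0n; exact: leq_trans m3.
have lmu : ln m%:R <= u by rewrite -[leRHS]expRK ler_ln ?posrE ?expR_gt0.
(* Rounding down to an integer at most halves the logarithm; this is why 200 replaces 100 in the
   lower bound for [ln (ln m)]. *)
have lmu2 : u / 2 <= ln m%:R.
  rewrite -[leLHS]expRK ler_ln ?posrE ?expR_gt0//.
  have E : expR u = expR (u / 2) * expR (u / 2) by rewrite -expRD; congr expR; field.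
  have := expR_ge1Dx (u / 2); move: um; rewrite -natr1 E; nra.
have lm1 : 1 <= ln m%:R by lra.
have llm : ln (ln m%:R) <= ln u by rewrite ler_ln ?posrE//; clear -lm1 u20; lra.
have llm2 : ln (u / 2) <= ln (ln m%:R) by rewrite ler_ln ?posrE//; clear -lm1 u20; lra.
have p100 : 0 < 100 :> R by rewrite ltr0n.
have p200 : 0 < 200 :> R by rewrite ltr0n.
have lnu : ln u = T - (ln 100 + ln T).
  by rewrite /u ln_div ?posrE ?expR_gt0 ?mulr_gt0// expRK lnM ?posrE.
have lnu2 : ln (u / 2) = T - (ln 200 + ln T).
  have -> : u / 2 = expR T / (200 * T) by rewrite /u; field; rewrite gt_eqF.
  by rewrite ln_div ?posrE ?expR_gt0 ?mulr_gt0// expRK lnM ?posrE.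
have ln100 : 0 <= ln 100 by apply: ln_ge0; lra.
exists m; split => //.
- by rewrite ler_norml; apply/andP; split; clear -llm llm2 lnu lnu2 lT200 ln100 lT0; lra.
(* With [k] between [12 T] and [13 T], [(2 m)^k] is at most [exp(13 T + 0.13 exp T)], negligible
   against [N = exp(exp T)], while [2^k >= exp(6 T)] beats the moment [exp(4 T + 4 C0)]. *)
- move=> f f1; pose k := (Num.truncn (12 * T)).+1.
  have /andP[k1 k2] : (Num.truncn (12 * T))%:R <= 12 * T < k%:R.
    by apply: truncn_itv; lra.
  have kT : k%:R <= 13 * T by rewrite /k -natr1; clear -k1 T40; lra.
  have := kubilius N m prime N0 (fun _ h => h) f k (leq_trans _ m3) f1.
  move=> /(_ isT)/le_trans; apply; rewrite [leRHS]mulrDl mul1r; apply: lerD.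
    rewrite ler_pdivrMr ?ltr0n// NE.
    apply: (@le_trans _ _ (expR 1 * expR (k%:R * (1 + u)))).
      rewrite ler_wpM2l ?expR_ge0// expRM_natl lerXn2r ?nnegrE ?expR_ge0 ?mulr_ge0//.
      by rewrite expRD ler_pM//; have := expR_ge1Dx (1 : R); lra.
    rewrite -!expRD ler_expR.
    have : k%:R * (1 + u) <= 13 * T * (1 + u) by rewrite ler_wpM2r//; lra.
    have : T ^+ 2 * 400 <= expR T by apply: le_trans T3; rewrite !exprS expr0; nra.
    by rewrite !exprS expr0; nra.
  have S1 : \sum_p recip m prime p <= T + C0.
    have := H0 m m3; rewrite big_mkord ler_norml => /andP[_].
    by rewrite /recip; lra.
  have k2' : expR (6 * T) <= 2 ^+ k.
    apply: (@le_trans _ _ (expR (k%:R * 2^-1))); first by rewrite ler_expR; lra.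
    by rewrite expRM_natl lerXn2r ?nnegrE ?expR_ge0// expR_half_le2.
  rewrite ler_pdivrMr ?exprn_gt0//.
  apply: (@le_trans _ _ (2 * expR (4 * C0) * expR (- T) * expR (6 * T))); last first.
    by rewrite ler_wpM2l// !mulr_ge0// expR_ge0.
  by rewrite -!mulrA ler_wpM2l// -!expRD ler_expR; lra.
- have -> : \sum_(p < N.+1) recip N.+1 (fun p => prime p && (m <= p)%N) p =
    \sum_(0 <= p < N.+1 | prime p && (m%:R <= p%:R :> R)) p%:R^-1 :> R.
    rewrite big_mkord [RHS]big_mkcond; apply: eq_bigr => p _; rewrite /recip ler_nat.
    by case: (prime p && _); rewrite ?mul1r ?mul0r.
  have mN : (m <= N)%N.
    rewrite -(ler_nat R) NE; apply: le_trans mu _; rewrite ler_expR /u.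
    by rewrite ler_pdivrMr ?ler_peMr ?expR_ge0//; lra.
  have := H1 m%:R N.+1; rewrite !ler_nat m3 => /(_ isT (leqW mN)).
  have : C1 / ln m%:R <= C1 by rewrite ler_pdivrMr ?ler_peMr//; lra.
  have lN1 : 1 <= ln N%:R by rewrite lN; have := expR_ge1Dx T; lra.
  have N1 : 1 <= N%:R :> R by rewrite ler1n.
  have : 0 <= ln (ln N.+1%:R) - T <= 1.
    by apply: (ln_ln_near N) => //; rewrite -natr1; clear -T40 N1; lra.
  move=> /andP[_]; rewrite ler_norml => ? ? /andP[? ?]; lra.
Unshelve. all: by end_near. Qed.

(** Markov's inequality for 2 raised to the number of large prime factors; [2 >= exp(1/2)] gives the
    rate [x / 2]. *)
Lemma few_large_primes (N m : nat) (T x : R) : (0 < N)%N ->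
  \sum_p recip N.+1 (fun p => prime p && (m <= p)%N) p <= 4 * ln T ->
  Pr (unif N) (fun i => x < #|divset N.+1 (fun p => prime p && (m <= p)%N) i.+1|%:R)
  <= expR (4 * ln T - x / 2).
Proof.
move=> N0 S4.
set Q := (fun p => prime p && (m <= p)%N) in S4 *.
have QP p : Q p -> prime p by case/andP.
apply: (@le_trans _ _ (Ex (unif N) (fun i => expR (- (x / 2)) *
    2 ^+ #|divset N.+1 Q i.+1|))).
  apply: markov_Ex (unif_distr N N0) _ _ => i.
    by rewrite mulr_ge0 ?expR_ge0 ?exprn_ge0.
  set c := #|_| => xc.
  apply: (@le_trans _ _ (expR (- (x / 2)) * expR (c%:R * 2^-1))).
    by rewrite -expRD -[leLHS]expR0 ler_expR; lra.
  by rewrite ler_wpM2l ?expR_ge0// expRM_natl lerXn2r ?nnegrE ?expR_ge0// expR_half_le2.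
rewrite ExZ addrC expRD ler_wpM2l ?expR_ge0//.
have := Ex_divset_exp N N.+1 Q N0 QP (2 : R); rewrite ler1n => /(_ isT).
by move/le_trans; apply; rewrite ler_expR; lra.
Qed.

End Cutoff.

(** * Stability of the normal law under scaling and shifts *)

Section PhiScale.
Context {R : realType}.

(** The bound is uniform in [t] because the intermediate point [c] satisfies [|t| <= 2 |c|] and
    [|c| * phi c] is at most 1. *)
Lemma Phi_scale (t a : R) : 2^-1 <= a -> `|Phi (t * a) - Phi t| <= 2 * `|a - 1|.
Proof.
move=> a2.
have [c tc E] : exists2 c, `|t| <= 2 * `|c| &
    Phi (t * a) - Phi t = phi c * (t * (a - 1)).
  have cP := continuous_subspaceT (is_derive_continuous (@is_derive_Phi R)).
  have [ta|ta] := leP t (t * a).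
    have [c] := MVT_segment ta (fun z _ => is_derive_Phi z) (cP _).
    rewrite in_itv/= => /andP[c1 c2] E; exists c; last by rewrite E; ring.
    by case: (ger0P t) => ?; case: (ger0P c) => ?; nra.
  have [c] := MVT_segment (ltW ta) (fun z _ => is_derive_Phi z) (cP _).
  rewrite in_itv/= => /andP[c1 c2] E; exists c; last by rewrite -opprB E; ring.
  by case: (ger0P t) => ?; case: (ger0P c) => ?; nra.
rewrite E normrM (ger0_norm (ltW (phi_gt0 c))) normrM mulrA ler_wpM2r//.
have p0 := phi_gt0 c.
have pc : phi c * (1 + c ^+ 2 / 2) <= 1.
  apply: (@le_trans _ _ (expR (- (c ^+ 2 / 2)) * expR (c ^+ 2 / 2))).
    rewrite ler_pM ?(ltW p0) ?phi_le ?expR_ge1Dx//.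
    by rewrite addr_ge0// divr_ge0// sqr_ge0.
  by rewrite -expRD addNr expR0.
have : `|c| <= 1 + c ^+ 2 / 2.
  rewrite -(@real_normK _ c) ?num_real//.
  have := sqr_ge0 (`|c| - 1); rewrite !expr2; lra.
move=> cc; apply: (@le_trans _ _ (phi c * (2 * (1 + c ^+ 2 / 2)))); last lra.
by rewrite ler_wpM2l ?(ltW p0)//; lra.
Qed.

Lemma Phi_perturb (t s sg d c e : R) : 0 <= s -> 0 < sg ->
  `|s ^+ 2 - sg ^+ 2| <= e -> e / sg ^+ 2 <= 2^-1 -> `|d| <= c ->
  `|Phi ((t * s + d) / sg) - Phi t| <= c / sg + 2 * (e / sg ^+ 2).
Proof.
move=> s0 sg0 es e2 dc.
have -> : Phi ((t * s + d) / sg) - Phi t = (Phi ((t * s + d) / sg) - Phi (t * (s / sg)))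
   + (Phi (t * (s / sg)) - Phi t) by ring.
apply: le_trans (ler_normD _ _) _; apply: lerD.
  apply: le_trans (Phi_lip_norm _ _) _.
  have -> : (t * s + d) / sg - t * (s / sg) = d / sg by ring.
  by rewrite normrM (gtr0_norm (_ : 0 < sg^-1)) ?invr_gt0// ler_wpM2r// invr_ge0 ltW.
have ss0 : 0 < sg * (s + sg) by rewrite mulr_gt0// ltr_wpDl.
have ssg : `|s / sg - 1| <= e / sg ^+ 2.
  have -> : s / sg - 1 = (s ^+ 2 - sg ^+ 2) / (sg * (s + sg)).
    by field; rewrite !gt_eqF// ltr_wpDl.
  rewrite normrM (gtr0_norm (_ : 0 < (sg * (s + sg))^-1)) ?invr_gt0//.
  rewrite ler_pM ?invr_ge0 ?(ltW ss0)//.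
  by rewrite lef_pV2 ?posrE ?exprn_gt0// expr2 ler_pM2l// lerDr.
apply: le_trans (Phi_scale t (s / sg) _) _; last by rewrite ler_wpM2l.
by move: (le_trans ssg e2); rewrite ler_norml => /andP[? ?]; lra.
Qed.

End PhiScale.

(** * The distribution function of the gap count *)

Section Distribution.
Context {R : realType}.
Variable z : R.
Hypothesis z0 : 0 <= z.
Local Notation ln := (@ln R).
Local Notation lam := (expR (- z)).

(** Positivity amounts to [2 z < exp z], which follows from [exp z > (1 + z / 2)^2 >= 2 z] for
    [z > 0]. *)
Lemma gamma_bounds : 0 < gamma z <= 1.
Proof.
have l0 : 0 < lam := expR_gt0 _.
have l1 : lam <= 1 by rewrite expR_le1 oppr_le0.
have h : 2 * z * lam < 1.
  rewrite -ltr_pdivlMr// div1r -expRN opprK.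
  have [->|zn] := eqVneq z 0; first by rewrite mulr0 expR_gt0.
  have h2 : 1 + z / 2 < expR (z / 2) by apply: expR_gt1Dx; rewrite mulf_neq0// invr_eq0.
  have -> : expR z = expR (z / 2) * expR (z / 2) by rewrite -expRD; congr expR; field.
  have : 0 <= (z / 2 - 1) ^+ 2 by rewrite sqr_ge0.
  have : (1 + z / 2) * (1 + z / 2) < expR (z / 2) * expR (z / 2).
    by rewrite ltr_pM//; have := z0; lra.
  by rewrite expr2; lra.
have zl : 0 <= z * lam by rewrite mulr_ge0// ltW.
rewrite /gamma /lambda; apply/andP; split; first by rewrite mulr_gt0//; lra.
by rewrite mulr_ile1//; lra.
Qed.

(** Bundles what both the distribution and the tail estimates need. The parameter [x] stays free
    because the tail needs an exceptional set smaller than any given power of [1 / T]. *)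
Definition coupled (C T : R) (N : nat) : Prop := (0 < N)%N /\
  exists (m : nat) (ES : R),
  let X := fun A : {set 'I_m} => gap_total (R := R) (gap_rel z) A in
  [/\ ES = gap_total_mean (recip m prime) (gap_rel z) /\ 0 <= ES <= 2 * T,
   `|gap_total_var (recip m prime) (gap_rel z) - gamma z * T| <= C * ln T,
   (forall f : {set 'I_m} -> R, (forall A, `|f A| <= 1) ->
      `|Ex (unif N) (fun i => f (divset m prime i.+1)) - Ex (bern (recip m prime)) f|
      <= C * expR (- T)) &
   forall x, Pr (unif N) (fun i => C * ln T + x <
       `|gap_dev z N i.+1 - (X (divset m prime i.+1) - ES)|) <= expR (4 * ln T - x / 2)].

Lemma coupling_exists : exists2 C : R, 1 <= C & \forall T \near +oo, forall N : nat,
  T = ln (ln N%:R) -> coupled C T N.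
Proof.
have [C0 C00 H0] := @cutoff_exists R.
have [C1 C10 H1] := gap_mean_total_asym z z0.
have [C2 C20 H2] := gap_var_total_asym z z0.
have /andP[g0 g1] := gamma_bounds.
have l0 : 0 < lam := expR_gt0 _.
have l1 : lam <= 1 by rewrite expR_le1 oppr_le0.
(* The 4 covers [2 * ln T] from the cutoff, 1 from replacing N by 2N in the centring and 1 from the
   smallest prime factor. *)
pose C := C0 + C1 + C2 + 4.
exists C; first by rewrite /C; lra.
near=> T => N TE.
have lT1 : 1 <= ln T by near: T; exact: near_ln_ge.
have T2 : 2 <= T by near: T; exact: near_ge.
have lTT : ln T <= (2 + C1)^-1 / 2 * T.
  by near: T; apply: near_ln_le; rewrite divr_gt0// invr_gt0; lra.
have [m [m3 llm TV few]] : exists m, is_cutoff C0 T N m.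
  by move: (N) TE; near: T.
have T0 : 0 < T by lra.
have [N0 lNT _] := ln_ln_natE N T T0 TE.
have lN0 : 0 < ln N%:R by rewrite lNT expR_gt0.
split; first exact: N0.
exists m, (gap_total_mean (recip m prime) (gap_rel z)).
have M1 := H1 m m3; have V1 := H2 m m3.
rewrite -gap_total_mean_prime// in M1.
rewrite -gap_total_var_prime// in V1.
set ES := gap_total_mean _ _ in M1 *.
set VAR := gap_total_var _ _ in V1 *.
have lamT : `|lam * ln (ln m%:R) - lam * T| <= 2 * ln T.
  by rewrite -mulrBr normrM (ger0_norm (ltW l0)); apply: le_trans llm; rewrite ler_piMl.
have gamT : `|gamma z * ln (ln m%:R) - gamma z * T| <= 2 * ln T.
  by rewrite -mulrBr normrM (ger0_norm (ltW g0)); apply: le_trans llm; rewrite ler_piMl.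
have MT : `|ES - lam * T| <= C1 + 2 * ln T.
  have -> : ES - lam * T = (ES - lam * ln (ln m%:R)) + (lam * ln (ln m%:R) - lam * T) by ring.
  by apply: le_trans (ler_normD _ _) _; apply: lerD.
split.
- split=> //; apply/andP; split.
    by apply: sumr_ge0 => i _; apply: gap_mean_ge0; exact: recip01.
  have : lam * T <= T by rewrite ler_piMl//; lra.
  have : (2 + C1) * ln T <= (2 + C1) * ((2 + C1)^-1 / 2 * T) by rewrite ler_wpM2l//; lra.
  have -> : (2 + C1) * ((2 + C1)^-1 / 2 * T) = T / 2 by field; lra.
  have : C1 * 1 <= C1 * ln T by rewrite ler_wpM2l.
  by move: MT; rewrite ler_norml => /andP[_]; lra.
- have -> : VAR - gamma z * T =
    (VAR - gamma z * ln (ln m%:R)) + (gamma z * ln (ln m%:R) - gamma z * T) by ring.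
  apply: le_trans (ler_normD _ _) _.
  have : C2 * 1 <= C2 * ln T by rewrite ler_wpM2l.
  have : 0 <= C0 * ln T by rewrite mulr_ge0//; lra.
  have : 0 <= C1 * ln T by rewrite mulr_ge0//; lra.
  by rewrite /C; lra.
- move=> f f1; apply: le_trans (TV f f1) _; rewrite ler_wpM2r ?expR_ge0// /C; lra.
move=> x.
apply: le_trans (few_large_primes N m T x N0 few); apply: le_Pr (unif_distr N N0) _ => i.
have iN : (i.+1 <= N)%N := ltn_ord i.
have := gap_count_total z m N i.+1 isT iN.
set w := #|_|; set g := gap_count z i.+1; set Xi := gap_total _ _ => gX.
rewrite /gap_dev -/g /log_iter /= /lambda.
have ll2 : `|ln (ln (2 * N%:R)) - T| <= 1.
  have NR : 0 < N%:R :> R by rewrite ltr0n.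
  have NN : N%:R <= 2 * N%:R :> R by clear -NR; lra.
  have /andP[h0 h1] := ln_ln_near N T _ (le_trans lT1 (ltW (ln_sublinear T0))) TE NN (lexx _).
  by rewrite ger0_norm.
have ll2' : `|lam * ln (ln (2 * N%:R)) - lam * T| <= 1.
  by rewrite -mulrBr normrM (ger0_norm (ltW l0)); apply: le_trans ll2; rewrite ler_piMl.
move=> Hx; rewrite -(ltrD2l (C * ln T)); apply: lt_le_trans Hx _.
have -> : g%:R - lam * ln (ln (2 * N%:R)) - (Xi - ES) = (g%:R - Xi) +
   ((ES - lam * T) - (lam * ln (ln (2 * N%:R)) - lam * T)) by ring.
apply: le_trans (ler_normD _ _) _.
have := ler_normB (ES - lam * T) (lam * ln (ln (2 * N%:R)) - lam * T).
have : C1 * 1 <= C1 * ln T by rewrite ler_wpM2l.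
have : 0 <= C0 * ln T by rewrite mulr_ge0//; lra.
have : 0 <= C2 * ln T by rewrite mulr_ge0//; lra.
by rewrite /C; lra.
Unshelve. all: by end_near. Qed.

Lemma dist_asym : exists2 C : R, 0 <= C & \forall T \near +oo, forall N : nat,
  T = ln (ln N%:R) -> forall t : R,
  `|Pr (unif N) (fun i => gap_dev z N i.+1 <= t * Num.sqrt (gamma z * T)) - Phi t|
  <= C * (ln T / Num.sqrt T).
Proof.
have [C C1 HC] := coupling_exists.
have C00 : 0 <= C by lra.
have C100 : 0 <= C + 10 by lra.
have /andP[g0 g1] := gamma_bounds.
pose K0 := 8 * (phi (1 : R))^-1 + 72.
have K0_ge0 : 0 <= K0.
  by rewrite /K0 addr_ge0// mulr_ge0// invr_ge0 ltW// phi_gt0.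
pose cg := Num.sqrt (2 / gamma z).
have cg0 : 0 <= cg by rewrite sqrtr_ge0.
(* The five terms are the exceptional integers, the comparison with the model, Berry-Esseen, the
   shift by [c], and the change of standard deviation. *)
pose C' := 1 + C + (32 / gamma z + 1) * K0 * (4 * cg) + (C + 10) * cg + 2 * (C * cg).
exists C'.
  have P1 : 0 <= (32 / gamma z + 1) * K0 * (4 * cg).
    by rewrite !mulr_ge0// addr_ge0// divr_ge0// ltW.
  have P2 := mulr_ge0 C00 cg0.
  by rewrite /C'; lra.
near=> T => N TE t.
have lT1 : 1 <= ln T by near: T; exact: near_ln_ge.
(* Together with [V >= gamma z * T / 2] this makes the variance at least 16, as [gap_berry_esseen]
   requires. *)
have T32 : 32 / gamma z <= T by near: T; exact: near_ge.
have Tg : 0 < T by apply: lt_le_trans T32; rewrite divr_gt0.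
have lTg : C * ln T <= gamma z / 4 * T.
  have lT : ln T <= gamma z / (4 * C) * T.
    by near: T; apply: near_ln_le; rewrite divr_gt0// mulr_gt0//; lra.
  apply: le_trans (ler_wpM2l _ lT) _; first by lra.
  by rewrite le_eqVlt; apply/orP; left; apply/eqP; field; lra.
have [N0 [m [ES [[ESE /andP[ES0 ES2]] VT TV few]]]] : coupled C T N.
  by move: (N) TE; near: T.
set V := gap_total_var _ _ in VT.
pose X (A : {set 'I_m}) := gap_total (R := R) (gap_rel z) A - ES.
pose Xn (i : 'I_N) := X (divset m prime i.+1).
pose s := Num.sqrt (gamma z * T).
have gT0 : 0 < gamma z * T by rewrite mulr_gt0.
have s2 : s ^+ 2 = gamma z * T by rewrite sqr_sqrtr// ltW.
have s0 : 0 <= s by rewrite sqrtr_ge0.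
have Vge : gamma z * T / 2 <= V.
  by move: VT; rewrite ler_norml => /andP[VT _]; move: lTg gT0 VT; lra.
have gT32 : 32 <= gamma z * T by rewrite mulrC -ler_pdivrMr.
pose sg := Num.sqrt V.
have sg2 : sg ^+ 2 = V by rewrite sqr_sqrtr//; lra.
have sg4 : 4 <= sg.
  by rewrite -(@ger0_norm _ 4)// -sqrtr_sqr ler_sqrt; rewrite ?expr2; clear -Vge gT32; lra.
have sg0 : 0 < sg by lra.
have sT0 : 0 < Num.sqrt T by rewrite sqrtr_gt0.
have sT2 : Num.sqrt T ^+ 2 = T by rewrite sqr_sqrtr// ltW.
have isg : sg^-1 <= cg / Num.sqrt T.
  rewrite ler_pdivlMr// mulrC ler_pdivrMr// /cg /sg -sqrtrM ?divr_ge0 ?(ltW g0)//.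
  rewrite ler_sqrt; last by rewrite mulr_ge0 ?divr_ge0 ?(ltW g0)//; lra.
  rewrite mulrAC ler_pdivlMr// mulrC; lra.
set q := ln T / Num.sqrt T.
have q0 : 0 <= q by rewrite divr_ge0 ?sqrtr_ge0//; lra.
have isTq : (Num.sqrt T)^-1 <= q by rewrite /q ler_peMl// invr_ge0 ltW.
have T1 : 1 <= T by have := @ln_sublinear R T Tg; lra.
have iTq : T^-1 <= q.
  apply: le_trans isTq; rewrite lef_pV2 ?posrE//.
  by rewrite -{2}sT2 expr2 ler_peMl ?sqrtr_ge0// -sqrtr1 ler_sqrt.
have eTq : expR (- T) <= q.
  apply: le_trans iTq; rewrite expRN lef_pV2 ?posrE ?expR_gt0//.
  by have := expR_ge1Dx T; lra.
pose c := (C + 10) * ln T.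
(* An excess of [10 * ln T] makes the exceptional probability [exp(4 ln T - 5 ln T) = 1 / T]. *)
have bad : Pr (unif N) (fun i => c < `|gap_dev z N i.+1 - Xn i|) <= q.
  have := few (10 * ln T); rewrite -mulrDl; move/le_trans; apply.
  have -> : 4 * ln T - 10 * ln T / 2 = - ln T by field.
  by rewrite expRN lnK ?posrE.
have BE v : `|Pr (bern (recip m prime)) (fun A => X A <= v) - Phi (v / sg)| <=
    (32 / gamma z + 1) * K0 * (4 * cg) * q.
  have := gap_berry_esseen (recip m prime) (gap_rel z) (recip01 m prime (fun _ h => h))
     (gap_rel_lower z) (gap_rel_upper z) (v / sg) sg sg4 sg2.
  rewrite -ESE divfK ?gt_eqF// => /le_trans; apply.
  have -> : (32 / gamma z + 1) * K0 * (4 * cg) * q =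
    (32 / gamma z + 1) * K0 * (4 * (cg * q)) by ring.
  have PA : 0 <= 8 * ES / sg ^+ 2 + 1.
    by rewrite addr_ge0// divr_ge0 ?exprn_ge0 ?(ltW sg0)// mulr_ge0.
  apply: ler_pM; [exact: mulr_ge0|by rewrite divr_ge0// ltW| |].
    rewrite ler_wpM2r// lerD2r sg2 ler_pdivrMr; last lra.
    apply: (@le_trans _ _ (16 * T)); first by clear -ES2; lra.
    have -> : 16 * T = 32 / gamma z * (gamma z * T / 2) by field; rewrite gt_eqF.
    by rewrite ler_wpM2l// divr_ge0// ltW.
  rewrite ler_wpM2l//; apply: le_trans isg _.
  by rewrite ler_wpM2l.
have PhiT d : `|d| <= c -> `|Phi ((t * s + d) / sg) - Phi t| <=
   ((C + 10) * cg + 2 * (C * cg)) * q.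
  move=> dc.
  have sq2 : C * ln T / sg ^+ 2 <= 2^-1.
    by rewrite ler_pdivrMr ?exprn_gt0// sg2; move: lTg Vge; clear; lra.
  have VT' : `|s ^+ 2 - sg ^+ 2| <= C * ln T by rewrite sg2 s2 distrC.
  apply: le_trans (Phi_perturb t s sg d _ _ s0 sg0 VT' sq2 dc) _.
  have lsg : ln T / sg <= cg * q.
    by rewrite /q mulrCA ler_wpM2l// (le_trans ler01).
  have lsg2 : ln T / sg ^+ 2 <= cg * q.
    apply: le_trans lsg; rewrite ler_wpM2l ?(le_trans ler01)//.
    rewrite lef_pV2 ?posrE ?exprn_gt0// expr2 ler_peMl ?(ltW sg0)//.
    by apply: le_trans sg4; rewrite ler1n.
  have H1 := ler_wpM2l C100 lsg; have H2 := ler_wpM2l C00 lsg2.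
  by move: H1 H2; rewrite /c; clear; lra.
have TVP v : `|Pr (unif N) (fun i => Xn i <= v) -
    Pr (bern (recip m prime)) (fun A => X A <= v)| <= C * q.
  apply: le_trans (TV (fun A => (X A <= v)%R%:R) _) _.
    by move=> A; rewrite normr_nat lern1 leq_b1.
  by rewrite ler_wpM2l//; lra.
have dU : is_distr (@unif R N) := unif_distr N N0.
have up : Pr (unif N) (fun i => gap_dev z N i.+1 <= t * s) <=
   Pr (unif N) (fun i => Xn i <= t * s + c) + q.
  apply: le_trans (Pr_union _ _ (fun i => Xn i <= t * s + c)
    (fun i => c < `|gap_dev z N i.+1 - Xn i|) dU _) _; last by rewrite lerD2l.
  move=> i Hi; rewrite orbC ltNge; case: leP => //= Hc.
  by move: Hc; rewrite ler_norml => /andP[h1 h2]; clear -Hi h1 h2; lra.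
have dn : Pr (unif N) (fun i => Xn i <= t * s - c) <=
   Pr (unif N) (fun i => gap_dev z N i.+1 <= t * s) + q.
  apply: le_trans (Pr_union _ _ (fun i : 'I_N => gap_dev z N i.+1 <= t * s)
    (fun i => c < `|gap_dev z N i.+1 - Xn i|) dU _) _; last by rewrite lerD2l.
  move=> i Hi; rewrite orbC ltNge; case: leP => //= Hc.
  by move: Hc; rewrite ler_norml => /andP[h1 h2]; clear -Hi h1 h2; lra.
have c0 : 0 <= c := mulr_ge0 C100 (le_trans ler01 lT1).
have A1 := TVP (t * s + c); have A2 := TVP (t * s - c).
have A3 := BE (t * s + c); have A4 := BE (t * s - c).
have A5 : `|Phi ((t * s + c) / sg) - Phi t| <= ((C + 10) * cg + 2 * (C * cg)) * q.
  by apply: PhiT; rewrite ger0_norm.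
have A6 : `|Phi ((t * s - c) / sg) - Phi t| <= ((C + 10) * cg + 2 * (C * cg)) * q.
  by apply: PhiT; rewrite normrN ger0_norm.
have -> : C' * q = q + C * q + (32 / gamma z + 1) * K0 * (4 * cg) * q +
    ((C + 10) * cg + 2 * (C * cg)) * q by rewrite /C'; ring.
move: up dn A1 A2 A3 A4 A5 A6; rewrite !ler_norml; clear.
move: (C * q) (_ * (4 * cg) * q) (_ * q) => y1 y2 y3 up dn.
move=> /andP[? ?] /andP[? ?] /andP[? ?] /andP[? ?] /andP[? ?] /andP[? ?].
by apply/andP; split; lra.
Unshelve. all: by end_near. Qed.

End Distribution.

(** * Crude moments and tails *)

Section Moments.
Context {R : realType}.
Variable z : R.
Hypothesis z0 : 0 <= z.
Local Notation ln := (@ln R).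
Local Notation lam := (expR (- z)).

(** The deviation is at most the number of prime factors plus [T + 1], and that number divided by
    [T] has a bounded exponential moment. The exponent [r], instead of the true [r / 2], is made up
    for by the tail bound. *)
Lemma gap_dev_moment (r : nat) : exists2 C : R, 0 <= C &
  \forall T \near +oo, forall N : nat, T = ln (ln N%:R) ->
  Ex (unif N) (fun i => `|gap_dev z N i.+1| ^+ r) <= C * T ^+ r.
Proof.
have [C0 C00 H0] := @sum_prime_recip R.
exists (r`!%:R * (expR 2 * expR 4)); first by rewrite !mulr_ge0// expR_ge0.
near=> T => N TE.
have T2 : 2 <= T by near: T; exact: near_ge.
have TC0 : 1 + C0 <= T by near: T; exact: near_ge.
have T0 : 0 < T by lra.
have [N0 lNT _] := ln_ln_natE N T T0 TE.
have lN0 : 0 < ln N%:R by rewrite lNT expR_gt0.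
pose Q := fun p => prime p && (0 <= p)%N.
have QP p : Q p -> prime p by case/andP.
pose w (i : 'I_N) := #|divset N.+1 Q i.+1|.
have NR : 0 < N%:R :> R by rewrite ltr0n.
have l0 : 0 < lam := expR_gt0 _.
have l1 : lam <= 1 by rewrite expR_le1 oppr_le0.
have ll2 : `|ln (ln (2 * N%:R))| <= T + 1.
  have T1 : 1 <= T by clear -T2; lra.
  have NN : N%:R <= 2 * N%:R :> R by clear -NR; lra.
  have /andP[h1 h2] := ln_ln_near N T _ T1 TE NN (lexx _).
  by rewrite ger0_norm; clear -T1 h1 h2; lra.
have Dw (i : 'I_N) : `|gap_dev z N i.+1| <= (w i)%:R + (T + 1).
  rewrite /gap_dev /log_iter /= /lambda; apply: le_trans (ler_normB _ _) _.
  apply: lerD.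
    by rewrite normr_nat ler_nat; exact: gap_count_le (ltn_ord i).
  by rewrite normrM (ger0_norm (ltW l0)); apply: le_trans ll2; rewrite ler_piMl.
have Ew : Ex (unif N) (fun i => expR ((w i)%:R / T)) <= expR 4.
  have c1 : 1 <= expR T^-1 by rewrite -[leLHS]expR0 ler_expR invr_ge0 ltW.
  have := Ex_divset_exp N N.+1 Q N0 QP _ c1.
  rewrite (eq_Ex _ _ (fun i => expR ((w i)%:R / T))); last first.
    by move=> i; rewrite -expRM_natl.
  move/le_trans; apply; rewrite ler_expR.
  have iT2 : T^-1 <= 2^-1 by rewrite lef_pV2 ?posrE.
  have iT0 : 0 <= T^-1 by rewrite invr_ge0 ltW.
  have cT : expR T^-1 - 1 <= 2 / T.
    have : expR T^-1 * (1 - T^-1) <= 1.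
      apply: (@le_trans _ _ (expR T^-1 * expR (- T^-1))).
        by rewrite ler_wpM2l ?expR_ge0//; exact: expR_ge1Dx.
      by rewrite -expRD subrr expR0.
    by move: iT2 iT0 c1; move: (T^-1) (expR _) => h e; nra.
  have S : \sum_p recip N.+1 Q p <= T + 1 + C0.
    have N3 : (3 <= N.+1)%N.
      have : expR 2 <= ln N%:R by rewrite lNT ler_expR.
      have := expR_ge1Dx (2 : R); have := ln_sublinear NR => A B C'.
      by rewrite -(ler_nat R) -natr1; lra.
    have := H0 N.+1 N3; rewrite big_mkord.
    have -> : \sum_(p < N.+1) (prime p)%:R / p%:R = \sum_p recip N.+1 Q p :> R.
      by apply: eq_bigr => p _; rewrite /recip /Q andbT.
    have N1 : 1 <= N%:R :> R by rewrite ler1n.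
    have T1 : 1 <= T by clear -T2; lra.
    have := ln_ln_near N T N.+1%:R T1 TE; rewrite -natr1 lerDl ler01 => /(_ isT).
    move=> /(_ ltac:(clear -N1; lra)) /andP[_].
    by rewrite ler_norml => ? /andP[_]; lra.
  apply: (@le_trans _ _ (2 / T * (T + 1 + C0))).
    rewrite ler_pM ?subr_ge0//; apply: sumr_ge0 => p _.
    by rewrite /recip divr_ge0.
  by rewrite mulrAC ler_pdivrMr//; lra.
apply: (@le_trans _ _ (Ex (unif N) (fun i =>
    T ^+ r * (r`!%:R * expR 2) * expR ((w i)%:R / T)))).
  apply: le_Ex (unif_distr N N0) _ => i.
  have -> : `|gap_dev z N i.+1| = T * (`|gap_dev z N i.+1| / T).
    by field; rewrite gt_eqF.
  rewrite exprMn -!mulrA ler_wpM2l ?exprn_ge0 ?(ltW T0)//.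
  apply: le_trans (exprn_le_expR _ _ _) _; first by rewrite divr_ge0// ltW.
  rewrite ler_wpM2l// -expRD ler_expR ler_pdivrMr//.
  apply: le_trans (Dw i) _.
  by rewrite mulrDl divfK ?gt_eqF//; lra.
rewrite ExZ mulrC -[leRHS]mulrA.
have -> : r`!%:R * (expR 2 * expR 4 * T ^+ r) = expR 4 * (T ^+ r * (r`!%:R * expR 2)) by ring.
by rewrite ler_wpM2r// !mulr_ge0 ?exprn_ge0 ?expR_ge0 ?(ltW T0).
Unshelve. all: by end_near. Qed.

(** A deviation beyond [K * y] forces either the coupling error beyond [y] or the model beyond
    [(K - 1) * y]. The four units are one each for the coupling and the law comparison, and two for
    Chernoff. *)
Lemma tail_asym (A : nat) : exists2 K : R, 0 <= K & \forall T \near +oo,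
  forall N : nat, T = ln (ln N%:R) ->
  Pr (unif N) (fun i => K * Num.sqrt (T * ln T) < `|gap_dev z N i.+1|)
  <= 4 * (T ^+ A)^-1.
Proof.
have [C C1 HC] := coupling_exists z z0.
pose e3 := expR 3 : R.
have e30 : 0 <= e3 by exact: expR_ge0.
pose K := 2 + 8 * e3 + A%:R.
have K2 : 2 <= K.
  by rewrite /K; have : 0 <= A%:R :> R by []; lra.
pose B := C + 2 * (A%:R + 4).
have B0 : 0 < B by rewrite /B; have : 0 <= A%:R :> R by []; lra.
exists K; first by lra.
near=> T => N TE.
have lT1 : 1 <= ln T by near: T; exact: near_ln_ge.
have T16 : 16 <= T by near: T; exact: near_ge.
have TC : C <= T by near: T; exact: near_ge.
have TA : T ^+ A.+1 <= expR T by near: T; exact: near_pow_le_expR.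
have lTB : ln T <= (B ^+ 2)^-1 * T.
  by near: T; apply: near_ln_le; rewrite invr_gt0 exprn_gt0.
have lT16 : ln T <= 16^-1 * T by near: T; apply: near_ln_le; rewrite invr_gt0.
have T0 : 0 < T by lra.
have [N0 [m [ES [[ESE /andP[ES0 ES2]] VT TV few]]]] : coupled z C T N.
  by move: (N) TE; near: T.
pose X (S : {set 'I_m}) := gap_total (R := R) (gap_rel z) S - ES.
pose Xn (i : 'I_N) := X (divset m prime i.+1).
have dU : is_distr (@unif R N) := unif_distr N N0.
set y := Num.sqrt (T * ln T).
have TlT : 0 < T * ln T by rewrite mulr_gt0//; lra.
have y0 : 0 < y by rewrite sqrtr_gt0.
have y2 : y ^+ 2 = T * ln T by rewrite sqr_sqrtr// ltW.
have expA : expR (- (A%:R * ln T)) = (T ^+ A)^-1.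
  by rewrite expRN expRM_natl lnK ?posrE.
have TA0 : 0 < T ^+ A by rewrite exprn_gt0.
have By : B * ln T <= y.
  rewrite -(@ler_pXn2r _ 2) ?nnegrE ?mulr_ge0 ?(ltW B0) ?(ltW y0)//; last lra.
  rewrite y2 exprMn expr2 mulrA ler_wpM2r//; first lra.
  by move: lTB; rewrite mulrC ler_pdivlMr ?exprn_gt0// mulrC.
have bad : Pr (unif N) (fun i => y < `|gap_dev z N i.+1 - Xn i|) <= (T ^+ A)^-1.
  have := few (2 * (A%:R + 4) * ln T); rewrite -mulrDl -/B => H.
  apply: le_trans (le_trans _ H) _.
    apply: le_Pr dU _ => i; exact: le_lt_trans.
  by rewrite -expA ler_expR; lra.
have TVX : Pr (unif N) (fun i => (K - 1) * y <= `|Xn i|) <=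
   Pr (bern (recip m prime)) (fun S => (K - 1) * y <= `|X S|) + (T ^+ A)^-1.
  have := TV (fun S => ((K - 1) * y <= `|X S|)%R%:R) _.
  move=> /(_ ltac:(by move=> S; rewrite normr_nat lern1 leq_b1)).
  have : C * expR (- T) <= (T ^+ A)^-1.
    rewrite expRN ler_pdivrMr ?expR_gt0// ler_pdivlMl ?TA0//.
    by apply: le_trans TA; rewrite exprSr ler_wpM2l// ltW.
  rewrite ler_norml => h /andP[_]; move: h; rewrite /Pr /Xn.
  by move: (Ex _ _) (Ex _ _) (C * _) (T ^+ A)^-1 => a b c d; clear; lra.
have che : Pr (bern (recip m prime)) (fun S => (K - 1) * y <= `|X S|) <= 2 * (T ^+ A)^-1.
  (* Then [s * y = ln T], and the quadratic term is at most [8 e^3 ln T] because the mean is at most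
     [2 T]; [K] is chosen so that [(A + 1) * ln T] survives. *)
  pose s := Num.sqrt (ln T / T).
  have lTT0 : 0 <= ln T / T by rewrite divr_ge0 ?(ltW T0)// (le_trans ler01).
  have s0 : 0 <= s by rewrite sqrtr_ge0.
  have s2 : s ^+ 2 = ln T / T by rewrite sqr_sqrtr.
  have sy : s * y = ln T.
    rewrite /s /y -sqrtrM// (_ : ln T / T * (T * ln T) = ln T ^+ 2); last first.
      by field; rewrite gt_eqF.
    by rewrite sqrtr_sqr ger0_norm// (le_trans ler01).
  have s4 : s * 4 <= 1.
    rewrite -(@ler_pXn2r _ 2) ?nnegrE ?mulr_ge0//.
    rewrite expr1n exprMn s2 mulrAC ler_pdivrMr// mul1r.
    by move: lT16; rewrite mulrC ler_pdivlMr// !expr2; clear; lra.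
  have := gap_chernoff (recip m prime) (gap_rel z) (recip01 m prime (fun _ h => h))
     (gap_rel_lower z) (gap_rel_upper z) s ((K - 1) * y) s0 s4.
  rewrite -ESE => /le_trans; apply; rewrite ler_wpM2l// -expA ler_expR.
  have -> : s * ((K - 1) * y) = (K - 1) * ln T by rewrite -sy; ring.
  rewrite s2.
  have : e3 * (8 * ES) * (ln T / T) / 2 <= e3 * 8 * ln T.
    have -> : e3 * (8 * ES) * (ln T / T) / 2 = e3 * 8 * ln T * (ES / (2 * T)).
      by field; rewrite gt_eqF.
    rewrite ler_piMr//; first by rewrite !mulr_ge0// (le_trans ler01).
    by rewrite ler_pdivrMr ?mul1r// mulr_gt0.
  by rewrite /K -/e3; lra.
have := Pr_union (unif N) (fun i : 'I_N => K * y < `|gap_dev z N i.+1|)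
   (fun i => y < `|gap_dev z N i.+1 - Xn i|)
   (fun i => (K - 1) * y <= `|Xn i|) dU.
move=> H; apply: le_trans (H _) _; last by lra.
move=> i Hi; rewrite ltNge; case: leP => //= Hc.
have := ler_normD (gap_dev z N i.+1 - Xn i) (Xn i); rewrite subrK; clear -Hi Hc; lra.
Unshelve. all: by end_near. Qed.

End Moments.

(** * One-sided and capped normal moments *)

Section HalfMoments.
Local Open Scope classical_set_scope.
Local Open Scope ring_scope.
Context {R : realType}.
Local Notation mu := (@lebesgue_measure R).
Implicit Types x y b r : R.

(** After [y^q <= q! exp y], the inequality [y - y^2 / 2 <= 1 - y^2 / 8] keeps a quarter of the
    Gaussian exponent; the factor [y] is left to make the integral explicit. *)
Lemma pow_phi_le (q : nat) : exists2 C : R, 0 <= C &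
  forall y, 0 <= y -> y ^+ q.+1 * phi y <= C * (y * phi (2^-1 * y)).
Proof.
exists (q`!%:R * expR 1); first by rewrite mulr_ge0 ?expR_ge0.
move=> y y0; rewrite exprS -mulrA [leRHS]mulrCA ler_wpM2l//.
have yq := exprn_le_expR q y y0.
apply: le_trans (ler_wpM2r (ltW (phi_gt0 y)) yq) _.
rewrite -!mulrA ler_wpM2l// /phi mulrCA [leRHS]mulrCA ler_wpM2l ?invr_ge0 ?sqrtr_ge0//.
rewrite -!expRD ler_expR exprMn.
have : 0 <= (3 * y - 4) ^+ 2 by exact: sqr_ge0.
by rewrite !expr2; nra.
Qed.

Definition half_pow r y := y `^ r * phi y.

Definition half_moment r : R := \int[mu]_(y in `[0, +oo[) half_pow r y.

Lemma half_pow_ge0 r y : 0 <= half_pow r y.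
Proof. by rewrite mulr_ge0 ?powR_ge0// ltW ?phi_gt0. Qed.

Lemma measurable_half_pow r (A : set R) : measurable A ->
  measurable_fun A (EFin \o half_pow r).
Proof.
move=> mA; apply/measurable_EFinP/measurable_funTS/measurable_funM.
  exact: measurable_powR.
by apply: continuous_measurable_fun; exact: continuous_phi.
Qed.

Lemma powR_le_exprn r (q : nat) x : r <= q%:R -> 1 <= x -> x `^ r <= x ^+ q.
Proof.
move=> rq x1; rewrite -powR_mulrn ?ler_powR//; exact: le_trans x1.
Qed.

Lemma integrable_mul_phi_half :
  mu.-integrable `[0, +oo[ (EFin \o (fun y => y * phi (2^-1 * y))).
Proof.
apply/integrableP; split.
  apply: (measurable_EFin_continuous (fun y => y * phi (2^-1 * y))) => // y.
  apply: cvgM; first exact: cvg_id.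
  apply: (@continuous_comp _ _ _ (fun y => 2^-1 * y) phi); last exact: continuous_phi.
  exact: mulrl_continuous.
under eq_integral => y.
  rewrite inE /= in_itv/= andbT => y0.
  rewrite ger0_norm; last by rewrite mulr_ge0// ltW ?phi_gt0.
  over.
by rewrite integral_mul_phi ?ltry// invr_gt0.
Qed.

Lemma half_pow_le r : exists2 C : R, 0 <= C &
  forall y, 1 <= y -> half_pow r y <= C * (y * phi (2^-1 * y)).
Proof.
pose q := Num.truncn `|r|.
have rq : r <= q.+1%:R.
  by apply: le_trans (ler_norm r) _; rewrite ltW// truncnS_gt.
have [C C0 HC] := pow_phi_le q; exists C => // y y1.
apply: le_trans (HC y (le_trans ler01 y1)).
by rewrite ler_wpM2r ?(ltW (phi_gt0 _))// powR_le_exprn.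
Qed.

Lemma integrable_half_pow r : 0 <= r -> mu.-integrable `[0, +oo[ (EFin \o half_pow r).
Proof.
move=> r0.
have [C C0 HC] := half_pow_le r.
have J1 : mu.-integrable `[0, +oo[ (EFin \o phi) by exact: integrable_phi.
have J2 : mu.-integrable `[0, +oo[ (fun y => C%:E * (EFin \o (fun y => y * phi (2^-1 * y)%R)%R) y)%E.
  by apply: integrableZl => //; exact: integrable_mul_phi_half.
have J : mu.-integrable `[0, +oo[ ((EFin \o phi) \+ (fun y => C%:E * (EFin \o (fun y => y * phi (2^-1 * y)%R)%R) y))%E.
  exact: integrableD.
apply: (le_integrable _ _ _ J) => //; first exact: measurable_half_pow.
move=> y; rewrite /= in_itv/= andbT => y0.
rewrite lee_fin ger0_norm ?half_pow_ge0//.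
have p0 := phi_gt0 y; have q0 := phi_gt0 (2^-1 * y).
rewrite ger0_norm; last by rewrite addr_ge0 ?mulr_ge0// ltW.
have [y1|y1] := leP 1 y; first by apply: le_trans (HC y y1) _; rewrite lerDr ltW.
apply: (@le_trans _ _ (phi y)); last by rewrite lerDl !mulr_ge0// ltW.
rewrite /half_pow ler_piMl ?(ltW p0)//.
have := @ge0_ler_powR R r r0 y 1; rewrite powR1; apply; rewrite ?nnegrE//.
exact: ltW.
Qed.

Lemma half_moment_tail r : 0 <= r -> exists2 C : R, 0 <= C & forall b, 1 <= b ->
  \int[mu]_(y in `]b, +oo[) half_pow r y <= C * phi (2^-1 * b).
Proof.
move=> r0; have [C C0 HC] := half_pow_le r; exists (C * 4); first by rewrite mulr_ge0.
move=> b b1.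
have sub : (`[b, +oo[ : set R) `<=` `[0, +oo[.
  by move=> y /=; rewrite !in_itv/= !andbT; apply: le_trans; exact: le_trans b1.
have I1 : mu.-integrable `[b, +oo[ (EFin \o half_pow r).
  by apply: integrableS (integrable_half_pow r r0).
have I2 : mu.-integrable `[b, +oo[ (EFin \o (fun y => y * phi (2^-1 * y))).
  by apply: integrableS integrable_mul_phi_half.
rewrite Rintegral_itv_obnd_cbnd; last first.
  apply: integrableS I1 => // v /=; rewrite !in_itv/= !andbT; exact: ltW.
apply: (@le_trans _ _ (\int[mu]_(y in `[b, +oo[) (C * (y * phi (2^-1 * y))))).
  apply: le_Rintegral => //.
    rewrite (_ : EFin \o _ = (fun y => C%:E * (EFin \o (fun y => y * phi (2^-1 * y))%R ) y)%E)//.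
    exact: integrableZl.
  by move=> y; rewrite /= in_itv/= andbT => by_; apply: HC; exact: le_trans by_.
rewrite RintegralZl// -mulrA ler_wpM2l// /Rintegral integral_mul_phi ?invr_gt0//; last first.
  exact: le_trans b1.
by rewrite /= -exprVn invrK mulrC -natrX.
Qed.

(** The [r]th moment of a normal variable cut to [[0, b]]. Its increments in [b] are governed by
    tail probabilities alone, so distribution functions can be compared without Stieltjes
    integrals. *)
Definition capped_moment r b := \int[mu]_(y in `[0, b]) half_pow r y + b `^ r * (1 - Phi b).

Lemma half_moment_incr r x y : 0 <= r -> 0 <= x -> x <= y ->
  x `^ r * (Phi y - Phi x) <=
  \int[mu]_(v in `[0, y]) half_pow r v - \int[mu]_(v in `[0, x]) half_pow r v <=
  y `^ r * (Phi y - Phi x).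
Proof.
move=> r0 x0 xy.
have sub (b : R) : (`[0, b] : set R) `<=` `[0, +oo[.
  by move=> v /=; rewrite !in_itv/= andbT => /andP[].
have I b : mu.-integrable `[0, b] (EFin \o half_pow r).
  by apply: integrableS (integrable_half_pow r r0).
rewrite Rintegral_itvB//.
have -> : Phi y - Phi x = \int[mu]_(v in `]x, y]) phi v.
  by rewrite !PhiE Rintegral_itvB//; exact: integrable_phi.
have sub2 : (`]x, y] : set R) `<=` `[0, +oo[.
  by move=> v /=; rewrite !in_itv/= andbT => /andP[/ltW + _]; exact: le_trans.
have I2 : mu.-integrable `]x, y] (EFin \o half_pow r).
  by apply: integrableS (integrable_half_pow r r0).
have I3 (c : R) : mu.-integrable `]x, y] (EFin \o (fun v => c * phi v)).
  rewrite (_ : EFin \o _ = (fun y => c%:E * (EFin \o phi) y)%E)//.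
  by apply: integrableZl => //; exact: integrable_phi.
rewrite -!RintegralZl//; [|exact: integrable_phi|exact: integrable_phi].
apply/andP; split; apply: le_Rintegral => // v; rewrite /= in_itv/= => /andP[xv vy].
- rewrite ler_wpM2r ?(ltW (phi_gt0 _))// ge0_ler_powR ?nnegrE//; lra.
- rewrite ler_wpM2r ?(ltW (phi_gt0 _))// ge0_ler_powR ?nnegrE//; lra.
Qed.

Lemma capped_moment_incr r x y : 0 <= r -> 0 <= x -> x <= y ->
  (y `^ r - x `^ r) * (1 - Phi y) <= capped_moment r y - capped_moment r x
  <= (y `^ r - x `^ r) * (1 - Phi x).
Proof.
move=> r0 x0 xy; have /andP[a b] := half_moment_incr r x y r0 x0 xy.
by apply/andP; rewrite /capped_moment; split; lra.
Qed.

Lemma capped_moment_half r b : 0 <= r -> 0 <= b ->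
  `|half_moment r - capped_moment r b| <= \int[mu]_(y in `]b, +oo[) half_pow r y.
Proof.
move=> r0 b0.
have I := integrable_half_pow r r0.
have E : half_moment r - \int[mu]_(y in `[0, b]) half_pow r y = \int[mu]_(y in `]b, +oo[) half_pow r y.
  by rewrite /half_moment Rintegral_itvB.
have sub : (`]b, +oo[ : set R) `<=` `[0, +oo[.
  by move=> v /=; rewrite !in_itv/= !andbT => /ltW; exact: le_trans.
have J : mu.-integrable `]b, +oo[ (EFin \o half_pow r).
  by apply: integrableS I.
have le : b `^ r * (1 - Phi b) <= \int[mu]_(y in `]b, +oo[) half_pow r y.
  rewrite oneBPhi -RintegralZl//; last exact: integrable_phi.
  apply: le_Rintegral => //.
    rewrite (_ : EFin \o _ = (fun y => (b `^ r)%:E * (EFin \o phi) y)%E)//.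
    by apply: integrableZl => //; exact: integrable_phi.
  move=> v; rewrite /= in_itv/= andbT => bv.
  rewrite ler_wpM2r ?(ltW (phi_gt0 _))// ge0_ler_powR ?nnegrE//; lra.
have ge0 : 0 <= b `^ r * (1 - Phi b) by rewrite mulr_ge0 ?powR_ge0 ?subr_ge0 ?Phi_le1.
by rewrite /capped_moment ler_norml; apply/andP; split; lra.
Qed.

End HalfMoments.

(** * From distribution functions to moments *)

Section MeshComparison.
Local Open Scope classical_set_scope.
Local Open Scope ring_scope.
Context {R : realType}.

(* Telescoping over m steps of length b / m and letting m grow removes the
   term y - x. *)
Lemma mesh_bound (f D : R -> R) (d b : R) : 0 <= b ->
  (forall x y, 0 <= x -> x <= y -> `|D y - D x| <= (f y - f x) * (d + (y - x))) ->
  `|D b - D 0| <= (f b - f 0) * d.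
Proof.
move=> b0 H.
have Hm (m : nat) : `|D b - D 0| <= (f b - f 0) * (d + b / m.+1%:R).
  have step (k : nat) : `|D (k%:R * (b / m.+1%:R)) - D 0| <=
      (f (k%:R * (b / m.+1%:R)) - f 0) * (d + b / m.+1%:R).
    have h0 : 0 <= b / m.+1%:R by rewrite divr_ge0.
    elim: k => [|k IH]; first by rewrite !mul0r !subrr normr0 mul0r.
    have := H (k%:R * (b / m.+1%:R)) (k.+1%:R * (b / m.+1%:R)) (mulr_ge0 (ler0n _ k) h0).
    rewrite ler_wpM2r ?ler_nat// => /(_ isT).
    rewrite -[k.+1%:R * _ - _]mulrBl -natr1 [_ + 1]addrC addrK mul1r => h.
    have := ler_normD (D ((1 + k%:R) * (b / m.+1%:R)) - D (k%:R * (b / m.+1%:R)))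
                      (D (k%:R * (b / m.+1%:R)) - D 0).
    rewrite addrA subrK => /le_trans; apply.
    by apply: le_trans (lerD h IH) _; rewrite -mulrDl addrA subrK.
  by have := step m.+1; rewrite [m.+1%:R * _]mulrC divfK.
apply/ler_addgt0Pr => e e0.
have : exists m : nat, (f b - f 0) * b / e < m.+1%:R.
  by exists (Num.truncn ((f b - f 0) * b / e)); exact: truncnS_gt.
move=> [m]; rewrite ltr_pdivrMr// => hm.
apply: le_trans (Hm m) _; rewrite mulrDr lerD2l mulrA ler_pdivrMr//.
by rewrite ltW// (mulrC e).
Qed.

Context {T : finType}.
Variables (w : T -> R) (X : T -> R) (d : R).
Hypothesis dw : is_distr w.
Hypothesis Hd : forall t, `|Pr w (fun x => X x <= t) - Phi t| <= d.

Let cap b x := Num.min (Num.max (X x) 0) b.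

(** From cap [x] to cap [y], either moment grows by [y^r - x^r] times a number between its tail
    probabilities at [y] and at [x]. The two laws thus differ by [d] plus the variation [y - x] of
    [Phi], the form [mesh_bound] takes. *)
Lemma capped_moment_compare r b : 0 < r -> 0 <= b ->
  `|Ex w (fun x => cap b x `^ r) - capped_moment r b| <= b `^ r * d.
Proof.
move=> r0 b0.
have r00 : 0 <= r := ltW r0.
pose D b := Ex w (fun x => cap b x `^ r) - capped_moment r b.
have D0 : D 0 = 0.
  rewrite /D /capped_moment powR0 ?gt_eqF// mul0r addr0 set_itv1 Rintegral_set1 subr0.
  rewrite -[RHS](Ex_cst w 0 dw); apply: eq_Ex => x.
  by rewrite /cap min_r ?powR0 ?gt_eqF// le_max lexx orbT.
have := @mesh_bound (fun y => y `^ r) D d b b0.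
rewrite D0 powR0 ?gt_eqF// !subr0; apply => x y x0 xy.
have y0 : 0 <= y := le_trans x0 xy.
have f_le : x `^ r <= y `^ r by rewrite ge0_ler_powR.
have f0 : 0 <= y `^ r - x `^ r by rewrite subr_ge0.
have /andP[g1 g2] := capped_moment_incr r x y r00 x0 xy.
have tail t : `|Pr w (fun i => t < X i) - (1 - Phi t)| <= d.
  have -> : Pr w (fun i => t < X i) = 1 - Pr w (fun i => X i <= t).
    rewrite PrC//; congr (1 - _); apply: eq_Ex => i; by rewrite -leNgt.
  by have := Hd t; rewrite -normrN; congr (`|_| <= _); ring.
have e1 : (y `^ r - x `^ r) * Pr w (fun i => y < X i) <=
    Ex w (fun i => cap y i `^ r) - Ex w (fun i => cap x i `^ r).
  rewrite /Pr -ExZ -ExB; apply: le_Ex dw _ => i.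
  have [yX|yX] := ltP y (X i); rewrite ?mulr1 ?mulr0.
    by rewrite /cap max_l ?min_r//; lra.
  have m0 : 0 <= Num.max (X i) 0 by rewrite le_max lexx orbT.
  rewrite subr_ge0 ge0_ler_powR ?nnegrE// /cap ?le_min ?m0//.
  by rewrite !ge_min lexx/= xy orbT.
have e2 : Ex w (fun i => cap y i `^ r) - Ex w (fun i => cap x i `^ r) <=
    (y `^ r - x `^ r) * Pr w (fun i => x < X i).
  rewrite /Pr -ExZ -ExB; apply: le_Ex dw _ => i.
  have [xX|xX] := ltP x (X i); rewrite ?mulr1 ?mulr0.
    have -> : cap x i = x by rewrite /cap max_l ?min_r//; lra.
    rewrite lerD2r ge0_ler_powR ?nnegrE// /cap ?le_min ?le_max ?lexx ?orbT//.
    by rewrite ge_min lexx orbT.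
  have h : Num.max (X i) 0 <= x by rewrite ge_max xX.
  by rewrite /cap !min_l ?subrr//; exact: le_trans xy.
have := tail x; have := tail y; rewrite !ler_norml => /andP[t1 t2] /andP[t3 t4].
have pl := Phi_lip x y xy; have pm := le_Phi x y xy.
move: e1 e2 g1 g2 f0 t1 t2 t3 t4; rewrite /D.
move: (Ex w _) (Ex w _) (Pr w _) (Pr w _) (capped_moment r y) (capped_moment r x)
  (y `^ r - x `^ r) => a1 a2 p1 p2 c1 c2 f e1 e2 g1 g2 f0 t1 t2 t3 t4.
have h1 : f * (1 - Phi x) <= f * (1 - Phi y + (y - x)) by rewrite ler_wpM2l//; lra.
have h2 : f * p1 <= f * (1 - Phi x + d) by rewrite ler_wpM2l//; lra.
have h3 : f * (1 - Phi y - d) <= f * p2 by rewrite ler_wpM2l//; lra.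
by apply/andP; split; lra.
Qed.

Lemma half_moment_compare r b : 0 < r -> 0 <= b ->
  `|Ex w (fun x => Num.max (X x) 0 `^ r) - half_moment r| <=
  b `^ r * d + Ex w (fun x => `|X x| `^ r * (b < `|X x|)%R%:R) +
  \int[lebesgue_measure]_(y in `]b, +oo[) half_pow r y.
Proof.
move=> r0 b0.
have h1 := capped_moment_compare r b r0 b0.
have h2 := capped_moment_half r b (ltW r0) b0.
have h3 : `|Ex w (fun x => Num.max (X x) 0 `^ r) - Ex w (fun x => cap b x `^ r)| <=
    Ex w (fun x => `|X x| `^ r * (b < `|X x|)%R%:R).
  rewrite -ExB; apply: norm_Ex dw _ => x.
  have m0 : 0 <= Num.max (X x) 0 by rewrite le_max lexx orbT.
  have [Xb|Xb] := leP (Num.max (X x) 0) b.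
    by rewrite /cap min_l// subrr normr0 mulr_ge0 ?powR_ge0.
  rewrite /cap min_r ?(ltW Xb)//.
  have XX : Num.max (X x) 0 = X x.
    by move: Xb; rewrite lt_max => /orP[bX|]; [rewrite max_l//; lra|rewrite ltNge b0].
  rewrite XX in Xb m0 *; rewrite (ger0_norm m0) Xb mulr1 ger0_norm ?subr_ge0.
    by rewrite gerBl powR_ge0.
  by rewrite ge0_ler_powR ?nnegrE ?(ltW r0) ?(ltW Xb).
move: h1 h2 h3; rewrite !ler_norml => /andP[? ?] /andP[? ?] /andP[? ?].
by apply/andP; split; lra.
Qed.

(** Gives access to the negative part. Reflection produces a strict inequality, which is approached
    from below using the continuity of [Phi]. *)
Lemma cdf_approxN t : `|Pr w (fun x => - X x <= t) - Phi t| <= d.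
Proof.
have E : Pr w (fun x => - X x <= t) = 1 - Pr w (fun x => X x < - t).
  rewrite PrC//; congr (1 - _); apply: eq_Ex => x.
  by rewrite -ltNge ltrNr.
have Et : Phi t = 1 - Phi (- t) by rewrite PhiN; ring.
have up : Pr w (fun x => X x < - t) <= Phi (- t) + d.
  have := Hd (- t); rewrite ler_norml => /andP[_].
  have := le_Pr w (fun x => X x < - t) (fun x => X x <= - t) dw (fun x => @ltW _ _ _ _).
  by lra.
have lo : Phi (- t) - d <= Pr w (fun x => X x < - t).
  apply/ler_addgt0Pr => e e0.
  have := Hd (- t - e); rewrite ler_norml => /andP[+ _].
  have : Pr w (fun x => X x <= - t - e) <= Pr w (fun x => X x < - t).
    by apply: le_Pr dw _ => x; lra.
  have := Phi_lip (- t - e) (- t); rewrite opprB addrCA subrr addr0; lra.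
by rewrite ler_norml; apply/andP; split; lra.
Qed.

End MeshComparison.

(** * Evaluation of the normal moments *)

Section NormalMoments.
Local Open Scope classical_set_scope.
Local Open Scope ring_scope.
Context {R : realType}.
Local Notation mu := (@lebesgue_measure R).

Lemma half_moment_fin r : 0 <= r ->
  (\int[mu]_(y in `[0%R, +oo[) (half_pow r y)%:E = (half_moment r)%:E)%E.
Proof.
move=> r0; rewrite /half_moment /Rintegral fineK//.
by apply: integrable_fin_num => //; exact: integrable_half_pow.
Qed.

Let abs_pow (r : nat) (y : R) := `|y| ^+ r * phi y.

Let abs_pow_half (r : nat) (y : R) : 0 <= y -> abs_pow r y = half_pow r%:R y.
Proof. by move=> y0; rewrite /abs_pow /half_pow powR_mulrn// ger0_norm. Qed.

Let abs_pow_ge0 (r : nat) (y : R) : 0 <= abs_pow r y.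
Proof. by rewrite mulr_ge0 ?exprn_ge0// ltW ?phi_gt0. Qed.

Let continuous_abs_pow (r : nat) : continuous (abs_pow r).
Proof.
move=> y; apply: cvgM; last exact: continuous_phi.
have c : continuous (fun x : R => x ^+ r) by exact: exprn_continuous.
by apply: (@continuous_comp _ _ _ (fun y : R => `|y|) (fun x => x ^+ r)); [exact: norm_continuous|exact: c].
Qed.

Let integral_abs_pow (r : nat) :
  (\int[mu]_y (abs_pow r y)%:E = (2 * half_moment r%:R)%:E)%E.
Proof.
rewrite ge0_symfun_integralT//.
- rewrite EFinM -half_moment_fin// -set_itvcy; congr (_ * _)%E.
  apply: eq_integral => y; rewrite inE /= in_itv/= andbT => y0.
  by rewrite abs_pow_half.
- by move=> y; rewrite /abs_pow /= normrN phiN.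
Qed.

Lemma normal_momentE (r : nat) :
  normal_moment r = (1 + (-1) ^+ r) * half_moment r%:R :> R.
Proof.
have mF : measurable_fun setT (EFin \o abs_pow r).
  by apply: measurable_EFin_continuous => //; exact: continuous_abs_pow.
have IF : mu.-integrable setT (EFin \o abs_pow r).
  apply/integrableP; split => //.
  under eq_integral do rewrite /= ger0_norm//.
  by rewrite integral_abs_pow ltry.
pose g (y : R) := y ^+ r * phi y.
have Ig : mu.-integrable setT (EFin \o g).
  apply: (le_integrable _ _ _ IF) => //.
    apply: measurable_EFin_continuous => // y.
    by apply: cvgM; [exact: exprn_continuous|exact: continuous_phi].
  by move=> y _; rewrite /= lee_fin /g /abs_pow !normrM !normrX normr_id.
have IgA (A : set R) : measurable A -> mu.-integrable A (EFin \o g).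
  by move=> mA; exact: integrableS Ig.
have IFA (A : set R) : measurable A -> mu.-integrable A (EFin \o abs_pow r).
  by move=> mA; exact: integrableS IF.
have E1 : normal_moment r = \int[mu]_y g y.
  rewrite /normal_moment -RintegralZl//.
    by apply: eq_Rintegral => y _; rewrite /g /phi; ring.
  have s0 : Num.sqrt (2 * pi) != 0 :> R.
    by rewrite gt_eqF// (lt_le_trans ltr01 sqrt2pi_ge1).
  rewrite (_ : EFin \o _ = (fun y => (Num.sqrt (2 * pi))%:E * (EFin \o g) y)%E).
    exact: integrableZl.
  by apply/funext => y /=; rewrite -EFinM /g /phi mulrCA mulVKf.
have U : [set: R] = `[0, +oo[ `|` `]-oo, 0[.
  apply/seteqP; split => // y _ /=; rewrite !in_itv/= andbT.
  by case: (leP 0 y); [left|right].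
have dis : [disjoint (`[0, +oo[ : set R) & `]-oo, 0[].
  apply/disj_setPS => y /=; rewrite !in_itv/= andbT => -[h1 h2].
  by move: h2; rewrite ltNge h1.
have hg : \int[mu]_(y in `[0, +oo[) g y = half_moment r%:R.
  apply: eq_Rintegral => y; rewrite inE /= in_itv/= andbT => y0.
  by rewrite -abs_pow_half// /abs_pow /g ger0_norm.
have hF : \int[mu]_(y in `[0, +oo[) abs_pow r y = half_moment r%:R.
  apply: eq_Rintegral => y; rewrite inE /= in_itv/= andbT => y0.
  by rewrite -abs_pow_half.
have negF : \int[mu]_(y in `]-oo, 0[) abs_pow r y = half_moment r%:R.
  have : \int[mu]_y abs_pow r y = 2 * half_moment r%:R.
    by rewrite /Rintegral integral_abs_pow.
  rewrite U Rintegral_setU -?U// hF; lra.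
rewrite E1 U Rintegral_setU -?U// hg mulrDl mul1r; congr (_ + _).
rewrite -[in RHS]negF -RintegralZl//; last exact: IFA.
apply: eq_Rintegral => y; rewrite inE /= in_itv/= => y0.
by rewrite /g /abs_pow (ltr0_norm y0) (exprNn y) !mulrA -exprD -signr_odd addnn odd_double expr0 mul1r.
Qed.

Let square_half (y : R) := y ^+ 2 / 2.

Let is_derive_square_half (y : R) : is_derive y (1:R) square_half y.
Proof.
have -> : square_half = (2^-1 : R) *: (id ^+ 2).
  by apply/funext => v; rewrite !fctE /GRing.scale/= mulrC.
by apply: is_derive_eq; rewrite /GRing.scale/=; field.
Qed.

Let gamma_kernel_substitution (r y : R) : 0 < y ->
  (y ^+ 2 / 2) `^ (r / 2 + 1 / 2 - 1) * expR (- (y ^+ 2 / 2)) * y =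
  2 `^ (2^-1 - r / 2) * Num.sqrt (2 * pi) * half_pow r y.
Proof.
move=> y0.
have s0 : 0 < Num.sqrt (2 * pi) :> R by rewrite (lt_le_trans ltr01 sqrt2pi_ge1).
have h : 0 < y ^+ 2 / 2 by rewrite divr_gt0// exprn_gt0.
have lh : exp.ln (y ^+ 2 / 2) = 2 * exp.ln y - exp.ln 2.
  by rewrite ln_div ?posrE ?exprn_gt0// lnXn// mulr_natl.
rewrite /half_pow /phi /powR !gt_eqF// lh.
rewrite -[X in _ * X = _]lnK ?posrE//.
rewrite (_ : _ * _ * (_ * _) = expR ((2^-1 - r / 2) * exp.ln 2) * expR (r * exp.ln y) *
   expR (- (y ^+ 2 / 2)) * (Num.sqrt (2 * pi) / Num.sqrt (2 * pi))); last by ring.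
rewrite divff ?gt_eqF// mulr1 -!expRD; congr expR.
by field.
Qed.

(** Substitution [x = y^2 / 2]. Staying away from 0 avoids the possible singularity of the power;
    the half-line is recovered by exhaustion with intervals [[1 / n, n]]. *)
Lemma gamma_interval_substitution (r a b : R) : 0 < a -> a <= b ->
  (\int[mu]_(x in `[(a ^+ 2 / 2)%R, (b ^+ 2 / 2)%R]) (x `^ (r / 2 + 1 / 2 - 1) * expR (- x))%:E =
   (2 `^ (2^-1 - r / 2) * Num.sqrt (2 * pi))%:E *
   \int[mu]_(y in `[a, b]) (half_pow r y)%:E)%E.
Proof.
move=> a0 ab.
have dE : derive1 square_half = id.
  by apply/funext => y; rewrite derive1E; case: (is_derive_square_half y).
have cs : continuous square_half := is_derive_continuous is_derive_square_half.
rewrite -/(square_half a) -/(square_half b) (@integration_by_substitution_increasing _ square_half)//.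
- rewrite -ge0_integralZl//.
  + apply: eq_integral => y; rewrite inE /= in_itv/= => /andP[ay _].
    rewrite -EFinM dE; congr EFin; rewrite /square_half.
    exact: gamma_kernel_substitution (lt_le_trans a0 ay).
  + exact: measurable_half_pow.
  + by move=> y _; rewrite lee_fin half_pow_ge0.
- move=> x y; rewrite !in_itv/= => /andP[ax _] /andP[ay _] xy.
  rewrite /square_half ltr_pM2r ?invr_gt0// ltrXn2r//; lra.
- by move=> y _; rewrite dE; exact: cvg_id.
- by rewrite dE; apply/cvg_ex; exists a; apply: cvg_at_right_filter; exact: cvg_id.
- by rewrite dE; apply/cvg_ex; exists b; apply: cvg_at_left_filter; exact: cvg_id.
- split.
  + by move=> y _; case: (is_derive_square_half y).
  + by apply: cvg_at_right_filter; exact: cs.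
  + by apply: cvg_at_left_filter; exact: cs.
- apply: continuous_in_subspaceT => x; rewrite inE /= in_itv/= => /andP[ax _].
  have x0 : 0 < x by apply: lt_le_trans ax; rewrite divr_gt0// exprn_gt0.
  apply: cvgM.
    have d : derivable (fun x : R => x `^ (r / 2 + 1 / 2 - 1)) x 1.
      by apply: derivable_powR; rewrite in_itv/= x0.
    exact: (differentiable_continuous (proj1 (derivable1_diffP _ _) d)).
  by apply: continuous_comp; [exact: opp_continuous|exact: continuous_expR].
Qed.

Let ge0_integral_pos (f : R -> R) (a b : nat -> R) :
  (forall y, 0 <= f y) -> measurable_fun [set: R] f ->
  (forall n, 0 < a n) -> (forall m n, (m <= n)%N -> a n <= a m /\ b m <= b n) ->
  (forall y, 0 < y -> exists n, a n <= y <= b n) ->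
  (\int[mu]_(y in `[a n, b n]) (f y)%:E @[n --> \oo] -->
   \int[mu]_(y in `]0%R, +oo[) (f y)%:E)%E.
Proof.
move=> f0 mf a0 ab cov.
have -> : [set` `]0, +oo[] = \bigcup_n [set` `[a n, b n]] :> set R.
  apply/seteqP; split => y /=.
    by rewrite in_itv/= andbT => /cov[n nab]; exists n => //=; rewrite in_itv.
  by move=> [n _] /=; rewrite !in_itv/= andbT => /andP[+ _]; exact: lt_le_trans.
apply: ge0_nondecreasing_set_cvg_integral => //.
- move=> m n mn; apply/subsetPset => y /=; rewrite !in_itv/= => /andP[h1 h2].
  by have [h3 h4] := ab m n mn; rewrite (le_trans h3 h1) (le_trans h2 h4).
- by move=> n; apply/measurable_EFinP; exact: measurable_funTS.
- by move=> n y _; rewrite lee_fin.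
Qed.

Lemma Gamma_half_moment (r : R) : 0 <= r ->
  Gamma (r / 2 + 1 / 2) = 2 `^ (2^-1 - r / 2) * Num.sqrt (2 * pi) * half_moment r.
Proof.
move=> r0; set c := _ * Num.sqrt _.
pose a (n : nat) : R := n.+1%:R^-1.
pose b (n : nat) : R := n.+1%:R.
have a0 n : 0 < a n by rewrite /a invr_gt0.
have b1 n : 1 <= b n by rewrite ler1n.
have am m n : (m <= n)%N -> a n <= a m by move=> mn; rewrite lef_pV2 ?posrE// ler_nat.
have bm m n : (m <= n)%N -> b m <= b n by move=> mn; rewrite ler_nat.
have cov y : 0 < y -> exists n, a n <= y <= b n.
  move=> y0; exists (Num.truncn (y + y^-1)).
  have := truncnS_gt (y + y^-1); rewrite -/(b _) => h.
  have y'0 : 0 < y^-1 by rewrite invr_gt0.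
  apply/andP; split; last by lra.
  by rewrite /a invf_ple ?posrE// -/(b _); lra.
have S n : (\int[mu]_(x in `[(a n ^+ 2 / 2)%R, (b n ^+ 2 / 2)%R])
    (x `^ (r / 2 + 1 / 2 - 1) * expR (- x))%:E =
   c%:E * \int[mu]_(y in `[a n, b n]) (half_pow r y)%:E)%E.
  apply: gamma_interval_substitution => //; apply: le_trans (b1 n).
  by rewrite invf_le1// ler1n.
have L1 := @ge0_integral_pos (fun x => x `^ (r / 2 + 1 / 2 - 1) * expR (- x))
   (fun n => a n ^+ 2 / 2) (fun n => b n ^+ 2 / 2).
have sq (x y : R) : 0 <= x -> x <= y -> x ^+ 2 / 2 <= y ^+ 2 / 2.
  by move=> x0 xy; rewrite ler_pM2r ?invr_gt0// lerXn2r ?nnegrE//; lra.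
have {}L1 : (\int[mu]_(x in `[(a n ^+ 2 / 2)%R, (b n ^+ 2 / 2)%R])
    (x `^ (r / 2 + 1 / 2 - 1) * expR (- x))%:E @[n --> \oo] -->
    \int[mu]_(x in `]0%R, +oo[) (x `^ (r / 2 + 1 / 2 - 1) * expR (- x))%:E)%E.
  apply: L1.
  - by move=> y; rewrite mulr_ge0 ?powR_ge0 ?expR_ge0.
  - apply: measurable_funM; first exact: measurable_powR.
    by apply: continuous_measurable_fun => x; apply: continuous_comp; [exact: opp_continuous|exact: continuous_expR].
  - by move=> n; rewrite divr_gt0// exprn_gt0.
  - move=> m n mn; split; apply: sq; [exact/ltW|exact: am|exact: le_trans (b1 m)|exact: bm].
  - move=> y y0; have t0 : 0 < Num.sqrt (2 * y) by rewrite sqrtr_gt0 mulr_gt0.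
    have [n /andP[h1 h2]] := cov _ t0; exists n.
    have -> : y = Num.sqrt (2 * y) ^+ 2 / 2.
      by rewrite sqr_sqrtr ?mulr_ge0// ?(ltW y0)//; field.
    by rewrite !sq// ltW.
have L2 : (\int[mu]_(y in `[a n, b n]) (half_pow r y)%:E @[n --> \oo] -->
   \int[mu]_(y in `]0%R, +oo[) (half_pow r y)%:E)%E.
  apply: ge0_integral_pos => //.
  - exact: half_pow_ge0.
  - by apply/measurable_EFinP; exact: measurable_half_pow.
  - by move=> m n mn; split; [exact: am|exact: bm].
have cE : (\int[mu]_(y in `]0%R, +oo[) (half_pow r y)%:E = (half_moment r)%:E)%E.
  rewrite -half_moment_fin// integral_itv_obnd_cbnd//; exact: measurable_half_pow.
rewrite cE in L2.
have L3 : (c%:E * \int[mu]_(y in `[a n, b n]) (half_pow r y)%:E @[n --> \oo] -->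
   c%:E * (half_moment r)%:E)%E by exact: cvgeZl.
rewrite (eq_cvg _ _ S) in L1.
by rewrite /Gamma /Rintegral (cvg_unique _ L1 L3).
Qed.

Lemma Gamma_half_momentE (r : R) : 0 <= r ->
  2 `^ (r / 2) * Gamma (r / 2 + 1 / 2) / Num.sqrt pi = 2 * half_moment r.
Proof.
move=> r0; rewrite Gamma_half_moment// sqrtrM//.
have p0 : Num.sqrt (pi : R) != 0 by rewrite gt_eqF// sqrtr_gt0 pi_gt0.
have e : 2 `^ (r / 2) * 2 `^ (2^-1 - r / 2) = Num.sqrt 2 :> R.
  by rewrite -powRD ?pnatr_eq0 ?implybT// addrC subrK powR12_sqrt.
have e2 : Num.sqrt 2 * Num.sqrt 2 = 2 :> R by rewrite -expr2 sqr_sqrtr.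
rewrite -[in RHS]e2 -[in X in _ = X * _ * _]e; field.
exact: p0.
Qed.

End NormalMoments.

(** * Moments of the gap count *)

Section MomentAsymptotics.
Context {R : realType}.
Variable z : R.
Hypothesis z0 : 0 <= z.
Local Notation ln := (@ln R).
Local Notation mu := (@lebesgue_measure R).

Let normalized (T : R) (N : nat) (i : 'I_N) : R :=
  gap_dev z N i.+1 / Num.sqrt (gamma z * T).

Definition moment_rate (r T : R) := ln T `^ (1 + r / 2) / Num.sqrt T.

Lemma invr_le_rate (r T : R) : 0 <= r -> 1 <= T -> 1 <= ln T -> T^-1 <= moment_rate r T.
Proof.
move=> r0 T1 lT1; rewrite /moment_rate.
have T0 : 0 < T by lra.
have s0 : 0 < Num.sqrt T by rewrite sqrtr_gt0.
have ts : T = Num.sqrt T ^+ 2 by rewrite sqr_sqrtr// ltW.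
have sT : Num.sqrt T <= T.
  by rewrite [leRHS]ts expr2 ler_pMr// -[leLHS]sqrtr1 ler_wsqrtr.
apply: (@le_trans _ _ (Num.sqrt T)^-1); first by rewrite lef_pV2 ?posrE.
rewrite ler_peMl ?invr_ge0 ?(ltW s0)//.
have := ler_powR lT1 (_ : 0 <= 1 + r / 2); rewrite powRr0; apply.
by rewrite addr_ge0// divr_ge0.
Qed.

(** The crude moment of order [2 q] exceeds the true order by a factor [T^q]; a tail probability of
    sufficiently high polynomial decay compensates for it. *)
Lemma truncated_moment_asym (r : R) : 0 < r -> exists K C : R,
  [/\ 4 <= K, 0 <= C & \forall T \near +oo, forall N : nat, T = ln (ln N%:R) ->
  Ex (@unif R N) (fun i => `|normalized T N i| `^ r *
     (K / Num.sqrt (gamma z) * Num.sqrt (ln T) < `|normalized T N i|)%R%:R) <= C / T].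
Proof.
move=> r0.
pose q := (Num.truncn r).+1.
have rq : r <= q%:R by rewrite ltW// truncnS_gt.
(* With weight [eta = T^-(q+1)] the moment term becomes [T^(q-q-1)] and the tail term [T^(q+1-q-2)],
   so both are of order [1 / T]. *)
have [K K0 HK] := tail_asym z z0 q.+2.
have [C C0 HC] := gap_dev_moment z z0 (2 * q).
have /andP[g0 g1] := gamma_bounds z z0.
exists (K + 4), (C / gamma z ^+ q + 4); split; first by lra.
  by rewrite addr_ge0// divr_ge0// exprn_ge0// ltW.
apply: filterS3 (near_ln_ge 1) HK HC => T lT1 hK hC N TE.
have {hK hC} [hK hC] := (hK N TE, hC N TE).
have T1 := ge1_of_ln T lT1.
have T0 : 0 < T by lra.
have [N0 _ _] := ln_ln_natE N T T0 TE.
have dU : is_distr (@unif R N) := unif_distr N N0.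
set s := Num.sqrt (gamma z * T).
have s0 : 0 < s by rewrite sqrtr_gt0 mulr_gt0.
have s2 : s ^+ 2 = gamma z * T by rewrite sqr_sqrtr// mulr_ge0// ltW.
set b := _ * Num.sqrt (ln T).
have sg0 : 0 < Num.sqrt (gamma z) by rewrite sqrtr_gt0.
have sg1 : Num.sqrt (gamma z) <= 1 by rewrite -sqrtr1 ler_wsqrtr.
have sl1 : 1 <= Num.sqrt (ln T) by rewrite -sqrtr1 ler_wsqrtr.
have bs : b * s = (K + 4) * Num.sqrt (T * ln T).
  rewrite /b /s (sqrtrM T (ltW g0)) (sqrtrM (ln T) (ltW T0)); field.
  by rewrite gt_eqF.
have b1 : 1 <= b.
  rewrite /b mulrAC ler_pdivlMr// mul1r; apply: le_trans sg1 _.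
  by rewrite -[leLHS]mulr1 ler_pM//; lra.
(* AM-GM: 2 v <= eta v^2 + 1 / eta, applied to v = |X|^q on the tail event. *)
pose eta : R := (T ^+ q.+1)^-1.
have e0 : 0 < eta by rewrite invr_gt0 exprn_gt0.
apply: (@le_trans _ _ (Ex (unif N) (fun i =>
   (eta / s ^+ (2 * q)) * `|gap_dev z N i.+1| ^+ (2 * q) +
   eta^-1 * (K * Num.sqrt (T * ln T) < `|gap_dev z N i.+1|)%R%:R))).
  apply: le_Ex dU _ => i.
  have -> : eta / s ^+ (2 * q) * `|gap_dev z N i.+1| ^+ (2 * q) =
     eta * (`|normalized T N i| ^+ q) ^+ 2.
    by rewrite /normalized -/s -exprM mulnC normrM normfV (ger0_norm (ltW s0)) exprMn exprVn; ring.
  have [bX|bX] := ltP b `|normalized T N i|; last first.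
    by rewrite mulr0 addr_ge0// mulr_ge0 ?exprn_ge0 ?invr_ge0 ?ler0n ?(ltW e0)// exprn_ge0// ltW.
  have -> : K * Num.sqrt (T * ln T) < `|gap_dev z N i.+1|.
    have : b * s < `|gap_dev z N i.+1|.
      by move: bX; rewrite /normalized -/s normrM normfV (ger0_norm (ltW s0)) ltr_pdivlMr.
    have : 0 <= Num.sqrt (T * ln T) by rewrite sqrtr_ge0.
    by rewrite bs; lra.
  rewrite !mulr1; apply: le_trans (powR_le_exprn _ _ _ rq _) _; first lra.
  move: (_ ^+ q) => v.
  have : 0 <= eta * (v - eta^-1) ^+ 2 by rewrite mulr_ge0 ?sqr_ge0// ltW.
  have : eta * eta^-1 = 1 by rewrite divff// gt_eqF.
  have : 0 < eta^-1 by rewrite invr_gt0.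
  rewrite !expr2; move: eta^-1 => w w0 ew.
  have -> : eta * ((v - w) * (v - w)) = eta * (v * v) - 2 * v * (eta * w) + w * (eta * w) by ring.
  have : 0 <= eta * (v * v) by rewrite mulr_ge0 ?(ltW e0)// -expr2 sqr_ge0.
  by rewrite ew; lra.
rewrite ExD !ExZ -/(Pr _ _).
apply: (@le_trans _ _ (eta / s ^+ (2 * q) * (C * T ^+ (2 * q)) + eta^-1 * (4 * (T ^+ q.+2)^-1))).
  apply: lerD; rewrite ler_wpM2l// ?invr_ge0 ?(ltW e0)// ?exprn_ge0 ?(ltW T0)//.
  by rewrite divr_ge0 ?exprn_ge0// ltW.
rewrite exprM s2 exprMn [leRHS]mulrDl; apply: lerD.
  rewrite /eta exprS mul2n -addnn exprD le_eqVlt; apply/orP; left; apply/eqP.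
  by field; rewrite !gt_eqF// exprn_gt0.
rewrite /eta invrK !exprS le_eqVlt; apply/orP; left; apply/eqP.
by field; rewrite !gt_eqF// exprn_gt0.
Qed.

Lemma half_moment_asym (r : R) : 0 < r -> exists2 C : R, 0 <= C &
  \forall T \near +oo, forall N : nat, T = ln (ln N%:R) ->
  `|Ex (@unif R N) (fun i => Num.max (normalized T N i) 0 `^ r) - half_moment r|
    <= C * moment_rate r T /\
  `|Ex (@unif R N) (fun i => Num.max (- normalized T N i) 0 `^ r) - half_moment r|
    <= C * moment_rate r T.
Proof.
move=> r0.
have [C1 C10 H1] := dist_asym z z0.
have [K [C2 [K4 C20 H2]]] := truncated_moment_asym r r0.
have [C3 C30 H3] := half_moment_tail r (ltW r0).
have /andP[g0 g1] := gamma_bounds z z0.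
have sg0 : 0 < Num.sqrt (gamma z) by rewrite sqrtr_gt0.
have sg1 : Num.sqrt (gamma z) <= 1 by rewrite -sqrtr1 ler_wsqrtr.
pose k := K / Num.sqrt (gamma z).
have k4 : 4 <= k by rewrite /k ler_pdivlMr//; nra.
exists (k `^ r * C1 + C2 + C3); first by rewrite !addr_ge0 ?mulr_ge0 ?powR_ge0.
apply: filterS3 (near_ln_ge 1) H1 H2 => T lT1 h1 h2 N TE.
have {h1 h2} [h1 h2] := (h1 N TE, h2 N TE).
have T1 := ge1_of_ln T lT1.
have T0 : 0 < T by lra.
have [N0 _ _] := ln_ln_natE N T T0 TE.
have dU : is_distr (@unif R N) := unif_distr N N0.
have s0 : 0 < Num.sqrt (gamma z * T) by rewrite sqrtr_gt0 mulr_gt0.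
have Hd t : `|Pr (@unif R N) (fun i => normalized T N i <= t) - Phi t| <= C1 * (ln T / Num.sqrt T).
  apply: le_trans (h1 t); rewrite le_eqVlt; apply/orP; left; apply/eqP.
  congr (`|_ - _|); apply: eq_Ex => i.
  by rewrite /normalized ler_pdivrMr.
set b := k * Num.sqrt (ln T) in h2.
have sl1 : 1 <= Num.sqrt (ln T) by rewrite -sqrtr1 ler_wsqrtr.
have b4 : 4 * Num.sqrt (ln T) <= b by rewrite /b ler_wpM2r// sqrtr_ge0.
have b1 : 1 <= b by lra.
have iT : T^-1 <= moment_rate r T := invr_le_rate r T (ltW r0) T1 lT1.
(* Here [4 <= K] is used: [b^2 / 8 >= 2 ln T], so the normal tail beyond [b] is below [1 / T]. *)
have hphi : C3 * phi (2^-1 * b) <= C3 * moment_rate r T.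
  rewrite ler_wpM2l//; apply: le_trans iT; apply: le_trans (phi_le _) _.
  rewrite -[T in leRHS]lnK ?posrE// -expRN ler_expR lerN2.
  have : (4 * Num.sqrt (ln T)) ^+ 2 <= b ^+ 2 by rewrite lerXn2r ?nnegrE//; lra.
  rewrite [X in X <= _]exprMn sqr_sqrtr; last lra.
  by rewrite !expr2; lra.
(* Capping at a multiple of [sqrt (ln T)] multiplies the distance by [(ln T)^(r/2)]: this is the
   dominant error. *)
have hb : b `^ r * (C1 * (ln T / Num.sqrt T)) = k `^ r * C1 * moment_rate r T.
  rewrite /b powRM ?sqrtr_ge0//; last by lra.
  rewrite /moment_rate powRD; last by rewrite gt_eqF ?implybT//; lra.
  rewrite powRr1; last by lra.
  rewrite -powR12_sqrt; last by lra.
  by rewrite -powRrM mulrC [r / 2]mulrC; ring.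
have fin (X : 'I_N -> R) : (forall i, `|X i| = `|normalized T N i|) ->
   (forall t, `|Pr (@unif R N) (fun i => X i <= t) - Phi t| <= C1 * (ln T / Num.sqrt T)) ->
   `|Ex (@unif R N) (fun i => Num.max (X i) 0 `^ r) - half_moment r|
    <= (k `^ r * C1 + C2 + C3) * moment_rate r T.
  move=> HX HXd.
  apply: le_trans (half_moment_compare _ _ _ dU HXd r b r0 (le_trans ler01 b1)) _.
  rewrite hb !mulrDl; apply: lerD; last exact: le_trans (H3 b b1) hphi.
  rewrite lerD2l; apply: (@le_trans _ _ (C2 / T)); last by rewrite ler_wpM2l.
  by under eq_Ex do rewrite HX.
split; first exact: fin.
by apply: fin => [i|t]; [rewrite normrN|exact: cdf_approxN].
Qed.

Lemma half_moment0 : 2 * half_moment 0 = 1 :> R.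
Proof.
have := @normal_momentE R 0; rewrite expr0 => <-.
rewrite /normal_moment -RintegralZl//; last first.
  rewrite (_ : (fun x => _) = (fun y => expR (- (y ^+ 2 / 2)))).
    exact: integrable_expR_sq.
  by apply/funext => y; rewrite expr0 mul1r.
by apply: etrans integral_phi; apply: eq_Rintegral => y _; rewrite expr0 mul1r.
Qed.

(** The power splits into those of the positive and negative parts, with sign [(-1)^r]. The case
    [r = 0] is apart, since [0 ^+ 0 = 1] makes both parts contribute 1. *)
Lemma moment_asym (r : nat) : exists2 C : R, 0 <= C &
  \forall T \near +oo, forall N : nat, T = ln (ln N%:R) ->
  exists2 e : R, `|e| <= C * moment_rate r%:R T &
    Ex (@unif R N) (fun i => gap_dev z N i.+1 ^+ r) =
    (gamma z * T) `^ (r%:R / 2) * (normal_moment r + e).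
Proof.
case: r => [|r].
  exists 0 => //; near=> T => N TE.
  have T0 : 0 < T by near: T; exact: nbhs_pinfty_gt.
  have [N0 _ _] := ln_ln_natE N T T0 TE.
  exists 0; first by rewrite normr0 mul0r.
  rewrite normal_momentE expr0 half_moment0 addr0 mulr1 mul0r powRr0.
  by rewrite -[RHS](Ex_cst (@unif R N) 1 (unif_distr N N0)); apply: eq_Ex => i; rewrite expr0.
have r0 : 0 < r.+1%:R :> R by rewrite ltr0n.
have [C C0 H] := half_moment_asym r.+1%:R r0.
have /andP[g0 g1] := gamma_bounds z z0.
exists (2 * C); first by rewrite mulr_ge0.
apply: filterS2 (near_ge 1) H => T T1 h N TE; have {h} [h1 h2] := h N TE.
have gT : 0 < gamma z * T by rewrite mulr_gt0//; lra.
set s := Num.sqrt (gamma z * T).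
have s0 : 0 < s by rewrite sqrtr_gt0.
have -> : (gamma z * T) `^ (r.+1%:R / 2) = s ^+ r.+1.
  by rewrite /s -powR12_sqrt ?(ltW gT)// -powR_mulrn ?powR_ge0// -powRrM [_ / 2]mulrC.
set a := Ex _ _ in h1; set b := Ex _ _ in h2.
have E : Ex (@unif R N) (fun i => gap_dev z N i.+1 ^+ r.+1) = s ^+ r.+1 * (a + (-1) ^+ r.+1 * b).
  rewrite -ExZ -ExD -ExZ; apply: eq_Ex => i.
  rewrite !powR_mulrn ?le_max ?lexx ?orbT//.
  have {1}-> : gap_dev z N i.+1 = s * normalized T N i.
    by rewrite /normalized -/s mulrC divfK// gt_eqF.
  rewrite exprMn; congr (_ * _).
  have [x0|x0] := leP 0 (normalized T N i).
    rewrite max_r ?oppr_le0// expr0n /= mulr0 addr0//.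
  rewrite max_l ?oppr_ge0 ?(ltW x0)// expr0n add0r.
  by rewrite -exprMn mulN1r opprK.
exists (a + (-1) ^+ r.+1 * b - normal_moment r.+1); last by rewrite E; congr (_ * _); ring.
have -> : a + (-1) ^+ r.+1 * b - normal_moment r.+1 =
    (a - half_moment r.+1%:R) + (-1) ^+ r.+1 * (b - half_moment r.+1%:R).
  by rewrite normal_momentE; ring.
apply: le_trans (ler_normD _ _) _; rewrite normrM normrX normrN1 expr1n mul1r.
by rewrite -mulrA mulr_natl mulr2n lerD.
Unshelve. all: by end_near. Qed.

Lemma abs_moment_asym (r : R) : 0 <= r -> exists2 C : R, 0 <= C &
  \forall T \near +oo, forall N : nat, T = ln (ln N%:R) ->
  exists2 e : R, `|e| <= C * moment_rate r T &
    Ex (@unif R N) (fun i => `|gap_dev z N i.+1| `^ r) =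
    (gamma z * T) `^ (r / 2) * (2 * half_moment r + e).
Proof.
rewrite le_eqVlt => /predU1P[<-|r0].
  exists 0 => //; near=> T => N TE.
  have T0 : 0 < T by near: T; exact: nbhs_pinfty_gt.
  have [N0 _ _] := ln_ln_natE N T T0 TE.
  exists 0; first by rewrite normr0 mul0r.
  rewrite half_moment0 addr0 mulr1 mul0r powRr0.
  by rewrite -[RHS](Ex_cst (@unif R N) 1 (unif_distr N N0)); apply: eq_Ex => i; rewrite powRr0.
have [C C0 H] := half_moment_asym r r0.
have /andP[g0 g1] := gamma_bounds z z0.
exists (2 * C); first by rewrite mulr_ge0.
apply: filterS2 (near_ge 1) H => T T1 h N TE; have {h} [h1 h2] := h N TE.
have gT : 0 < gamma z * T by rewrite mulr_gt0//; lra.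
set s := Num.sqrt (gamma z * T).
have s0 : 0 < s by rewrite sqrtr_gt0.
have -> : (gamma z * T) `^ (r / 2) = s `^ r.
  by rewrite /s -powR12_sqrt ?(ltW gT)// -powRrM [_ / 2]mulrC.
set a := Ex _ _ in h1; set b := Ex _ _ in h2.
have E : Ex (@unif R N) (fun i => `|gap_dev z N i.+1| `^ r) = s `^ r * (a + b).
  rewrite -ExD -ExZ; apply: eq_Ex => i.
  have {1}-> : gap_dev z N i.+1 = s * normalized T N i.
    by rewrite /normalized -/s mulrC divfK// gt_eqF.
  rewrite normrM (ger0_norm (ltW s0)) powRM ?(ltW s0)//; congr (_ * _).
  have [x0|x0] := leP 0 (normalized T N i).
    by rewrite max_r ?oppr_le0// powR0 ?gt_eqF// addr0 ger0_norm.
  by rewrite max_l ?oppr_ge0 ?(ltW x0)// powR0 ?gt_eqF// add0r ltr0_norm.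
exists (a + b - 2 * half_moment r); last by rewrite E; congr (_ * _); ring.
have -> : a + b - 2 * half_moment r = (a - half_moment r) + (b - half_moment r) by ring.
apply: le_trans (ler_normD _ _) _.
by rewrite -mulrA mulr_natl mulr2n lerD.
Unshelve. all: by end_near. Qed.

End MomentAsymptotics.

(** * Uniformity over all N from 16 on *)

Section Uniformity.
Context {R : realType}.
Local Notation ln := (@ln R).

(** The first diagonal Pade approximant. The difference [2 + y - exp(y) (2 - y)] has derivative
    [1 - (1 - y) exp y], nonnegative since [1 - y <= exp(- y)]. *)
Lemma expR_le_pade (x : R) : 0 <= x -> x < 2 -> expR x <= (2 + x) / (2 - x).
Proof.
move=> x0 x2; rewrite ler_pdivlMr ?subr_gt0//.
have D (y : R) : is_derive y (1:R) (fun y => 2 + y - expR y * (2 - y)) (1 - (1 - y) * expR y).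
  apply: is_derive_eq; rewrite /GRing.scale/=; ring.
have := nondecreasing_derive _ _ D _ 0 x x0.
rewrite expR0; suff h : forall y : R, 0 <= 1 - (1 - y) * expR y by move=> /(_ h); lra.
move=> y; rewrite subr_ge0 -[leRHS](@expRxMexpNx_1 R y) mulrC.
by rewrite ler_wpM2l ?expR_ge0//; exact: expR_ge1Dx.
Qed.

(** The reason for the threshold 16: it makes [log_3 N] positive. The Pade bound is used at 1/4 to
    estimate [e], and near [e / 16] to estimate the sixteenth root. *)
Lemma expR_e_lt16 : expR (expR 1) < 16 :> R.
Proof.
have le_exp (x y : R) (n : nat) : 0 <= x -> x <= y -> x ^+ n <= y ^+ n.
  by move=> x0 xy; rewrite lerXn2r ?nnegrE//; exact: le_trans xy.
have e1 : expR 1 <= 2733 / 1000 :> R.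
  have -> : expR 1 = expR 4^-1 ^+ 4 :> R by rewrite -expRM_natl divff.
  apply: (@le_trans _ _ ((9 / 7) ^+ 4)); last by lra.
  apply: le_exp (expR_ge0 _) _.
  apply: le_trans (expR_le_pade 4^-1 _ _) _; [lra|lra|].
  by rewrite ler_pdivrMr; lra.
have {1}-> : expR 1 = 16 * (expR 1 / 16) :> R by rewrite mulrC divfK.
rewrite expRM_natl (exprM _ 4 4).
have e16 : expR (expR 1 / 16) <= 1187 / 1000 :> R.
  apply: (@le_trans _ _ (expR (2733 / 16000))); first by rewrite ler_expR; lra.
  apply: le_trans (expR_le_pade _ _ _) _; [lra|lra|].
  by rewrite ler_pdivrMr; lra.
apply: (@le_lt_trans _ _ ((1986 / 1000) ^+ 4)); last by lra.
apply: (le_exp _ _ 4); first by apply: exprn_ge0; exact: expR_ge0.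
apply: (@le_trans _ _ ((1187 / 1000) ^+ 4)); last by lra.
exact: le_exp (expR_ge0 _) e16.
Qed.

Lemma log_iter2_gt1 (N : nat) : (16 <= N)%N -> 1 < ln (ln N%:R).
Proof.
move=> N16.
have N0 : 0 < N%:R :> R by rewrite ltr0n; case: (N) N16.
have h : expR 1 < ln N%:R.
  rewrite -ltr_expR lnK ?posrE//; apply: lt_le_trans expR_e_lt16 _.
  by rewrite (ler_nat R 16).
by rewrite -ltr_expR lnK// posrE; apply: lt_trans h; exact: expR_gt0.
Qed.

(** Only finitely many [N] lie below the asymptotic range, and a maximum of their individual
    constants serves them all. *)
Lemma eventually_uniform (P : nat -> R -> Prop) :
  (forall N C C', (16 <= N)%N -> C <= C' -> P N C -> P N C') ->
  (forall N, (16 <= N)%N -> exists C, P N C) ->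
  (exists2 C, 0 <= C & \forall T \near +oo, forall N : nat, T = ln (ln N%:R) -> P N C) ->
  exists C, forall N, (16 <= N)%N -> P N C.
Proof.
move=> mono ind [C C0 [M [_ HM]]].
pose N1 := (Num.truncn (expR (expR (M + 1)))).+1.
have [C' HC'] : exists C', forall N, (N < N1)%N -> (16 <= N)%N -> P N C'.
  elim: N1 => [|n [C1 H1]]; first by exists 0.
  have [n16|n16] := leqP 16 n; last first.
    exists C1 => N; rewrite ltnS leq_eqVlt => /predU1P[->|]; last exact: H1.
    by rewrite leqNgt n16.
  have [C2 H2] := ind n n16; exists (Num.max C1 C2) => N.
  rewrite ltnS leq_eqVlt => /predU1P[->|Nn] N16.
    by apply: mono H2 => //; rewrite le_max lexx orbT.
  by apply: mono (H1 N Nn N16) => //; rewrite le_max lexx.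
exists (Num.max C C') => N N16.
have [NN|NN] := ltnP N N1.
  by apply: mono (HC' N NN N16) => //; rewrite le_max lexx orbT.
apply: (mono N C) => //; first by rewrite le_max lexx.
apply: (HM (ln (ln N%:R))) => //.
have h : expR (expR (M + 1)) <= N%:R.
  by apply: le_trans (ltW (truncnS_gt _)) _; rewrite ler_nat.
have N0 : 0 < N%:R :> R by apply: lt_le_trans h; exact: expR_gt0.
have h2 : expR (M + 1) <= ln N%:R by rewrite -ler_expR lnK ?posrE.
have l0 : 0 < ln N%:R by apply: lt_le_trans h2; exact: expR_gt0.
apply: (@lt_le_trans _ _ (M + 1)); first by rewrite ltrDl.
by rewrite -ler_expR lnK ?posrE.
Qed.

Lemma relative_error_uniform (S E rate : nat -> R) (m : R) :
  (forall N, (16 <= N)%N -> 0 < E N) -> (forall N, (16 <= N)%N -> 0 < rate N) ->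
  (exists2 C, 0 <= C & \forall T \near +oo, forall N : nat, T = ln (ln N%:R) ->
     exists2 e, `|e| <= C * rate N & S N = E N * (m + e)) ->
  exists C, forall N, (16 <= N)%N -> exists2 e, `|e| <= C * rate N & S N = E N * (m + e).
Proof.
move=> E0 rate0; apply: eventually_uniform => [N C C' N16 CC' [e he hS]|N N16].
  by exists e => //; apply: le_trans he _; rewrite ler_wpM2r// ltW// rate0.
exists (`|S N / E N - m| / rate N), (S N / E N - m).
  by rewrite divfK// gt_eqF// rate0.
by rewrite addrC subrK mulrC divfK// gt_eqF// E0.
Qed.

End Uniformity.

Theorem theorem1 (R : realType) (z : R) (hz : 0 <= z) :
  [/\ exists C : R, forall (t : R) (N : nat), (16 <= N)%N ->
        `| N%:R^-1 * (\sum_(1 <= n < N.+1 |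
              gap_dev z N n <= t * Num.sqrt (gamma z * log_iter 2 N%:R)) 1)
           - Phi t |
        <= C * (log_iter 3 N%:R / Num.sqrt (log_iter 2 N%:R)),
      forall r : nat, exists C : R, forall N : nat, (16 <= N)%N ->
        exists2 e : R,
          `| e | <= C * (log_iter 3 N%:R `^ (1 + r%:R / 2)
                         / Num.sqrt (log_iter 2 N%:R))
        & N%:R^-1 * (\sum_(1 <= n < N.+1) gap_dev z N n ^+ r)
          = (gamma z * log_iter 2 N%:R) `^ (r%:R / 2) * (normal_moment r + e)
    & forall r : R, 0 <= r -> exists C : R, forall N : nat, (16 <= N)%N ->
        exists2 e : R,
          `| e | <= C * (log_iter 3 N%:R `^ (1 + r / 2)
                         / Num.sqrt (log_iter 2 N%:R))
        & N%:R^-1 * (\sum_(1 <= n < N.+1) `| gap_dev z N n | `^ r)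
          = (gamma z * log_iter 2 N%:R) `^ (r / 2)
            * (2 `^ (r / 2) * Gamma (r / 2 + 1 / 2) / Num.sqrt pi + e) ].
Proof.
have /andP[g0 _] := gamma_bounds z hz.
have T1 := @log_iter2_gt1 R.
have T0 N (h : (16 <= N)%N) : 0 < exp.ln (exp.ln N%:R) :> R := lt_trans ltr01 (T1 N h).
have lT0 N (h : (16 <= N)%N) : 0 < exp.ln (exp.ln (exp.ln N%:R)) :> R := ln_gt0 (T1 N h).
have rate0 (r : R) N (h : (16 <= N)%N) : 0 < moment_rate r (exp.ln (exp.ln N%:R)).
  by rewrite divr_gt0 ?sqrtr_gt0 ?T0// powR_gt0// lT0.
have E0 (r : R) N (h : (16 <= N)%N) : 0 < (gamma z * exp.ln (exp.ln N%:R)) `^ (r / 2).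
  by rewrite powR_gt0// mulr_gt0 ?T0.
split.
- have PrE (t : R) N : N%:R^-1 * (\sum_(1 <= n < N.+1 |
     gap_dev z N n <= t * Num.sqrt (gamma z * log_iter 2 N%:R)) 1) =
     Pr (unif N) (fun i => gap_dev z N i.+1 <= t * Num.sqrt (gamma z * log_iter 2 N%:R)).
    rewrite /Pr (Ex_unif N (fun n => (gap_dev z N n <= t * Num.sqrt (gamma z * log_iter 2 N%:R))%R%:R)).
    by rewrite big_mkcond; congr (_ * _); apply: eq_bigr => n _; case: ifP.
  have [C HC] : exists C : R, forall N : nat, (16 <= N)%N -> forall t : R,
     `|Pr (unif N) (fun i => gap_dev z N i.+1 <= t * Num.sqrt (gamma z * exp.ln (exp.ln N%:R))) - Phi t| <=
     C * (exp.ln (exp.ln (exp.ln N%:R)) / Num.sqrt (exp.ln (exp.ln N%:R))).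
    have rt N (h : (16 <= N)%N) : 0 < exp.ln (exp.ln (exp.ln N%:R)) / Num.sqrt (exp.ln (exp.ln N%:R)) :> R.
      by rewrite divr_gt0 ?sqrtr_gt0 ?T0 ?lT0.
    apply: eventually_uniform => [N C C' N16 CC' H t|N N16|].
    + by apply: le_trans (H t) _; rewrite ler_wpM2r// ltW// rt.
    (* For a single [N] the bound is normalized to 1, which dominates the difference of two numbers
       in [[0, 1]] for every [t]. *)
    + exists (exp.ln (exp.ln (exp.ln N%:R)) / Num.sqrt (exp.ln (exp.ln N%:R)))^-1 => t.
      rewrite mulVf ?gt_eqF ?rt//.
      have dU : is_distr (@unif R N) by apply: unif_distr; case: (N) N16.
      have := Phi_ge0 t; have := Phi_le1 t; rewrite ler_norml.
      set p := Pr _ _.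
      have := Pr_ge0 _ _ dU : 0 <= p; have := Pr_le1 _ _ dU : p <= 1.
      by move=> ? ? ? ?; apply/andP; split; lra.
    + have [C C0 H] := dist_asym z hz; exists C => //.
      by apply: filterS H => T HT N TE t; rewrite -TE; exact: HT.
  by exists C => t N N16; rewrite PrE; exact: HC.
- move=> r; apply: (relative_error_uniform
    (fun N => N%:R^-1 * (\sum_(1 <= n < N.+1) gap_dev z N n ^+ r))
    (fun N => (gamma z * exp.ln (exp.ln N%:R)) `^ (r%:R / 2))
    (fun N => moment_rate r%:R (exp.ln (exp.ln N%:R))) (normal_moment r)) => //; [exact: E0|exact: rate0|].
  have [C C0 H] := moment_asym z hz r; exists C => //.
  apply: filterS H => T HT N TE; rewrite -TE -Ex_unif; exact: HT.
- move=> r r0; rewrite Gamma_half_momentE//; apply: (relative_error_uniform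
    (fun N => N%:R^-1 * (\sum_(1 <= n < N.+1) `|gap_dev z N n| `^ r))
    (fun N => (gamma z * exp.ln (exp.ln N%:R)) `^ (r / 2))
    (fun N => moment_rate r (exp.ln (exp.ln N%:R))) (2 * half_moment r)) => //; [exact: E0|exact: rate0|].
  have [C C0 H] := abs_moment_asym z hz r r0; exists C => //.
  apply: filterS H => T HT N TE; rewrite -TE -(Ex_unif N (fun n => `|gap_dev z N n| `^ r)); exact: HT.
Qed.
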